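(* Let $n\ge 3$, $N\ge 1$, $m\ge 1$ be integers and $0<\alpha<1$. Let $a=a(p_0,p_1,\ldots,p_{2m})$ be an $\mathbb{R}^N$-valued function, where $p_j$ is the slot of $\nabla^j u$. If $a\in\mathcal{C}^2$ and $a(0)=\nabla a(0)=0$, then for any $R>0$ there exist infinitely many solutions $u=(u_1,\ldots,u_N)$ in the class $\mathcal{C}^{2m,\alpha}$ to the autonomous system $$\triangle^m u=a(u,\nabla u,\ldots,\nabla^{2m}u)$$ in $\{x\in\mathbb{R}^n:|x|<R\}$. Moreover, all those solutions are of vanishing order $2m$ at $0$ and are not radially symmetric.
   Context: $\triangle$ is the Laplacian on $\mathbb{R}^n$ (acting componentwise) and $\triangle^m$ its $m$-th iterate. $\nabla^j u$ denotes the collection of all $j$-th order partial derivatives of all components of $u$, i.e. $(D^\beta u_l)_{|\beta|=j,\,1\le l\le N}$, with $\nabla^0u=u$. The function $a$ is defined on the whole Euclidean space of its variables and $\nabla a$ is its gradient with respect to all its variables. $u$ is of class $\mathcal{C}^{2m,\alpha}$ on the ball if its partial derivatives up to order $2m$ exist and are continuous and those of order $2m$ are Hölder continuous with exponent $\alpha$. A function $u\in\mathcal{C}^k$ is of vanishing order $l$ ($l\le k$) at $0$ if $\nabla^j u(0)=0$ for $0\le j\le l-1$ and $\nabla^l u(0)\ne 0$. A function is radially symmetric if it depends only on $|x|$. ''All those solutions'' refers to the infinitely many solutions asserted to exist. *)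

(* Defs.v *)
From HB Require Import structures.
From mathcomp Require Import all_boot all_order all_algebra.
From mathcomp Require Import all_classical all_reals all_analysis.

Set Implicit Arguments.
Unset Strict Implicit.
Unset Printing Implicit Defensive.

Import Order.TTheory GRing.Theory Num.Theory.
Import numFieldNormedType.Exports.

Local Open Scope classical_set_scope.
Local Open Scope ring_scope.

Section Defs.
Context {R : realType}.

(* The library norm on ['rV[R]_n] is the max norm, hence this definition. *)
Definition enorm n (x : 'rV[R]_n) : R := Num.sqrt (\sum_(i < n) x 0 i ^+ 2).

Definition eball n (r : R) : set 'rV[R]_n := [set x | enorm x < r].

Definition partial n (i : 'I_n) (f : 'rV[R]_n -> R) : 'rV[R]_n -> R :=
  fun x => 'D_(delta_mx 0 i) f x.

(* [partials [:: i1; ..; ik] f] is d_i1 (.. (d_ik f)); no symmetry is assumed. *)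
Definition partials n (s : seq 'I_n) (f : 'rV[R]_n -> R) : 'rV[R]_n -> R :=
  foldr (@partial n) f s.

Definition mlen n (b : 'I_n -> nat) : nat := (\sum_(i < n) b i)%N.

(* D^b for a multi-index b, with a fixed order of differentiation
   (immaterial for functions of class C^|b|). *)
Definition Dmulti n (b : 'I_n -> nat) (f : 'rV[R]_n -> R) : 'rV[R]_n -> R :=
  partials (flatten [seq nseq (b i) i | i <- enum 'I_n]) f.

(* Meant for open sets W: all iterated partial derivatives of order at most k,
   in every order of differentiation, exist and are continuous on W. *)
Definition class_C n (W : set 'rV[R]_n) (k : nat) (f : 'rV[R]_n -> R) : Prop :=
  forall s : seq 'I_n,
    ((size s < k)%N -> forall (i : 'I_n) x, W x ->
        derivable (partials s f) x (delta_mx 0 i)) /\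
    ((size s <= k)%N -> forall x, W x -> {for x, continuous (partials s f)}).

Definition holder_on n (W : set 'rV[R]_n) (al : R) (f : 'rV[R]_n -> R) : Prop :=
  exists C : R, forall x y, W x -> W y ->
    `|f x - f y| <= C * enorm (x - y) `^ al.

Definition class_C_holder n (W : set 'rV[R]_n) (k : nat) (al : R)
    (f : 'rV[R]_n -> R) : Prop :=
  class_C W k f /\
  forall b : 'I_n -> nat, mlen b = k -> holder_on W al (Dmulti b f).

Definition laplacian n (f : 'rV[R]_n -> R) : 'rV[R]_n -> R :=
  fun x => \sum_(i < n) partial i (partial i f) x.

Definition coordf n N (u : 'rV[R]_n -> 'rV[R]_N) (l : 'I_N) : 'rV[R]_n -> R :=
  fun x => u x 0 l.

Definition laplacian_iter n N (m : nat) (u : 'rV[R]_n -> 'rV[R]_N) :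
    'rV[R]_n -> 'rV[R]_N :=
  fun x => \row_l iter m (@laplacian n) (coordf u l) x.

(* Indices (b, l) of the derivatives D^b u_l with |b| <= k; those with |b| = j
   index the slot p_j. *)
Definition jet_index (n N k : nat) :=
  {bl : {ffun 'I_n -> 'I_k.+1} * 'I_N | (mlen (fun i => bl.1 i : nat) <= k)%N}.

Definition jet_dim (n N k : nat) : nat := #|{: jet_index n N k}|.

(* The vector (u(x), nabla u(x), ..., nabla^k u(x)). *)
Definition jet n N (k : nat) (u : 'rV[R]_n -> 'rV[R]_N) (x : 'rV[R]_n) :
    'rV[R]_(jet_dim n N k) :=
  \row_(q < jet_dim n N k)
    let bl := val (enum_val q : jet_index n N k) in
    Dmulti (fun i => bl.1 i : nat) (coordf u bl.2) x.

Definition vanishing_order0 n N (u : 'rV[R]_n -> 'rV[R]_N) (l : nat) : Prop :=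
  (forall (b : 'I_n -> nat) (c : 'I_N),
      (mlen b < l)%N -> Dmulti b (coordf u c) 0 = 0) /\
  (exists (b : 'I_n -> nat) (c : 'I_N),
      mlen b = l /\ Dmulti b (coordf u c) 0 <> 0).

Definition radial_on n N (W : set 'rV[R]_n) (u : 'rV[R]_n -> 'rV[R]_N) : Prop :=
  exists g : R -> 'rV[R]_N, forall x, W x -> u x = g (enorm x).

End Defs.

Arguments eball {R} n r _.

(* Main.v *)
Require Import Defs.
From HB Require Import structures.
From mathcomp Require Import all_boot all_order all_algebra.
From mathcomp Require Import all_classical all_reals all_analysis.
From mathcomp Require Import zify ring lra.

(** The solutions depend on the first two coordinates X, Y only. As [n >=
    3], every sphere contains a point with X = Y = 0, so that such a
    function, if it vanishes at 0 and is radial, vanishes identically. What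
    remains is to solve the system in the plane with all derivatives of
    order below 2m vanishing at 0 and a small nonzero derivative D_X^(2m-1)
    D_Y, which is the content of [plane_solutions].

    Since [a] vanishes to second order at 0, the right-hand side of the
    equation is quadratically small for small jets, and there should be a
    solution close to each small multiple of the polyharmonic polynomial
    X^(2m-1) Y. The unknown is taken to be f = Delta^m v. On a torus larger
    than the ball, Delta^m has an inverse K on functions of mean zero, and
    v = K f + P solves Delta^m v = f for a polynomial P that restores the
    mean of f, cancels the derivatives of K f of order below 2m at 0, and
    adds eps X^(2m-1) Y / (2m-1)!. The equation becomes the fixed point
    problem f = a(jet of K f + P). The derivatives of order 2m of K f are
    of order zero in f: Fourier multipliers bounded by a constant. They are
    therefore bounded on the Sobolev spaces H^1 and H^2, whose norms are
    computed from Fourier coefficients.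

    In two dimensions the product of two functions of H^1 is in L^2 (an
    Agmon inequality in each variable, [product_estimate]). Hence composing
    with a function of class C^2 that vanishes to second order maps a ball
    of radius s of H^2 into one of radius O(s^2) ([sob2p_comp]), and is
    Lipschitz for the H^1 norm with constant O(s) on that ball
    ([sob1_comp]). The contraction has to be measured in H^1, as no third
    derivative of [a] is available. For eps small the fixed point map then
    preserves a ball of radius kappa eps of H^2 and halves H^1 distances.

    To avoid Fourier series and completeness of function spaces, the
    iteration is run on the square grid with (2p+1)^2 points of the torus,
    where the Fourier transform is a finite sum and derivatives of f are
    replaced by difference quotients. This gives approximate fixed points
    with bounds uniform in p ([approximate_solutions]). Their Fourier
    coefficients define trigonometric polynomials on the plane, whose
    derivatives up to order 2m after applying K are Hoelder continuous with
    a constant independent of p, because the sum of (1 + |k|^2)^(alpha - 2)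
    over k in Z^2 is finite ([holder_weight_bound], [energy_holder]). They
    converge along an ultrafilter on the values of p, and equi-Hoelder
    derivatives pass to the limit ([holder_limit_derive]). As the grid
    becomes dense, the limit solves the equation.

    Finally, the derivative D_X^(2m-1) D_Y at 0 lies between eps / 2 and 3
    eps / 2, so that the parameters eps = eps0 4^-j give pairwise different
    solutions. *)

Set Implicit Arguments.
Unset Strict Implicit.
Unset Printing Implicit Defensive.

Import Order.TTheory GRing.Theory Num.Theory.
Import numFieldNormedType.Exports.

Local Open Scope classical_set_scope.
Local Open Scope ring_scope.

(** * Functions of class C^2 that vanish to second order *)

Section CompositionEstimates.
Context {R : realType}.

Lemma le_of_eq (x y : R) : x = y -> x <= y.
Proof. by move=> ->. Qed.

Lemma is_derive_line n (f : 'rV[R]_n -> R) (x v : 'rV[R]_n) (s : R) :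
  derivable f (x + s *: v) v ->
  is_derive s 1 (fun t : R => f (x + t *: v)) ('D_v f (x + s *: v)).
Proof.
move=> df.
have E : (fun h : R => h^-1 *: (((fun t => f (x + t *: v)) \o shift s) (h *: (1 : R))
              - f (x + s *: v)))
       = (fun h : R => h^-1 *: ((f \o shift (x + s *: v)) (h *: v)
              - f (x + s *: v))).
  apply/funext => h /=; congr (_ *: (f _ - _)).
  by rewrite [h *: 1]mulr1 scalerDl addrCA.
split; first by rewrite /derivable E.
by rewrite /derive E.
Qed.

Lemma mean_value01 (g dg : R -> R) :
  (forall t : R, is_derive t 1 g (dg t)) ->
  exists2 c, 0 <= c <= 1 & g 1 - g 0 = dg c.
Proof.
move=> H.
have H1 (x : R) : x \in `]0, 1[%R -> is_derive x 1 g (dg x) by move=> _; exact: H.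
have H2 : {within `[0, 1], continuous g}.
  by apply: derivable_within_continuous => x _; have := H x => -[].
have [c] := @MVT_segment R g dg 0 1 ler01 H1 H2.
rewrite in_itv /= => c01; rewrite subr0 mulr1 => E.
by exists c.
Qed.

Lemma ler_term (I : finType) (g : I -> R) i :
  (forall i, 0 <= g i) -> g i <= \sum_i g i.
Proof. by move=> g0; rewrite (bigD1 i) //= lerDl sumr_ge0. Qed.

(** The l^1 norm is the convenient one here: it bounds each coordinate, and
    first order expansions along the coordinate axes are sums over the
    coordinates. *)
Definition l1 d (x : 'rV[R]_d) : R := \sum_(i < d) `|x 0 i|.

Lemma l1_ge0 d (x : 'rV[R]_d) : 0 <= l1 x.
Proof. exact: sumr_ge0. Qed.

Lemma ler_l1 d (x : 'rV[R]_d) i : `|x 0 i| <= l1 x.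
Proof. exact: (@ler_term _ (fun i => `|x 0 i|)). Qed.

Lemma l1N d (x : 'rV[R]_d) : l1 (- x) = l1 x.
Proof. by rewrite /l1; apply: eq_bigr => i _; rewrite mxE normrN. Qed.

(** One parameter for each coordinate: the points met when going from [x]
    to [x'] along the coordinate axes have this form. *)
Definition between d (s : 'I_d -> R) (x x' : 'rV[R]_d) : 'rV[R]_d :=
  \row_i (x 0 i + s i * (x' 0 i - x 0 i)).

(** The segments from [x] to [x'] and from [y] to [y'] are replaced by
    chains that change one coordinate at a time, and the mean value theorem
    is applied to the difference of the two restrictions. The point is that
    the same parameters [s] serve both chains, so that the two derivatives
    are taken at corresponding points and can be compared. *)
Lemma mean_value_two_chains d (F : 'rV[R]_d -> R) (x x' y y' : 'rV[R]_d) :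
  (forall (k : 'I_d) z, derivable F z (delta_mx 0 k)) ->
  exists s : 'I_d -> 'I_d -> R,
    (forall k i, 0 <= s k i <= 1) /\
    F x' - F x - (F y' - F y) =
    \sum_k (partial k F (between (s k) x x') * (x' 0 k - x 0 k)
          - partial k F (between (s k) y y') * (y' 0 k - y 0 k)).
Proof.
move=> dF.
(* The k-th step of the chain: the coordinates before the k-th one have
   reached their target and the k-th one is at time t. *)
pose st (k : nat) (t : R) (i : 'I_d) : R :=
  if (i < k)%N then 1 else if i == k :> nat then t else 0.
have stD (k : 'I_d) t (a a' : 'rV[R]_d) : between (st k t) a a' =
    between (st k 0) a a' + (t * (a' 0 k - a 0 k)) *: delta_mx 0 k.
  apply/rowP => i; rewrite !mxE eqxx /= /st.
  case: ltnP => [ik|ki].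
    by rewrite (_ : (i == k) = false) ?mulr0 ?addr0//; apply/negbTE; rewrite neq_ltn ik.
  rewrite -(inj_eq val_inj) /=; case: eqP => [/val_inj->|_].
    by rewrite mul0r addr0 mulr1.
  by rewrite mulr0 addr0.
have der (k : 'I_d) (a a' : 'rV[R]_d) (t : R) :
    is_derive t 1 (fun t => F (between (st k t) a a'))
      (partial k F (between (st k t) a a') * (a' 0 k - a 0 k)).
  pose z := between (st k 0) a a'.
  have -> : (fun t => F (between (st k t) a a')) =
     (fun u : R => F (z + u *: delta_mx 0 k)) \o (fun t => t * (a' 0 k - a 0 k)).
    by apply/funext => u /=; rewrite stD.
  have D1 := @is_derive_line d F z (delta_mx 0 k) (t * (a' 0 k - a 0 k)) (dF _ _).
  have D2 : is_derive t 1 (fun t : R => t * (a' 0 k - a 0 k)) (a' 0 k - a 0 k).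
    by apply: is_derive_eq; rewrite scaler0 add0r [_ *: 1]mulr1.
  have := @is_derive1_comp R _ _ t _ _ D1 D2.
  by rewrite stD.
have step (k : 'I_d) : exists c : R, 0 <= c <= 1 /\
    (F (between (st k.+1 0) x x') - F (between (st k.+1 0) y y'))
    - (F (between (st k 0) x x') - F (between (st k 0) y y')) =
    partial k F (between (st k c) x x') * (x' 0 k - x 0 k)
          - partial k F (between (st k c) y y') * (y' 0 k - y 0 k).
  have [c c01 E] := @mean_value01 (fun t => F (between (st k t) x x') -
     F (between (st k t) y y'))
     (fun c => partial k F (between (st k c) x x') * (x' 0 k - x 0 k)
          - partial k F (between (st k c) y y') * (y' 0 k - y 0 k)).
  exists c; split => //; rewrite -E.
  have Est a a' : between (st k.+1 0) a a' = between (st k 1) a a'.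
    apply/rowP => i; rewrite !mxE /st ltnS leq_eqVlt.
    by case: (ltngtP i k) => //= _; rewrite ?if_same.
  by rewrite !Est.
have [c cP] := choice step.
exists (fun k : 'I_d => st k (c k)); split.
  move=> k i; rewrite /st; case: ifP => _; first by rewrite ler01 lexx.
  by case: ifP => _; [exact: (cP k).1 | rewrite ler01 lexx].
pose g (k : nat) := F (between (st k 0) x x') - F (between (st k 0) y y').
transitivity (\sum_(k < d) (g k.+1 - g k)).
  rewrite -(big_mkord xpredT (fun k => g k.+1 - g k)) telescope_sumr // /g.
  have E0 a a' : between (st 0%N 0) a a' = a.
    by apply/rowP => i; rewrite !mxE /st /= if_same mul0r addr0.
  have E1 a a' : between (st d 0) a a' = a'.
    by apply/rowP => i; rewrite !mxE /st /= ltn_ord mul1r addrC subrK.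
  by rewrite !E0 !E1; ring.
by apply: eq_bigr => k _; rewrite (cP k).2.
Qed.

Lemma subr_mxE d (x y : 'rV[R]_d) k : (x - y) 0 k = x 0 k - y 0 k.
Proof. by rewrite !mxE. Qed.

Lemma mean_value_chain d (F : 'rV[R]_d -> R) (x y : 'rV[R]_d) :
  (forall (k : 'I_d) z, derivable F z (delta_mx 0 k)) ->
  exists s : 'I_d -> 'I_d -> R,
    (forall k i, 0 <= s k i <= 1) /\
    F y - F x = \sum_k partial k F (between (s k) x y) * (y - x) 0 k.
Proof.
move=> dF; have [s [s01 E]] := mean_value_two_chains x y x x (@dF).
exists s; split => //; move: E; rewrite subrr subr0 => ->.
apply: eq_bigr => k _; rewrite subr_mxE subrr.
by move: (partial k F _) (partial k F _) => p p'; rewrite mulr0 subr0.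
Qed.

Lemma l1_between d (s : 'I_d -> R) (x x' : 'rV[R]_d) :
  (forall i, 0 <= s i <= 1) -> l1 (between s x x') <= l1 x + l1 x'.
Proof.
move=> s01; rewrite /l1 -big_split /=; apply: ler_sum => i _.
have /andP[s0 s1] := s01 i; rewrite mxE.
have -> : x 0 i + s i * (x' 0 i - x 0 i) = (1 - s i) * x 0 i + s i * x' 0 i.
  by ring.
apply: (le_trans (ler_normD _ _)); rewrite !normrM ger0_norm ?subr_ge0//.
rewrite (ger0_norm s0) lerD// ler_piMl// lerBlDr lerDl//.
Qed.

Lemma l1_betweenB d (s : 'I_d -> R) (x x' y y' : 'rV[R]_d) :
  (forall i, 0 <= s i <= 1) ->
  l1 (between s x x' - between s y y') <= l1 (x - y) + l1 (x' - y').
Proof.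
move=> s01; have -> : between s x x' - between s y y' = between s (x - y) (x' - y').
  by apply/rowP => i; rewrite !mxE; ring.
exact: l1_between.
Qed.

Lemma l1_betweenBl d (s : 'I_d -> R) (x x' : 'rV[R]_d) :
  (forall i, 0 <= s i <= 1) -> l1 (between s x x' - x) <= l1 (x' - x).
Proof.
move=> s01; rewrite /l1; apply: ler_sum => i _.
have /andP[s0 s1] := s01 i; rewrite !mxE.
by rewrite addrAC subrr add0r normrM (ger0_norm s0) ler_piMl.
Qed.

Lemma ler_sum_l1 d (g : 'I_d -> R) (y : 'rV[R]_d) (K : R) :
  (forall k, `|g k| <= K) -> `|\sum_k g k * y 0 k| <= K * l1 y.
Proof.
move=> gK; apply: (le_trans (ler_norm_sum _ _ _)).
rewrite /l1 mulr_sumr; apply: ler_sum => k _.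
by rewrite normrM ler_wpM2r.
Qed.

Section C2estimates.
Variables (d : nat) (F : 'rV[R]_d -> R) (C rho : R).
Hypothesis dF : forall (k : 'I_d) z, derivable F z (delta_mx 0 k).
Hypothesis ddF : forall (q k : 'I_d) z, derivable (partial q F) z (delta_mx 0 k).
Hypothesis F0 : F 0 = 0.
Hypothesis gradF0 : forall q, partial q F 0 = 0.
Hypothesis C_ge0 : 0 <= C.
Hypothesis hessF : forall q k x, l1 x <= rho -> `|partial k (partial q F) x| <= C.

Lemma partial_lipschitz q x y : l1 x + l1 y <= rho ->
  `|partial q F y - partial q F x| <= C * l1 (y - x).
Proof.
move=> xy; have [s [s01 ->]] := mean_value_chain x y (@ddF q).
apply: ler_sum_l1 => k; apply: hessF.
by apply: le_trans xy; exact: l1_between.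
Qed.

Lemma partial_small q x : l1 x <= rho -> `|partial q F x| <= C * l1 x.
Proof.
have l10 : l1 (0 : 'rV[R]_d) = 0.
  by rewrite /l1 big1// => i _; rewrite mxE normr0.
by move=> xr; have := @partial_lipschitz q 0 x; rewrite l10 add0r gradF0 !subr0; apply.
Qed.

Lemma C2_lipschitz x y : l1 x + l1 y <= rho ->
  `|F y - F x| <= C * (l1 x + l1 y) * l1 (y - x).
Proof.
move=> xy; have [s [s01 ->]] := mean_value_chain x y (@dF).
apply: ler_sum_l1 => k; have le1 := l1_between x y (s01 k).
apply: (le_trans (partial_small _ (le_trans le1 xy))).
by rewrite ler_wpM2l.
Qed.

Lemma C2_quadratic x : l1 x <= rho -> `|F x| <= C * l1 x ^+ 2.
Proof.
have l10 : l1 (0 : 'rV[R]_d) = 0.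
  by rewrite /l1 big1// => i _; rewrite mxE normr0.
by move=> xr; have := @C2_lipschitz 0 x; rewrite l10 add0r F0 !subr0 expr2 mulrA; apply.
Qed.

Lemma C2_taylor x y : l1 x + (l1 x + l1 y) <= rho ->
  `|F y - F x - \sum_q partial q F x * (y - x) 0 q| <= C * l1 (y - x) ^+ 2.
Proof.
move=> xy; have [s [s01 ->]] := mean_value_chain x y (@dF).
rewrite -sumrB.
rewrite (eq_bigr (fun k => (partial k F (between (s k) x y) - partial k F x) *
  (y - x) 0 k)); last first.
  by move=> k _; rewrite mulrBl.
rewrite expr2 mulrA; apply: ler_sum_l1 => k.
apply: (le_trans (partial_lipschitz _ _)).
  by apply: le_trans xy; rewrite lerD2l l1_between.
by rewrite ler_wpM2l// l1_betweenBl.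
Qed.

(** Expanding at the middle point [y] turns a second difference of [F] into
    its gradient, which is small, applied to the second difference of the
    arguments, up to squares of the first differences. *)
Lemma C2_second_difference x y z :
  l1 y + (l1 y + l1 x) <= rho -> l1 y + (l1 y + l1 z) <= rho ->
  `|F z - 2 * F y + F x| <= C * l1 y * l1 (z - 2 *: y + x)
     + C * (l1 (z - y) ^+ 2 + l1 (y - x) ^+ 2).
Proof.
move=> yx yz; have T1 := C2_taylor yx; have T2 := C2_taylor yz.
have yr : l1 y <= rho by apply: le_trans yx; rewrite lerDl addr_ge0 ?l1_ge0.
have -> : F z - 2 * F y + F x = \sum_q partial q F y * (z - 2 *: y + x) 0 q
  + ((F z - F y - \sum_q partial q F y * (z - y) 0 q)
  + (F x - F y - \sum_q partial q F y * (x - y) 0 q)).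
  have -> : \sum_q partial q F y * (z - 2 *: y + x) 0 q =
    \sum_q partial q F y * (z - y) 0 q + \sum_q partial q F y * (x - y) 0 q.
    by rewrite -big_split /=; apply: eq_bigr => q _; rewrite !mxE; ring.
  by ring.
apply: (le_trans (ler_normD _ _)); apply: lerD.
  by apply: ler_sum_l1 => q; exact: partial_small.
apply: (le_trans (ler_normD _ _)); rewrite mulrDr; apply: lerD => //.
by rewrite -(l1N (y - x)) opprB.
Qed.

(** The discrete analogue of the product rule for D(F(V) - F(W)): either
    the difference of the increments appears with a small gradient, or the
    increment of one function appears with a difference of gradients. *)
Lemma C2_four_points x x' y y' : (l1 x + l1 x') + (l1 y + l1 y') <= rho ->
  `|F x' - F x - (F y' - F y)| <= C * (l1 x + l1 x') * l1 ((x' - x) - (y' - y))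
     + C * (l1 (x - y) + l1 (x' - y')) * l1 (y' - y).
Proof.
move=> xyr; have [s [s01 ->]] := mean_value_two_chains x x' y y' (@dF).
rewrite (eq_bigr (fun k => partial k F (between (s k) x x')
      * ((x' - x) - (y' - y)) 0 k
   + (partial k F (between (s k) x x') - partial k F (between (s k) y y'))
      * (y' - y) 0 k)); last first.
  move=> k _; move: (partial k F _) (partial k F _) => p p'.
  by rewrite !subr_mxE; ring.
rewrite big_split /=; apply: (le_trans (ler_normD _ _)); apply: lerD.
  apply: ler_sum_l1 => k; have le1 := l1_between x x' (s01 k).
  apply: (le_trans (partial_small _ _)); last by rewrite ler_wpM2l.
  apply: (le_trans le1); apply: le_trans xyr.
  by rewrite lerDl addr_ge0 ?l1_ge0.
apply: ler_sum_l1 => k.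
apply: (le_trans (partial_lipschitz _ _)).
  by apply: le_trans xyr; rewrite addrC lerD// l1_between.
by rewrite ler_wpM2l// l1_betweenB.
Qed.

End C2estimates.

(** Bounds near 0 suffice, since only small jets will be inserted. *)
Lemma class_C2_local_bounds d (F : 'rV[R]_d -> R) : class_C setT 2 F ->
  exists rho C : R, [/\ 0 < rho, 0 <= C &
    forall q k x, l1 x <= rho -> `|partial k (partial q F) x| <= C].
Proof.
move=> cF.
pose C := \sum_q \sum_k (`|partial k (partial q F) 0| + 1).
have : \forall x \near (0 : 'rV[R]_d), forall q k : 'I_d,
    `|partial k (partial q F) x| <= `|partial k (partial q F) 0| + 1.
  have H q k : \forall x \near (0 : 'rV[R]_d),
      `|partial k (partial q F) x| <= `|partial k (partial q F) 0| + 1; last first.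
    pose Q q k := [set x : 'rV[R]_d | `|partial k (partial q F) x| <=
      `|partial k (partial q F) 0| + 1].
    have H1 q : nbhs (0 : 'rV[R]_d) [set x | forall k, Q q k x].
      exact: (filter_forall (f := Q q) (nbhs_filter _) (H q)).
    exact: (filter_forall (f := fun q => [set x | forall k, Q q k x])
      (nbhs_filter _) H1).
  have [_ /(_ isT 0 I) ct] := cF [:: k; q].
  have /= := @cvgr_dist_le _ _ _ _ (nbhs_filter _) _ _ ct 1 ltr01.
  apply: (@filterS _ _ (nbhs_filter _)) => x /= H; rewrite -lerBlDl.
  by apply: le_trans H; rewrite distrC; exact: lerB_dist.
move=> /nbhs_ballP[e /= e0 He].
exists (e / 2), C; split; first by rewrite divr_gt0.
  by rewrite !sumr_ge0// => q _; rewrite sumr_ge0// => k _; rewrite addr_ge0.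
move=> q k x xe; apply: (@le_trans _ _ (`|partial k (partial q F) 0| + 1)).
  apply: He; split => // i j; rewrite (ord1 i) -ball_normE /= mxE sub0r normrN.
  rewrite (le_lt_trans (ler_l1 x j))// (le_lt_trans xe)//.
  by rewrite ltr_pdivrMr// ltr_pMr// ltr1n.
have ge0 i j : 0 <= `|partial j (partial i F) 0| + 1 by rewrite addr_ge0.
apply: (le_trans (ler_term k (ge0 q))).
by apply: (@ler_term _ (fun i => \sum_j (`|partial j (partial i F) 0| + 1)));
  move=> i; apply: sumr_ge0 => j _; exact: ge0.
Qed.

End CompositionEstimates.

Local Notation grid p := ('I_(2 * p).+1 * 'I_(2 * p).+1)%type.

(** * The Fourier transform on a periodic square grid *)

Section DiscreteFourier.
Context {R : realType}.
Variable p : nat.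
Local Notation M := ((2 * p).+1).
Local Notation I := ('I_(2 * p).+1).
Local Notation G := (grid p).

(** The indices 0, ..., 2p stand for the integers -p, ..., p. They serve
    both as wave numbers and as grid points. *)
Definition centred (j : I) : R := j%:R - p%:R.

Definition angle : R := 2 * pi / M%:R.

Lemma M_gt0 : 0 < M%:R :> R. Proof. by rewrite ltr0n. Qed.

Lemma M_neq0 : M%:R != 0 :> R. Proof. by rewrite pnatr_eq0. Qed.

Lemma ME : M%:R = 2 * p%:R + 1 :> R.
Proof. by rewrite -natr1 natrM. Qed.

Lemma sin_natpi n : sin (n%:R * pi) = 0 :> R.
Proof.
rewrite mulr_natl -[_ *+ n]add0r (alternatingn (@sinDpi R)) sin0.
by rewrite [LHS]mulr0.
Qed.

(** Multiplying by 2 sin eta makes the Dirichlet kernel telescope. *)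
Lemma sum_cos_telescope (eta : R) :
  2 * sin eta * \sum_(k < M) cos (2 * eta * centred k) = 2 * sin (M%:R * eta).
Proof.
pose g (k : nat) : R := sin (2 * eta * (k%:R - p%:R) - eta).
have gS k : g k.+1 - g k = 2 * sin eta * cos (2 * eta * (k%:R - p%:R)).
  have -> : g k.+1 = sin (2 * eta * (k%:R - p%:R) + eta).
    by rewrite /g -natr1; congr sin; ring.
  by rewrite /g sinD sinB; ring.
rewrite mulr_sumr; under eq_bigr do rewrite -gS.
rewrite -(big_mkord xpredT (fun k => g k.+1 - g k)) telescope_sumr // /g.
rewrite (_ : _ - eta = M%:R * eta); last by rewrite ME; ring.
rewrite (_ : 2 * eta * _ - eta = - (M%:R * eta)); last by rewrite ME; ring.
by rewrite sinN; ring.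
Qed.

Section OneDim.
Variables j j' : I.
Let eta : R := angle * (centred j - centred j') / 2.

Let etaE : eta = pi * (j%:R - j'%:R) / M%:R.
Proof.
rewrite /eta /angle /centred; have := M_neq0; move: (M%:R) => m m0.
by field.
Qed.

Let sin_Meta : sin (M%:R * eta) = 0.
Proof.
rewrite etaE mulrC divfK ?M_neq0// mulrBr sinB.
by rewrite ![pi * _]mulrC !sin_natpi; ring.
Qed.

Let sin_eta_neq0 : j != j' -> sin eta != 0.
Proof.
move=> jj; rewrite etaE.
have H (a b : I) : (a < b)%N -> 0 < sin (pi * (b%:R - a%:R) / M%:R) :> R.
  move=> ab; apply: sin_gt0_pi.
  have ab' : 0 < b%:R - a%:R :> R by rewrite subr_gt0 ltr_nat.
  rewrite divr_gt0 ?mulr_gt0 ?pi_gt0 ?M_gt0//=.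
  rewrite ltr_pdivrMr ?M_gt0// ltr_pM2l ?pi_gt0//.
  apply: (@le_lt_trans _ _ b%:R); last by rewrite ltr_nat.
  by rewrite lerBlDr lerDl.
move: jj; rewrite -(inj_eq val_inj) /= neq_ltn => /orP[/H h|/H h]; last first.
  by rewrite gt_eqF.
by rewrite -[_ - _]opprB mulrN mulNr sinN oppr_eq0 gt_eqF.
Qed.

Lemma sum_cos1 :
  \sum_k cos (angle * centred k * (centred j - centred j')) = if j == j' then M%:R else 0 :> R.
Proof.
case: eqVneq => [->|jj].
  under eq_bigr do rewrite subrr mulr0 cos0.
  by rewrite sumr_const card_ord.
have /eqP := sum_cos_telescope eta.
rewrite sin_Meta mulr0 mulf_eq0 mulf_eq0 pnatr_eq0 (negbTE (sin_eta_neq0 jj)) /=.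
move=> /eqP E; rewrite -[RHS]E; apply: eq_bigr => k _; congr cos.
by rewrite /eta; field.
Qed.

Lemma sum_sin1 : \sum_k sin (angle * centred k * (centred j - centred j')) = 0 :> R.
Proof.
set S := \sum_k _; suff : S = - S by lra.
rewrite {1}/S (reindex_inj rev_ord_inj) -sumrN; apply: eq_bigr => k _.
have -> : centred (rev_ord k) = - centred k.
  by rewrite /centred /= subSS natrB -1?ltnS// natrM; ring.
by rewrite mulrN mulNr sinN.
Qed.

End OneDim.

(** The phase of the [k]-th character at the grid point [x]. *)
Definition Phi (k x : G) : R := angle * (centred k.1 * centred x.1 + centred k.2 * centred x.2).

Lemma PhiC k x : Phi k x = Phi x k.
Proof. by rewrite /Phi; ring. Qed.

Let PhiB k x y : Phi k x - Phi k y =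
  angle * centred k.1 * (centred x.1 - centred y.1) + angle * centred k.2 * (centred x.2 - centred y.2).
Proof. by rewrite /Phi; ring. Qed.

(** Orthogonality of the characters of the grid: the double sum factors, by
    the addition formula, into one-dimensional ones. *)
Lemma sum_cos2 (x y : G) :
  \sum_k cos (Phi k x - Phi k y) = if x == y then M%:R ^+ 2 else 0 :> R.
Proof.
pose c i k := cos (angle * centred k * (centred (i x) - centred (i y))).
pose s i k := sin (angle * centred k * (centred (i x) - centred (i y))).
transitivity (\sum_k1 \sum_k2 (c fst k1 * c snd k2 - s fst k1 * s snd k2)).
  rewrite pair_bigA; apply: eq_bigr => k _.
  by rewrite PhiB cosD.
under eq_bigr do rewrite sumrB -!mulr_sumr.
rewrite sumrB -!mulr_suml /c /s !sum_cos1 !sum_sin1 mul0r subr0.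
have -> : (x == y) = (x.1 == y.1) && (x.2 == y.2) by [].
by do 2!case: eqP => _ /=; rewrite ?(mulr0, mul0r, expr2).
Qed.

Lemma sum_sin2 (x y : G) : \sum_k sin (Phi k x - Phi k y) = 0 :> R.
Proof.
pose c i k := cos (angle * centred k * (centred (i x) - centred (i y))).
pose s i k := sin (angle * centred k * (centred (i x) - centred (i y))).
transitivity (\sum_k1 \sum_k2 (s fst k1 * c snd k2 + c fst k1 * s snd k2)).
  rewrite pair_bigA; apply: eq_bigr => k _.
  by rewrite PhiB sinD.
under eq_bigr do rewrite big_split /= -!mulr_sumr.
rewrite big_split /= -!mulr_suml /c /s !sum_sin1 mul0r mulr0 addr0 //.
Qed.

Definition avg (f : G -> R) : R := M%:R ^- 2 * \sum_x f x.

Definition nrm2 (z : R * R) : R := z.1 ^+ 2 + z.2 ^+ 2.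

(** Pairs of real numbers, the cosine and sine coefficients, take the place
    of complex Fourier coefficients. *)
Definition dft (f : G -> R) (k : G) : R * R :=
  (avg (fun x => f x * cos (Phi k x)), avg (fun x => f x * sin (Phi k x))).

(** Without the normalisation 1 / M^2, which is part of [dft]; hence
    [synth] inverts [dft]. *)
Definition synth (c : G -> R * R) (x : G) : R :=
  \sum_k ((c k).1 * cos (Phi k x) + (c k).2 * sin (Phi k x)).

Let MM : M%:R ^- 2 * M%:R ^+ 2 = 1 :> R.
Proof. by rewrite mulVf// expf_neq0// M_neq0. Qed.

Lemma avgE_delta (f : G -> R) x :
  avg (fun y => f y * (if y == x then M%:R ^+ 2 else 0)) = f x.
Proof.
rewrite /avg (bigD1 x) //= eqxx big1 ?addr0; last first.
  by move=> y /negbTE ->; rewrite mulr0.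
by rewrite mulrCA MM mulr1.
Qed.

Lemma synth_dft f x : synth (dft f) x = f x.
Proof.
rewrite /synth /dft /=.
transitivity (\sum_k avg (fun y => f y * cos (Phi k y - Phi k x))).
  apply: eq_bigr => k _; rewrite /avg -!mulrA -mulrDr; congr (_ * _).
  rewrite !mulr_suml -big_split /=; apply: eq_bigr => y _.
  by rewrite cosB; ring.
rewrite /avg -mulr_sumr exchange_big /=.
under eq_bigr do rewrite -mulr_sumr sum_cos2.
exact: avgE_delta.
Qed.

Lemma parseval f : \sum_k nrm2 (dft f k) = avg (fun x => f x ^+ 2).
Proof.
transitivity (\sum_k M%:R ^- 2 * avg (fun x => \sum_y (f x * f y * cos (Phi k x - Phi k y)))).
  apply: eq_bigr => k _; rewrite /nrm2 /dft /avg /=.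
  set A := \sum_x _; set B := \sum_x _.
  have -> : \sum_x \sum_y f x * f y * cos (Phi k x - Phi k y) = A ^+ 2 + B ^+ 2.
    rewrite !expr2 /A /B !big_distrlr -big_split /=; apply: eq_bigr => x _.
    rewrite -big_split /=; apply: eq_bigr => y _.
    by rewrite cosB; ring.
  by ring.
rewrite -mulr_sumr /avg -mulr_sumr; congr (_ * _).
rewrite exchange_big /= mulr_sumr; apply: eq_bigr => x _.
rewrite exchange_big /=; under eq_bigr do rewrite -mulr_sumr sum_cos2 eq_sym.
by rewrite expr2; exact: (avgE_delta (fun y => f x * f y)).
Qed.

(** Only an inequality: the characters of k and -k span the same
    two-dimensional space, so that pairs of coefficients are not determined
    by the function. *)
Lemma synth_le c : avg (fun x => synth c x ^+ 2) <= \sum_k nrm2 (c k).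
Proof.
pose d k := (- (c k).2, (c k).1).
apply: (@le_trans _ _ (avg (fun x => synth c x ^+ 2 + synth d x ^+ 2))).
  rewrite /avg ler_wpM2l ?invr_ge0 ?exprn_ge0 ?ler0n//.
  by apply: ler_sum => x _; rewrite lerDl sqr_ge0.
apply: le_of_eq.
have E x : synth c x ^+ 2 + synth d x ^+ 2 = \sum_k \sum_l
   (((c k).1 * (c l).1 + (c k).2 * (c l).2) * cos (Phi x k - Phi x l)
   + ((c k).2 * (c l).1 - (c k).1 * (c l).2) * sin (Phi x k - Phi x l)).
  rewrite !expr2 /synth !big_distrlr -big_split /=; apply: eq_bigr => k _.
  rewrite -big_split /=; apply: eq_bigr => l _.
  by rewrite /d /= cosB sinB ![Phi x _]PhiC; ring.
rewrite /avg; under eq_bigr do rewrite E.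
rewrite exchange_big /= mulr_sumr; apply: eq_bigr => k _.
rewrite exchange_big /=.
under eq_bigr do rewrite big_split /= -!mulr_sumr sum_cos2 sum_sin2 mulr0 addr0 eq_sym.
rewrite /nrm2 !expr2.
exact: (avgE_delta (fun l => (c k).1 * (c l).1 + (c k).2 * (c l).2)).
Qed.

End DiscreteFourier.

(** * Chords and arcs *)

Section TrigBounds.
Context {R : realType}.
Implicit Types a b x y : R.

Lemma mvt_lipschitz (g dg : R -> R) (C : R) :
  (forall t : R, is_derive t 1 g (dg t)) -> (forall t, `|dg t| <= C) ->
  forall a b, `|g a - g b| <= C * `|a - b|.
Proof.
move=> dgP dgC a b.
wlog ab : a b / a <= b.
  by move=> H; have [|/ltW] := leP a b; move/H => //; rewrite distrC (distrC b).
have H1 (x : R) : x \in `]a, b[%R -> is_derive x 1 g (dg x) by move=> _; exact: dgP.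
have H2 : {within `[a, b], continuous g}.
  by apply: derivable_within_continuous => x _; have := dgP x => -[].
have [c _ E] := @MVT_segment R g dg a b ab H1 H2.
by rewrite distrC E normrM (distrC a) ler_wpM2r.
Qed.

Lemma cos_lipschitz a b : `|cos a - cos b| <= `|a - b|.
Proof.
have H t : `|- sin t| <= 1 :> R by rewrite normrN sin_max.
by have := mvt_lipschitz (@is_derive_cos R) H a b; rewrite mul1r.
Qed.

Lemma sin_lipschitz a b : `|sin a - sin b| <= `|a - b|.
Proof.
by have := mvt_lipschitz (@is_derive_sin R) (@cos_max R) a b; rewrite mul1r.
Qed.

Lemma chord_half x : 2 - 2 * cos x = 4 * sin (x / 2) ^+ 2.
Proof.
have -> : cos x = cos ((x / 2) *+ 2) by congr cos; rewrite mulr2n; field.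
by rewrite cos_mulr2n cos2sin2; ring.
Qed.

(** The quantity 2 - 2 cos x is the square of the length of a chord; this
    and [chord_ge] compare it to the arc. They compare difference quotients
    with derivatives on the Fourier side. *)
Lemma chord_le x : 2 - 2 * cos x <= x ^+ 2.
Proof.
rewrite chord_half; have := sin_lipschitz (x / 2) 0.
rewrite sin0 !subr0 => H; have : sin (x / 2) ^+ 2 <= (x / 2) ^+ 2.
  by rewrite -(real_normK (num_real (sin _))) -(real_normK (num_real (x / 2)))
     lerXn2r ?nnegrE.
by move=> {}H; have -> : x ^+ 2 = 4 * (x / 2) ^+ 2; [field | rewrite ler_pM2l].
Qed.

(** The constant of a Jordan type inequality sin y >= chord_cst * y for y
    between 0 and pi / 2. Any positive constant would do. *)
Definition chord_cst : R := cos 1 / 2.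

Lemma chord_cst_gt0 : 0 < chord_cst. Proof. by rewrite divr_gt0 ?cos1_gt0. Qed.

Lemma sin_ge y : 0 <= y <= pi / 2 -> chord_cst * y <= sin y.
Proof.
move=> /andP[y0 y2].
have c1 := @cos1_gt0 R.
(* On [0, 1] the derivative of sin is at least cos 1. *)
have sin1 (z : R) : 0 <= z -> z <= 1 -> cos 1 * z <= sin z.
  move=> z0 z1.
  have H2 : {within `[0, z], continuous (@sin R)}.
    by apply: derivable_within_continuous => x _; exact: derivable_sin.
  have [c] := @MVT_segment R sin cos 0 z z0 (fun x _ => is_derive_sin x) H2.
  rewrite in_itv /= sin0 !subr0 => /andP[c0 cz] ->.
  rewrite ler_wpM2r//; have [->//|c1'] := eqVneq c 1.
  have clt1 : c < 1 by rewrite lt_neqAle c1' (le_trans cz).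
  apply: ltW; rewrite ltr_cos ?in_itv //= ?c0 ?ler01 /=.
    by rewrite (le_trans (ltW clt1))// (le_trans _ (@pi_ge2 R))// ler1n.
  by rewrite (le_trans _ (@pi_ge2 R))// ler1n.
have [y1|y1] := leP y 1.
  apply: le_trans (sin1 _ y0 y1); rewrite ler_wpM2r// /chord_cst.
  by rewrite ler_pdivrMr// ler_pMr// ler1n.
apply: (@le_trans _ _ (cos 1)).
  rewrite /chord_cst -mulrA ler_piMr ?(ltW c1)// mulrC ler_pdivrMr// mul1r.
  by apply: (le_trans y2); exact/ltW/pihalf_lt2.
rewrite -[leLHS]mulr1; apply: (le_trans (sin1 1 ler01 (lexx _))).
apply: ltW; rewrite ltr_sin ?in_itv //=.
  rewrite pihalf_ge1 andbT (@le_trans _ _ 0)// oppr_le0 divr_ge0// pi_ge0 //.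
by rewrite y2 andbT (@le_trans _ _ 0)// oppr_le0 divr_ge0// pi_ge0.
Qed.

Lemma chord_ge x : `|x| <= pi -> chord_cst ^+ 2 * x ^+ 2 <= 2 - 2 * cos x.
Proof.
move=> xpi; rewrite chord_half.
have : chord_cst * (`|x| / 2) <= sin (`|x| / 2).
  by apply: sin_ge; rewrite divr_ge0//= ler_pM2r.
have c0 := chord_cst_gt0.
have n0 : 0 <= chord_cst * (`|x| / 2) by rewrite mulr_ge0 ?(ltW c0)// divr_ge0.
move=> H; have : (chord_cst * (`|x| / 2)) ^+ 2 <= sin (`|x| / 2) ^+ 2.
  by rewrite lerXn2r ?nnegrE// (le_trans n0).
have -> : sin (`|x| / 2) ^+ 2 = sin (x / 2) ^+ 2.
  case: (ger0P x) => // _; by rewrite mulNr sinN sqrrN.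
have -> : (chord_cst * (`|x| / 2)) ^+ 2 = chord_cst ^+ 2 * x ^+ 2 / 4.
  by rewrite exprMn [(`|x| / 2) ^+ 2]exprMn real_normK ?num_real//; field.
rewrite ler_pdivrMr// => ?; lra.
Qed.

Lemma cosD2pin a n : cos (a + 2 * pi * n%:R) = cos a.
Proof.
rewrite (_ : 2 * pi * n%:R = (pi *+ 2) *+ n) ?(periodicn (@cosD2pi R))//.
by rewrite -(mulr_natr (pi *+ 2)) -(mulr_natl pi).
Qed.

Lemma sinD2pin a n : sin (a + 2 * pi * n%:R) = sin a.
Proof.
rewrite (_ : 2 * pi * n%:R = (pi *+ 2) *+ n) ?(periodicn (@sinD2pi R))//.
by rewrite -(mulr_natr (pi *+ 2)) -(mulr_natl pi).
Qed.

End TrigBounds.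

(** * Difference quotients and discrete Sobolev norms *)

Section Differences.
Context {R : realType}.
Variables (w : R).
Hypothesis w_gt0 : 0 < w.
Variable p : nat.
Local Notation M := ((2 * p).+1).
Local Notation I := ('I_(2 * p).+1).
Local Notation G := (grid p).
Local Notation centred := (@centred R p).
Local Notation angle := (@angle R p).
Local Notation Phi := (@Phi R p).

(** The mesh size of the grid when the torus has period 2 pi / w. *)
Definition mesh : R := angle / w.

Lemma angle_gt0 : 0 < angle.
Proof. by rewrite divr_gt0 ?mulr_gt0 ?pi_gt0 ?M_gt0. Qed.

Lemma mesh_gt0 : 0 < mesh. Proof. by rewrite divr_gt0 // angle_gt0. Qed.

Lemma w_mesh : w * mesh = angle.
Proof. by rewrite /mesh mulrC divfK// gt_eqF. Qed.

Definition axis (i : bool) (x : G) : I := if i then x.2 else x.1.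

(** Translation by one mesh in the direction of [i], around the torus. *)
Definition translate (i : bool) (x : G) : G :=
  if i then (x.1, ordS x.2) else (ordS x.1, x.2).

Lemma translate_inj i : injective (translate i).
Proof.
move=> [a b] [c d] /eqP; rewrite /translate.
by case: i => /=; rewrite xpair_eqE (inj_eq (@ordS_inj _)) -xpair_eqE => /eqP.
Qed.

(** The second case is the jump from p to -p at the seam of the torus. *)
Lemma centred_ordS (j : I) :
  centred (ordS j) = centred j + 1 \/ centred (ordS j) = centred j + 1 - M%:R.
Proof.
rewrite /centred /=; have := ltn_ord j; rewrite leq_eqVlt => /orP[/eqP E|jM].
  right; have -> : (j.+1 %% M = 0)%N by rewrite {1}E modnn.
  have -> : M%:R = j%:R + 1 :> R by rewrite -{1}E -natr1.
  by ring.
by left; rewrite modn_small// -natr1; ring.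
Qed.

Lemma angle_period : angle * M%:R = 2 * pi.
Proof. by rewrite /angle divfK// M_neq0. Qed.

Let cos_wrap a (k : I) : cos (a - angle * (centred k * M%:R)) = cos a.
Proof.
have -> : angle * (centred k * M%:R) = 2 * pi * (k%:R - p%:R).
  by rewrite mulrCA angle_period /centred mulrC.
rewrite -(cosD2pin (a - _) k) -[RHS](cosD2pin a p).
by congr cos; ring.
Qed.

Let sin_wrap a (k : I) : sin (a - angle * (centred k * M%:R)) = sin a.
Proof.
have -> : angle * (centred k * M%:R) = 2 * pi * (k%:R - p%:R).
  by rewrite mulrCA angle_period /centred mulrC.
rewrite -(sinD2pin (a - _) k) -[RHS](sinD2pin a p).
by congr sin; ring.
Qed.

Lemma Phi_translate k i x :
  cos (Phi k (translate i x)) = cos (Phi k x + angle * centred (axis i k)) /\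
  sin (Phi k (translate i x)) = sin (Phi k x + angle * centred (axis i k)).
Proof.
have [] := centred_ordS (axis i x) => E.
  have -> : Phi k (translate i x) = Phi k x + angle * centred (axis i k).
    by case: i E => /= E; rewrite /Phi /= E; ring.
  by [].
have -> : Phi k (translate i x) = Phi k x + angle * centred (axis i k) - angle * (centred (axis i k) * M%:R).
  by case: i E => /= E; rewrite /Phi /= E; ring.
by rewrite cos_wrap sin_wrap.
Qed.

Definition dif i (f : G -> R) : G -> R := fun x => (f (translate i x) - f x) / mesh.

(** The action of the difference quotient on Fourier coefficients: the
    multiplier (e^(i eta) - 1) / h, written on pairs of real numbers. *)
Definition dif_sym i (c : G -> R * R) (k : G) : R * R :=
  let eta := angle * centred (axis i k) in
  (((c k).1 * (cos eta - 1) + (c k).2 * sin eta) / mesh,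
   ((c k).2 * (cos eta - 1) - (c k).1 * sin eta) / mesh).

Lemma avg_translate i (f : G -> R) : avg (fun x => f (translate i x)) = avg f.
Proof. by rewrite /avg [in RHS](reindex_inj (@translate_inj i)). Qed.

Lemma avgD (f g : G -> R) : avg (fun x => f x + g x) = avg f + avg g.
Proof. by rewrite /avg big_split mulrDr. Qed.

Lemma avgZ a (f : G -> R) : avg (fun x => a * f x) = a * avg f.
Proof. by rewrite /avg -mulr_sumr mulrCA. Qed.

Lemma avg_ext (f g : G -> R) : f =1 g -> avg f = avg g.
Proof. by move=> fg; congr (_ * _); exact: eq_bigr. Qed.

Lemma avg_sum (J : finType) (f : J -> G -> R) :
  avg (fun x => \sum_j f j x) = \sum_j avg (f j).
Proof. by rewrite /avg exchange_big mulr_sumr. Qed.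

Lemma avg_le (f g : G -> R) : (forall x, f x <= g x) -> avg f <= avg g.
Proof.
move=> fg; rewrite /avg ler_wpM2l ?invr_ge0 ?exprn_ge0 ?ler0n//.
exact: ler_sum.
Qed.

Lemma avg_ge0 (f : G -> R) : (forall x, 0 <= f x) -> 0 <= avg f.
Proof.
move=> f0; rewrite mulr_ge0 ?invr_ge0 ?exprn_ge0 ?ler0n// sumr_ge0 //.
Qed.

Lemma avg_cst (a : R) : avg (fun _ : G => a) = a.
Proof.
rewrite /avg sumr_const card_prod !card_ord -[a *+ _]mulr_natr natrM.
by rewrite -expr2 mulrCA mulVf ?mulr1// expf_neq0// M_neq0.
Qed.

Lemma dft_dif i f k : dft (dif i f) k = dif_sym i (dft f) k.
Proof.
rewrite /dft /dif_sym; set eta := angle * _ => /=.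
set A' := avg (fun x => f x * cos _); set B' := avg (fun x => f x * sin _).
have C x : cos (Phi k x) = cos (Phi k (translate i x)) * cos eta
                         + sin (Phi k (translate i x)) * sin eta.
  by rewrite (Phi_translate k i x).1 (Phi_translate k i x).2 -/eta -cosB addrK.
have S x : sin (Phi k x) = sin (Phi k (translate i x)) * cos eta
                         - cos (Phi k (translate i x)) * sin eta.
  by rewrite (Phi_translate k i x).1 (Phi_translate k i x).2 -/eta -sinB addrK.
have E1 : avg (fun x => f (translate i x) * cos (Phi k x)) = cos eta * A' + sin eta * B'.
  rewrite -!avgZ -avgD -[RHS](avg_translate i); apply: avg_ext => x.
  by rewrite C; ring.
have E2 : avg (fun x => f (translate i x) * sin (Phi k x)) = cos eta * B' + - sin eta * A'.
  rewrite -!avgZ -avgD -[RHS](avg_translate i); apply: avg_ext => x.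
  by rewrite S; ring.
congr pair.
  transitivity (mesh^-1 * (avg (fun x => f (translate i x) * cos (Phi k x)) + -1 * A')).
    by rewrite -avgZ -avgD -avgZ; apply: avg_ext => x; rewrite /dif; ring.
  by rewrite E1; ring.
transitivity (mesh^-1 * (avg (fun x => f (translate i x) * sin (Phi k x)) + -1 * B')).
  by rewrite -avgZ -avgD -avgZ; apply: avg_ext => x; rewrite /dif; ring.
by rewrite E2; ring.
Qed.

Lemma dif_synth i c x : dif i (synth c) x = synth (dif_sym i c) x.
Proof.
rewrite /dif /synth -sumrB mulr_suml; apply: eq_bigr => k _.
rewrite (Phi_translate k i x).1 (Phi_translate k i x).2 cosD sinD /dif_sym /=.
by ring.
Qed.

(** The squared modulus of the multiplier of [dif i]. *)
Definition dif_mult i (k : G) : R := (2 - 2 * cos (angle * centred (axis i k))) / mesh ^+ 2.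

Lemma nrm2_dif_sym i c k : nrm2 (dif_sym i c k) = nrm2 (c k) * dif_mult i k.
Proof.
rewrite /nrm2 /dif_sym /dif_mult /=; set e := angle * _.
have h0 : mesh != 0 by rewrite gt_eqF// mesh_gt0.
have -> : 2 - 2 * cos e = (cos e - 1) ^+ 2 + sin e ^+ 2 by rewrite sin2cos2; ring.
by field.
Qed.

Lemma dif_mult_le i k : dif_mult i k <= (w * centred (axis i k)) ^+ 2.
Proof.
rewrite /dif_mult ler_pdivrMr ?exprn_gt0 ?mesh_gt0//.
apply: (le_trans (chord_le _)).
by rewrite -w_mesh mulrAC [leLHS]exprMn.
Qed.

Lemma centred_norm (k : I) : `|centred k| <= p%:R.
Proof.
rewrite /centred ler_norml; have := ltn_ord k; rewrite ltnS -(ler_nat R) natrM => kM.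
have := ler0n R k; lra.
Qed.

Lemma dif_mult_ge i k : chord_cst ^+ 2 * (w * centred (axis i k)) ^+ 2 <= dif_mult i k.
Proof.
rewrite /dif_mult ler_pdivlMr ?exprn_gt0 ?mesh_gt0//.
have -> : chord_cst ^+ 2 * (w * centred (axis i k)) ^+ 2 * mesh ^+ 2
    = chord_cst ^+ 2 * (angle * centred (axis i k)) ^+ 2 by rewrite -w_mesh; ring.
apply: chord_ge; rewrite normrM (gtr0_norm angle_gt0).
apply: (le_trans (ler_wpM2l (ltW angle_gt0) (centred_norm _))).
rewrite /angle mulrAC ler_pdivrMr ?M_gt0// ME.
have := @pi_gt0 R; nra.
Qed.

Lemma dif_mult_ge0 i k : 0 <= dif_mult i k.
Proof.
by apply: le_trans (dif_mult_ge i k); rewrite mulr_ge0// ?sqr_ge0.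
Qed.

Lemma nrm2_ge0 (z : R * R) : 0 <= nrm2 z.
Proof. by rewrite addr_ge0 ?sqr_ge0. Qed.

(** The squares of the discrete Sobolev norms of H^1 and, with [sob2], of
    H^2. Squares are kept to avoid square roots. *)
Definition sob1 (f : G -> R) : R :=
  avg (fun x => f x ^+ 2) + \sum_i avg (fun x => dif i f x ^+ 2).

Definition sob2 (f : G -> R) : R :=
  sob1 f + \sum_i \sum_j avg (fun x => dif i (dif j f) x ^+ 2).

(** The mixed differences are left out: the pure ones control them through
    Fourier coefficients ([energy2_le_sob2p]), and the second differences
    of F(W) are estimated in one direction at a time. *)
Definition sob2p (f : G -> R) : R :=
  avg (fun x => f x ^+ 2) + \sum_i avg (fun x => dif i (dif i f) x ^+ 2).

(** The usual weight 1 + |k|^2 of Sobolev spaces. *)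
Definition weight (k : G) : R := 1 + centred k.1 ^+ 2 + centred k.2 ^+ 2.

Lemma weight_ge1 k : 1 <= weight k.
Proof. by rewrite /weight -addrA lerDl addr_ge0 ?sqr_ge0. Qed.

Lemma weight_gt0 k : 0 < weight k. Proof. exact: lt_le_trans (weight_ge1 k). Qed.

(** The square of the H^s norm on the Fourier side. *)
Definition energy (s : nat) (c : G -> R * R) : R := \sum_k weight k ^+ s * nrm2 (c k).

Lemma avg_dif f i : avg (fun x => dif i f x ^+ 2) = \sum_k nrm2 (dft f k) * dif_mult i k.
Proof.
by rewrite -parseval; apply: eq_bigr => k _; rewrite dft_dif nrm2_dif_sym.
Qed.

Lemma avg_dif2 f i j :
  avg (fun x => dif i (dif j f) x ^+ 2) = \sum_k nrm2 (dft f k) * dif_mult j k * dif_mult i k.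
Proof.
rewrite avg_dif; apply: eq_bigr => k _.
by rewrite dft_dif nrm2_dif_sym.
Qed.

Lemma sob1_dft f : sob1 f = \sum_k nrm2 (dft f k) * (1 + dif_mult true k + dif_mult false k).
Proof.
rewrite /sob1 -parseval big_bool /= !avg_dif -!big_split /=.
by apply: eq_bigr => k _; ring.
Qed.

Lemma sob2p_dft f :
  sob2p f = \sum_k nrm2 (dft f k) * (1 + dif_mult true k ^+ 2 + dif_mult false k ^+ 2).
Proof.
rewrite /sob2p -parseval big_bool /= !avg_dif2 -!big_split /=.
by apply: eq_bigr => k _; ring.
Qed.

Lemma energy1_le_sob1 f : energy 1 (dft f) <= (1 + (chord_cst ^+ 2 * w ^+ 2)^-1) * sob1 f.
Proof.
rewrite sob1_dft mulr_sumr; apply: ler_sum => k _.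
rewrite mulrCA mulrC ler_wpM2l ?nrm2_ge0// expr1.
have a0 : 0 < chord_cst ^+ 2 * w ^+ 2 by rewrite mulr_gt0 ?exprn_gt0 ?chord_cst_gt0.
have H i : centred (axis i k) ^+ 2 <= (chord_cst ^+ 2 * w ^+ 2)^-1 * dif_mult i k.
  rewrite mulrC ler_pdivlMr//; apply: le_trans (dif_mult_ge i k).
  by apply: le_of_eq; ring.
have := H true; have := H false; rewrite /= /weight.
have := dif_mult_ge0 true k; have := dif_mult_ge0 false k.
have : 0 < (chord_cst ^+ 2 * w ^+ 2)^-1 by rewrite invr_gt0.
by move: (_^-1) => b; nra.
Qed.

(** As k_1^2 k_2^2 <= (k_1^4 + k_2^4) / 2, pure second differences bound
    the whole energy. *)
Lemma energy2_le_sob2p f : energy 2 (dft f) <= 3 * (1 + ((chord_cst ^+ 2 * w ^+ 2)^-1) ^+ 2) * sob2p f.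
Proof.
rewrite sob2p_dft mulr_sumr; apply: ler_sum => k _.
rewrite mulrCA mulrC ler_wpM2l ?nrm2_ge0//.
have a0 : 0 < chord_cst ^+ 2 * w ^+ 2 by rewrite mulr_gt0 ?exprn_gt0 ?chord_cst_gt0.
have H i : (centred (axis i k) ^+ 2) ^+ 2 <= ((chord_cst ^+ 2 * w ^+ 2)^-1 * dif_mult i k) ^+ 2.
  rewrite [leLHS]expr2 [leRHS]expr2.
  suff Hi : centred (axis i k) ^+ 2 <= (chord_cst ^+ 2 * w ^+ 2)^-1 * dif_mult i k.
    by apply: ler_pM => //; exact: sqr_ge0.
  rewrite mulrC ler_pdivlMr//; apply: le_trans (dif_mult_ge i k).
  by apply: le_of_eq; ring.
have := H true; have := H false; rewrite /= /weight.
move: (dif_mult true k) (dif_mult false k) (_^-1) (centred k.1 ^+ 2) (centred k.2 ^+ 2) => u v b x y.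
rewrite !exprMn => Hx Hy.
have b0 : 0 <= b ^+ 2 by exact: sqr_ge0.
have u0 : 0 <= u ^+ 2 by exact: sqr_ge0.
have v0 : 0 <= v ^+ 2 by exact: sqr_ge0.
have A : (1 + x + y) ^+ 2 <= 3 * (1 + x ^+ 2 + y ^+ 2).
  rewrite -subr_ge0.
  have -> : 3 * (1 + x ^+ 2 + y ^+ 2) - (1 + x + y) ^+ 2 =
    (1 - x) ^+ 2 + (1 - y) ^+ 2 + (x - y) ^+ 2 by ring.
  by rewrite !addr_ge0 ?sqr_ge0.
apply: (le_trans A).
suff : 1 + x ^+ 2 + y ^+ 2 <= (1 + b ^+ 2) * (1 + u ^+ 2 + v ^+ 2) by move=> ?; lra.
by nra.
Qed.

Lemma avg_dif_synth c i :
  avg (fun x => dif i (synth c) x ^+ 2) <= \sum_k nrm2 (c k) * dif_mult i k.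
Proof.
rewrite (avg_ext (g := fun x => synth (dif_sym i c) x ^+ 2)); last first.
  by move=> x; rewrite dif_synth.
by apply: (le_trans (synth_le _)); apply: ler_sum => k _; rewrite nrm2_dif_sym.
Qed.

Lemma avg_dif2_synth c i j :
  avg (fun x => dif i (dif j (synth c)) x ^+ 2) <= \sum_k nrm2 (c k) * dif_mult j k * dif_mult i k.
Proof.
have -> : dif j (synth c) = synth (dif_sym j c) by apply/funext => y; exact: dif_synth.
apply: (le_trans (avg_dif_synth _ _)).
by apply: ler_sum => k _; rewrite nrm2_dif_sym.
Qed.

Lemma sob1_synth c : sob1 (synth c) <= (1 + w ^+ 2) * energy 1 c.
Proof.
apply: (@le_trans _ _ (\sum_k nrm2 (c k) * (1 + dif_mult true k + dif_mult false k))).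
  rewrite /sob1 big_bool /=.
  apply: (le_trans (lerD (synth_le c) (lerD (avg_dif_synth c true) (avg_dif_synth c false)))).
  by rewrite -!big_split /= ler_sum// => k _; apply: le_of_eq; ring.
rewrite mulr_sumr; apply: ler_sum => k _.
rewrite mulrA [leRHS]mulrC ler_wpM2l ?nrm2_ge0// expr1.
have := dif_mult_le true k; have := dif_mult_le false k; rewrite /= /weight !exprMn.
have := sqr_ge0 (centred k.1); have := sqr_ge0 (centred k.2); have := sqr_ge0 w.
nra.
Qed.

Lemma sob2_synth c : sob2 (synth c) <= (1 + w ^+ 2) ^+ 2 * energy 2 c.
Proof.
apply: (@le_trans _ _ (\sum_k nrm2 (c k) * (1 + dif_mult true k + dif_mult false k
   + (dif_mult true k + dif_mult false k) ^+ 2))).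
  rewrite /sob2 /sob1 !big_bool /=.
  have := synth_le c; have := avg_dif_synth c true; have := avg_dif_synth c false.
  have := avg_dif2_synth c true true; have := avg_dif2_synth c true false.
  have := avg_dif2_synth c false true; have := avg_dif2_synth c false false.
  move=> h1 h2 h3 h4 h5 h6 h7.
  apply: (le_trans (lerD (lerD h7 (lerD h6 h5)) (lerD (lerD h4 h3) (lerD h2 h1)))).
  by rewrite -!big_split /= ler_sum// => k _; apply: le_of_eq; ring.
rewrite mulr_sumr; apply: ler_sum => k _.
rewrite mulrA [leRHS]mulrC ler_wpM2l ?nrm2_ge0//.
have mK : dif_mult true k + dif_mult false k <= w ^+ 2 * (centred k.1 ^+ 2 + centred k.2 ^+ 2).
  have := dif_mult_le true k; have := dif_mult_le false k; rewrite /= !exprMn mulrDr; lra.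
have m0 : 0 <= dif_mult true k + dif_mult false k by rewrite addr_ge0 ?dif_mult_ge0.
have k0 : 0 <= centred k.1 ^+ 2 + centred k.2 ^+ 2 by rewrite addr_ge0 ?sqr_ge0.
apply: (@le_trans _ _ ((1 + w ^+ 2 * (centred k.1 ^+ 2 + centred k.2 ^+ 2)) ^+ 2)).
  rewrite -[1 + dif_mult true k + dif_mult false k]addrA.
  move: mK m0; move: (dif_mult true k + dif_mult false k) (w ^+ 2 * _) => u v uv u0.
  have : u ^+ 2 <= v ^+ 2 by rewrite [leLHS]expr2 [leRHS]expr2 ler_pM.
  by rewrite sqrrD !expr1n mul1r; lra.
rewrite -exprMn [leLHS]expr2 [leRHS]expr2.
have w0 := sqr_ge0 w.
have u0 : 0 <= 1 + w ^+ 2 * (centred k.1 ^+ 2 + centred k.2 ^+ 2).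
  exact: (addr_ge0 ler01 (mulr_ge0 w0 k0)).
suff uv : 1 + w ^+ 2 * (centred k.1 ^+ 2 + centred k.2 ^+ 2) <= (1 + w ^+ 2) * weight k.
  by apply: ler_pM.
by rewrite /weight -addrA; nra.
Qed.

End Differences.

(** * Summation inequalities *)

Section SumInequalities.
Context {R : realType}.

Lemma sum_cauchy_schwarz (I : finType) (u v : I -> R) :
  (\sum_i u i * v i) ^+ 2 <= (\sum_i u i ^+ 2) * (\sum_i v i ^+ 2).
Proof.
have : 0 <= \sum_i \sum_j (u i * v j - u j * v i) ^+ 2.
  by apply: sumr_ge0 => i _; apply: sumr_ge0 => j _; exact: sqr_ge0.
set A := \sum_i u i ^+ 2; set B := \sum_i v i ^+ 2; set D := \sum_i u i * v i.
have -> : \sum_i \sum_j (u i * v j - u j * v i) ^+ 2 = 2 * (A * B - D ^+ 2).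
  transitivity (\sum_i \sum_j (u i ^+ 2 * v j ^+ 2 + v i ^+ 2 * u j ^+ 2
      - 2 * ((u i * v i) * (u j * v j)))).
    by apply: eq_bigr => i _; apply: eq_bigr => j _; ring.
  transitivity (A * B + B * A - 2 * (D * D)); last by ring.
  rewrite /A /B /D !big_distrlr mulr_sumr -big_split -sumrB /=.
  by apply: eq_bigr => i _; rewrite mulr_sumr -big_split -sumrB.
by rewrite pmulr_rge0// subr_ge0.
Qed.

Lemma sqr_sum_le (I : finType) (u : I -> R) :
  (\sum_i u i) ^+ 2 <= #|I|%:R * \sum_i u i ^+ 2.
Proof.
have := sum_cauchy_schwarz u (fun=> 1).
rewrite (eq_bigr u) => [|i _]; last by rewrite mulr1.
by rewrite [X in _ * X](eq_bigr (fun=> 1)) ?sumr_const 1?mulrC // => i _; rewrite expr1n.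
Qed.

Lemma sqr3_le (a b c : R) : (a + b + c) ^+ 2 <= 3 * (a ^+ 2 + b ^+ 2 + c ^+ 2).
Proof.
rewrite -subr_ge0.
have -> : 3 * (a ^+ 2 + b ^+ 2 + c ^+ 2) - (a + b + c) ^+ 2 =
    (a - b) ^+ 2 + (b - c) ^+ 2 + (a - c) ^+ 2 by ring.
by rewrite !addr_ge0 ?sqr_ge0.
Qed.

Lemma sqr_le_abs (a b : R) : `|a| <= b -> a ^+ 2 <= b ^+ 2.
Proof.
move=> ab; rewrite -(real_normK (num_real a)) [leLHS]expr2 [leRHS]expr2.
exact: ler_pM.
Qed.

(** Comparison with the integral of x^(-s), whose primitive is telescoped
    by the mean value theorem. *)
Lemma sum_powR_le (s : R) : 1 < s -> forall n,
  \sum_(k < n) (1 + k%:R) `^ (- s) <= 1 + (s - 1)^-1.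
Proof.
move=> s1.
have s0 : 0 < s - 1 by rewrite subr_gt0.
have step (k : nat) : (s - 1) * (1 + k.+1%:R) `^ (- s) <=
    (1 + k%:R) `^ (1 - s) - (1 + k.+1%:R) `^ (1 - s) :> R.
  set a : R := 1 + k%:R; have a0 : 0 < a by rewrite ltr_pwDl.
  have -> : 1 + k.+1%:R = a + 1 :> R by rewrite /a -natr1 addrA.
  have ab : a <= a + 1 by rewrite lerDl.
  pose g := (powR (R:=R))^~ (1 - s).
  have H1 (x : R) : x \in `]a, a + 1[%R -> is_derive x 1 g ((1 - s) * x `^ (1 - s - 1)).
    rewrite in_itv /= => /andP[ax _].
    by apply: is_derive1_powR; exact: lt_trans ax.
  have H2 : {within `[a, a + 1], continuous g}.
    apply: derivable_within_continuous => x; rewrite in_itv /= => /andP[ax _].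
    by have := is_derive1_powR (1 - s) (lt_le_trans a0 ax) => -[].
  have [c] := @MVT_segment R g _ a (a + 1) ab H1 H2.
  rewrite in_itv /= => /andP[ac ca]; rewrite -/(g a) -/(g (a + 1)) => E.
  rewrite -[leRHS]opprB E.
  have -> : a + 1 - a = 1 by ring.
  have -> : 1 - s - 1 = - s by ring.
  rewrite mulr1 -mulNr opprB ler_wpM2l ?(ltW s0)//.
  have c0 : 0 < c by lra.
  have a10 : 0 < a + 1 by lra.
  rewrite !powRN lef_pV2 ?posrE ?powR_gt0//.
  by rewrite ge0_ler_powR ?nnegrE ?(ltW c0) ?(ltW a10) //; lra.
case=> [|n]; first by rewrite big_ord0 addr_ge0// invr_ge0 ltW.
rewrite big_ord_recl addr0 powR1 /= lerD2l.
rewrite -[leRHS]mulr1 ler_pdivlMl// mulr_sumr.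
apply: (@le_trans _ _ (\sum_(i < n) ((1 + i%:R) `^ (1 - s) - (1 + i.+1%:R) `^ (1 - s)))).
  by apply: ler_sum => i _; exact: step.
pose g (i : nat) : R := - (1 + i%:R) `^ (1 - s).
rewrite (eq_bigr (fun i : 'I_n => g i.+1 - g i)); last first.
  by move=> i _; rewrite /g opprK addrC.
rewrite -(big_mkord xpredT (fun k => g k.+1 - g k)) telescope_sumr // /g.
by rewrite addr0 powR1 opprK addrC lerBlDr lerDl powR_ge0.
Qed.

Lemma sum_centered_le (phi : nat -> R) p : (forall n, 0 <= phi n) ->
  \sum_(k < (2 * p).+1) phi `|k%:Z - p%:Z|%N <= 2 * \sum_(k < p.+1) phi k.
Proof.
move=> phi0.
rewrite -(big_mkord xpredT (fun k => phi `|k%:Z - p%:Z|%N)).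
rewrite (@big_cat_nat _ _ _ p) /=; last 2 first.
- by [].
- by rewrite mul2n -addnn -addSn leq_addl.
rewrite -[2]/(1 + 1) mulrDl mul1r lerD//.
  rewrite big_nat_rev add0n /= big_mkord.
  rewrite (eq_bigr (fun k : 'I_p => phi k.+1)) => [|k _]; last first.
    by congr phi; have := ltn_ord k; lia.
  by rewrite [leRHS]big_ord_recl ler_wpDl.
rewrite -{1}[p]add0n big_addn big_mkord.
have -> : ((2 * p).+1 - p = p.+1)%N by lia.
by apply: ler_sum => k _; rewrite (_ : `|_|%N = k)//; lia.
Qed.

End SumInequalities.

(** * Summable Fourier weights in dimension two *)

Section Weights.
Context {R : realType}.

Definition amp (z : R * R) : R := `|z.1| + `|z.2|.

Lemma amp_ge0 z : 0 <= amp z. Proof. by rewrite addr_ge0. Qed.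

Lemma sqr_amp z : amp z ^+ 2 <= 2 * nrm2 z.
Proof.
rewrite /amp /nrm2; have := real_normK (num_real z.1); have := real_normK (num_real z.2).
move: `|z.1| `|z.2| => x y <- <-; rewrite -subr_ge0.
have -> : 2 * (x ^+ 2 + y ^+ 2) - (x + y) ^+ 2 = (x - y) ^+ 2 by ring.
exact: sqr_ge0.
Qed.

Lemma weight1_bounded (s : R) : 1 < s -> exists2 C : R, 0 <= C & forall p,
  \sum_(k < (2 * p).+1) (1 + centred k ^+ 2) `^ (- (s / 2)) <= C.
Proof.
move=> s1; have s0 : 0 < s := lt_trans ltr01 s1.
exists (2 `^ (s / 2) * (2 * (1 + (s - 1)^-1))).
  by rewrite !mulr_ge0 ?powR_ge0// addr_ge0// invr_ge0 subr_ge0 ltW.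
move=> p.
apply: (@le_trans _ _ (2 `^ (s / 2) *
    \sum_(k < (2 * p).+1) (1 + `|k%:Z - p%:Z|%N%:R) `^ (- s))).
  rewrite mulr_sumr; apply: ler_sum => k _.
  set n := `|_|%N.
  have -> : centred k ^+ 2 = n%:R ^+ 2 :> R.
    rewrite /n natr_absz /centred intr_norm rmorphB /=.
    by rewrite real_normK ?num_real.
  have n0 : 0 <= n%:R :> R by [].
  move: n%:R n0 => x x0.
  have -> : (1 + x) `^ (- s) = ((1 + x) ^+ 2) `^ (- (s / 2)).
    have x1 : 0 <= 1 + x by lra.
    by rewrite -(powR_mulrn 2 x1) -powRrM; congr (_ `^ _); field.
  have x1 : 0 < (1 + x) ^+ 2 by rewrite exprn_gt0// ltr_pwDl.
  have x2 : 0 < 1 + x ^+ 2 by rewrite ltr_pwDl ?sqr_ge0.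
  rewrite !powRN ler_pdivlMr ?powR_gt0// mulrC ler_pdivrMr ?powR_gt0//.
  rewrite -powRM ?(ltW x2)// ge0_ler_powR ?nnegrE ?(ltW x1) ?divr_ge0 ?(ltW s0)//.
    by rewrite mulr_ge0// (ltW x2).
  by have := sqr_ge0 (1 - x); nra.
rewrite ler_wpM2l ?powR_ge0//.
apply: (le_trans (sum_centered_le (phi := fun n => (1 + n%:R) `^ (- s)) _ _)).
  by move=> n; exact: powR_ge0.
by rewrite ler_wpM2l// sum_powR_le.
Qed.

(** Convergence, uniformly in the size of the grid, of the sum of (1 +
    |k|^2)^(al - 2) over Z^2. As (1 + k_1^2)(1 + k_2^2) <= (1 + |k|^2)^2,
    the sum is bounded by a product of one-dimensional ones. *)
Lemma weight_bounded (al : R) : al < 1 -> exists2 C : R, 0 <= C & forall p,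
  \sum_k @weight R p k `^ (al - 2) <= C.
Proof.
move=> al1; have s1 : 1 < 2 - al by lra.
have [C C0 CP] := weight1_bounded s1.
exists (C * C); first exact: mulr_ge0.
move=> p; set f : 'I_(2 * p).+1 -> R := fun k => (1 + centred k ^+ 2) `^ (- ((2 - al) / 2)).
have f0 k : 0 <= f k by exact: powR_ge0.
apply: (@le_trans _ _ (\sum_(i < (2 * p).+1) \sum_(j < (2 * p).+1) f i * f j)); last first.
  rewrite -big_distrlr; apply: ler_pM; rewrite ?sumr_ge0//; exact: CP.
rewrite pair_bigA; apply: ler_sum => -[i j] _ /=.
rewrite /f /weight /= -powRM; [|by rewrite addr_ge0 ?sqr_ge0..].
have := sqr_ge0 (@centred R p i); have := sqr_ge0 (@centred R p j).
move: (centred i ^+ 2) (centred j ^+ 2) => x y y0 x0.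
have q0 : 0 < 1 + x + y by lra.
have -> : (1 + x + y) `^ (al - 2) = ((1 + x + y) ^+ 2) `^ (- ((2 - al) / 2)).
  by rewrite -powR_mulrn ?(ltW q0)// -powRrM; congr (_ `^ _); field.
have a0 : 0 < (1 + x) * (1 + y) by rewrite mulr_gt0 //; lra.
rewrite !powRN lef_pV2 ?posrE ?powR_gt0 ?exprn_gt0//.
rewrite ge0_ler_powR ?nnegrE ?(ltW a0) ?sqr_ge0//; first by rewrite divr_ge0; lra.
by nra.
Qed.

(** How energies bound absolutely convergent Fourier series: Cauchy-Schwarz
    with the weights of the energy. *)
Lemma weighted_l1_bound p (s : nat) (a : _ -> R) (c : _ -> R * R) :
  (\sum_k a k * amp (c k)) ^+ 2 <= 2 * (\sum_k a k ^+ 2 / @weight R p k ^+ s) * energy s c.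
Proof.
have Qs k : 0 < @weight R p k ^+ s by rewrite exprn_gt0 ?weight_gt0.
pose q k := Num.sqrt (@weight R p k ^+ s).
have q2 k : q k ^+ 2 = @weight R p k ^+ s by rewrite /q sqr_sqrtr// ltW.
have q0 k : q k != 0 by rewrite /q sqrtr_eq0 -ltNge.
have := sum_cauchy_schwarz (fun k => a k / q k) (fun k => q k * amp (c k)).
rewrite (eq_bigr (fun k => a k * amp (c k))) => [H|k _]; last first.
  by rewrite mulrA divfK.
apply: (le_trans H); rewrite [2 * _]mulrC -[leRHS]mulrA.
rewrite (eq_bigr (fun k => a k ^+ 2 / weight k ^+ s)) => [|k _]; last first.
  by rewrite expr_div_n q2.
apply: ler_wpM2l.
  by apply: sumr_ge0 => k _; apply: divr_ge0; [exact: sqr_ge0 | exact: ltW].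
rewrite mulr_sumr; apply: ler_sum => k _.
by rewrite exprMn q2 [leRHS]mulrCA; apply: ler_wpM2l; [exact: ltW | exact: sqr_amp].
Qed.

Lemma energy_ge0 p s (c : _ -> R * R) : 0 <= @energy R p s c.
Proof.
by apply: sumr_ge0 => k _; rewrite mulr_ge0 ?exprn_ge0 ?(ltW (weight_gt0 _)) ?nrm2_ge0.
Qed.

(** The Sobolev embedding of H^2 in the Hoelder spaces of exponent al < 1,
    on the Fourier side: a character of frequency k has Hoelder constant of
    order |k|^al. *)
Lemma holder_weight_bound (al : R) : al < 1 -> exists2 C : R, 0 <= C &
  forall p (c : _ -> R * R),
  (\sum_k @weight R p k `^ (al / 2) * amp (c k)) ^+ 2 <= C * energy 2 c.
Proof.
move=> al1; have [C C0 CP] := weight_bounded al1.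
exists (2 * C); first by rewrite mulr_ge0.
move=> p c; apply: (le_trans (weighted_l1_bound 2 _ _)).
rewrite ler_wpM2r ?energy_ge0// ler_wpM2l//; apply: le_trans (CP p).
apply: ler_sum => k _; have Q0 := @weight_gt0 R p k.
rewrite -powR_mulrn ?powR_ge0// -powRrM.
by rewrite -(@powR_mulrn _ (weight k)) ?(ltW Q0)// -powRN -powRD ?(gt_eqF Q0)// ?implybT//
  le_eqVlt; apply/orP; left; apply/eqP; congr (_ `^ _); field.
Qed.

End Weights.

(** * Products of functions on the grid *)

Section ProductEstimate.
Context {R : realType}.
Variables (w : R).
Hypothesis w_gt0 : 0 < w.
Variable p : nat.
Local Notation M := ((2 * p).+1).
Local Notation I := ('I_(2 * p).+1).
Local Notation G := (grid p).
Local Notation mesh := (@mesh R w p).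
Local Notation dif := (@dif R w p).
Local Notation sob1 := (@sob1 R w p).
Local Notation sob2 := (@sob2 R w p).
Local Notation sob2p := (@sob2p R w p).

Definition avg1 (z : I -> R) : R := M%:R^-1 * \sum_j z j.

Definition dif1 (z : I -> R) (j : I) : R := (z (ordS j) - z j) / mesh.

Definition period : R := 2 * pi / w.

Lemma meshE : mesh = period * M%:R^-1.
Proof. by rewrite /mesh /angle /period mulrAC. Qed.

Lemma avg1_cst (a : R) : avg1 (fun=> a) = a.
Proof.
by rewrite /avg1 sumr_const card_ord -[a *+ _]mulr_natr mulrCA mulVf ?mulr1// M_neq0.
Qed.

Lemma avg1_le (f g : I -> R) : (forall x, f x <= g x) -> avg1 f <= avg1 g.
Proof. by move=> fg; rewrite /avg1 ler_wpM2l ?invr_ge0 ?ler0n// ler_sum. Qed.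

Lemma avg1D (f g : I -> R) : avg1 (fun x => f x + g x) = avg1 f + avg1 g.
Proof. by rewrite /avg1 big_split mulrDr. Qed.

Lemma avg1Z a (f : I -> R) : avg1 (fun x => a * f x) = a * avg1 f.
Proof. by rewrite /avg1 -mulr_sumr mulrCA. Qed.

Lemma avg1_ge0 (f : I -> R) : (forall x, 0 <= f x) -> 0 <= avg1 f.
Proof. by move=> f0; rewrite mulr_ge0 ?invr_ge0 ?ler0n// sumr_ge0. Qed.

Lemma avgE1 (f : G -> R) : avg f = avg1 (fun i => avg1 (fun j => f (i, j))).
Proof.
rewrite /avg /avg1 -mulr_sumr mulrA -invfM -expr2; congr (_ * _).
by rewrite pair_bigA; apply: eq_bigr => -[].
Qed.

Lemma avgE2 (f : G -> R) : avg f = avg1 (fun j => avg1 (fun i => f (i, j))).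
Proof.
rewrite avgE1 /avg1 -!mulr_sumr exchange_big /=.
by congr (_ * _); rewrite mulr_sumr; apply: eq_bigr.
Qed.

(** Both points are joined to the point of index 0, without crossing the
    seam. *)
Lemma oscillation_le (z : I -> R) i j :
  `|z i - z j| <= 2 * \sum_s `|z (ordS s) - z s|.
Proof.
pose S := \sum_s `|z (ordS s) - z s|.
suff H (k : I) : `|z k - z ord0| <= S.
  rewrite (_ : z i - z j = (z i - z ord0) - (z j - z ord0)); last by ring.
  by apply: (le_trans (ler_normB _ _)); have := H i; have := H j; rewrite -/S; lra.
pose zz (n : nat) := z (inord n).
have Hn n : (n < M)%N -> `|zz n - zz 0%N| <= \sum_(s < n) `|zz s.+1 - zz s|.
  elim: n => [|n IH] nM; first by rewrite subrr normr0 big_ord0.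
  rewrite big_ord_recr /= addrC.
  rewrite (_ : _ - _ = (zz n.+1 - zz n) + (zz n - zz 0%N)); last by ring.
  by apply: (le_trans (ler_normD _ _)); rewrite lerD2l IH// ltnW.
have := Hn k (ltn_ord k); rewrite /zz inord_val.
rewrite (_ : inord 0 = ord0); last by apply: val_inj; rewrite /= inordK.
move=> H; apply: (le_trans H).
rewrite /S (bigID (fun s : I => (s < k)%N)) /= ler_wpDr ?sumr_ge0//.
have kM := ltn_ord k.
rewrite (big_ord_widen_cond M xpredT (fun s => `|z (inord s.+1) - z (inord s)|)); last by exact: ltnW.
apply: le_of_eq; apply: eq_bigr => s sk.
rewrite inord_val; congr `|z _ - _|; apply: val_inj => /=.
have sM : (s.+1 < M)%N by exact: leq_ltn_trans kM.
by rewrite inordK// modn_small.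
Qed.

Definition agmon_cst : R := 1 + 4 * period.

(** A one-dimensional Sobolev inequality: z^2 oscillates by at most twice
    its total variation, and |(z^2)'| <= z^2 + z'^2. Averaging over the
    second point gives the bound. *)
Lemma agmon (z : I -> R) i :
  z i ^+ 2 <= agmon_cst * avg1 (fun j => z j ^+ 2 + dif1 z j ^+ 2).
Proof.
set A := avg1 _.
have h0 := mesh_gt0 w_gt0 p.
have MM : M%:R * M%:R^-1 = 1 :> R by rewrite divff// M_neq0.
have osc j : z i ^+ 2 <= z j ^+ 2 + 4 * (period * A).
  have := oscillation_le (fun s => z s ^+ 2) i j.
  have -> : 4 * (period * A) = 2 * (mesh * \sum_s (z s ^+ 2 + z (ordS s) ^+ 2 + 2 * dif1 z s ^+ 2)).
    have E : \sum_s z (ordS s) ^+ 2 = \sum_s z s ^+ 2.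
      by rewrite [RHS](reindex_inj (@ordS_inj _)).
    rewrite big_split big_split /= E -mulr_sumr.
    by rewrite meshE /A avg1D /avg1; ring.
  have : \sum_s `|z (ordS s) ^+ 2 - z s ^+ 2| <=
     mesh * \sum_s (z s ^+ 2 + z (ordS s) ^+ 2 + 2 * dif1 z s ^+ 2).
    rewrite mulr_sumr; apply: ler_sum => s _.
    have -> : z (ordS s) = z s + mesh * dif1 z s.
      by rewrite /dif1 mulrC divfK ?gt_eqF// addrC subrK.
    move: (z s) (dif1 z s) => x d.
    have -> : (x + mesh * d) ^+ 2 - x ^+ 2 = mesh * (d * (x + (x + mesh * d))) by ring.
    rewrite normrM (gtr0_norm h0); apply: (ler_wpM2l (ltW h0)).
    move: (x + mesh * d) => y; rewrite ler_norml.
    have := sqr_ge0 (x + d); have := sqr_ge0 (y + d);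
    have := sqr_ge0 (x - d); have := sqr_ge0 (y - d); have := sqr_ge0 x; have := sqr_ge0 y.
    by move=> *; apply/andP; split; nra.
  by move=> H1 H2; have := ler_norm (z i ^+ 2 - z j ^+ 2); lra.
have := avg1_le osc; rewrite avg1_cst avg1D avg1_cst => H; apply: (le_trans H).
have : avg1 (fun j => z j ^+ 2) <= A.
  by apply: avg1_le => j; rewrite lerDl sqr_ge0.
by rewrite /agmon_cst; lra.
Qed.

(** By [agmon] in one variable, g^2 is bounded by a function of the first
    coordinate alone and k^2 by a function of the second alone, and the
    average of their product is the product of their averages. This
    replaces the embedding of H^1 in L^4. *)
Lemma product_estimate (g k : G -> R) :
  avg (fun x => g x ^+ 2 * k x ^+ 2) <= agmon_cst ^+ 2 * (sob1 g * sob1 k).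
Proof.
(* The bounds of g^2 and k^2 by functions of one coordinate each. *)
pose Gb i := avg1 (fun j => g (i, j) ^+ 2 + dif true g (i, j) ^+ 2).
pose Kb j := avg1 (fun i => k (i, j) ^+ 2 + dif false k (i, j) ^+ 2).
have Gb0 i : 0 <= Gb i by apply: avg1_ge0 => j; apply: addr_ge0; exact: sqr_ge0.
have Kb0 i : 0 <= Kb i by apply: avg1_ge0 => j; apply: addr_ge0; exact: sqr_ge0.
have gG i j : g (i, j) ^+ 2 <= agmon_cst * Gb i by exact: (agmon (fun j => g (i, j))).
have kK i j : k (i, j) ^+ 2 <= agmon_cst * Kb j by exact: (agmon (fun i => k (i, j))).
have gn : avg1 Gb <= sob1 g.
  rewrite -(avgE1 (fun x => g x ^+ 2 + dif true g x ^+ 2)) avgD /sob1 lerD2l big_bool /= lerDl.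
  by apply: avg_ge0 => x; exact: sqr_ge0.
have kn : avg1 Kb <= sob1 k.
  rewrite -(avgE2 (fun x => k x ^+ 2 + dif false k x ^+ 2)) avgD /sob1 lerD2l big_bool /= lerDr.
  by apply: avg_ge0 => x; exact: sqr_ge0.
apply: (@le_trans _ _ (agmon_cst ^+ 2 * (avg1 Gb * avg1 Kb))); last first.
  apply: ler_wpM2l; first exact: sqr_ge0.
  by apply: ler_pM => //; exact: avg1_ge0.
have -> : agmon_cst ^+ 2 * (avg1 Gb * avg1 Kb) = avg1 (fun i => avg1 (fun j => (agmon_cst * Gb i) * (agmon_cst * Kb j))).
  transitivity (avg1 (fun i => (agmon_cst * Gb i) * (agmon_cst * avg1 Kb))); last first.
    by congr avg1; apply/funext => i; rewrite -avg1Z -avg1Z.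
  transitivity (avg1 (fun i => (agmon_cst ^+ 2 * avg1 Kb) * Gb i)); last first.
    by congr avg1; apply/funext => i; ring.
  by rewrite avg1Z; ring.
rewrite avgE1; apply: avg1_le => i; apply: avg1_le => j.
by apply: ler_pM; rewrite ?sqr_ge0.
Qed.

End ProductEstimate.

(** * Rules for discrete Sobolev norms *)

Section NormRules.
Context {R : realType}.
Variables (w : R).
Hypothesis w_gt0 : 0 < w.
Variable p : nat.
Local Notation G := (grid p).
Local Notation mesh := (@mesh R w p).
Local Notation dif := (@dif R w p).
Local Notation sob1 := (@sob1 R w p).
Local Notation sob2 := (@sob2 R w p).
Implicit Types f g : G -> R.

Lemma translateC i j (x : G) : translate i (translate j x) = translate j (translate i x).
Proof. by case: i j => -[]. Qed.

Lemma dif_translate i j f : dif j (fun x => f (translate i x)) = fun x => dif j f (translate i x).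
Proof. by apply/funext => x; rewrite /dif translateC. Qed.

Lemma dif_sum i (J : finType) (f : J -> G -> R) :
  dif i (fun x => \sum_j f j x) = fun x => \sum_j dif i (f j) x.
Proof. by apply/funext => x; rewrite /dif -sumrB mulr_suml. Qed.

Lemma dif_scale i a f : dif i (fun x => a * f x) = fun x => a * dif i f x.
Proof. by apply/funext => x; rewrite /dif -mulrBr mulrA. Qed.

Lemma avg_sqr_ge0 f : 0 <= avg (fun x => f x ^+ 2).
Proof. by apply: avg_ge0 => x; exact: sqr_ge0. Qed.

Lemma sob1_ge0 f : 0 <= sob1 f.
Proof.
by apply: addr_ge0; [|apply: sumr_ge0 => i _]; exact: avg_sqr_ge0.
Qed.

Lemma sob1_le_sob2 f : sob1 f <= sob2 f.
Proof.
by rewrite lerDl; apply: sumr_ge0 => i _; apply: sumr_ge0 => j _; exact: avg_sqr_ge0.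
Qed.

Lemma avg_sqr_le_sob1 f : avg (fun x => f x ^+ 2) <= sob1 f.
Proof. by rewrite lerDl; apply: sumr_ge0 => i _; exact: avg_sqr_ge0. Qed.

Lemma avg_dif_le_sob1 i f : avg (fun x => dif i f x ^+ 2) <= sob1 f.
Proof.
apply: (@le_trans _ _ (\sum_i avg (fun x => dif i f x ^+ 2))).
  by apply: (@ler_term _ _ (fun i => avg (fun x => dif i f x ^+ 2))) => j; exact: avg_sqr_ge0.
by rewrite lerDr; exact: avg_sqr_ge0.
Qed.

Lemma sob1_dif_le_sob2 i f : sob1 (dif i f) <= sob2 f.
Proof.
rewrite /sob2 /sob1 !big_bool /=.
have := avg_sqr_ge0 f; have := avg_sqr_ge0 (dif (~~ i) f).
have := avg_sqr_ge0 (dif true (dif (~~ i) f)); have := avg_sqr_ge0 (dif false (dif (~~ i) f)).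
by case: i => /=; lra.
Qed.

Lemma sob1_translate i f : sob1 (fun x => f (translate i x)) = sob1 f.
Proof.
rewrite /sob1 (avg_translate i (fun x => f x ^+ 2)); congr (_ + _).
by apply: eq_bigr => j _; rewrite dif_translate (avg_translate i (fun x => dif j f x ^+ 2)).
Qed.

Lemma avg_sqr_sum (J : finType) (f : J -> G -> R) :
  avg (fun x => (\sum_j f j x) ^+ 2) <= #|J|%:R * \sum_j avg (fun x => f j x ^+ 2).
Proof.
rewrite -avg_sum -avgZ; apply: avg_le => x; exact: sqr_sum_le.
Qed.

Lemma sob1_sum (J : finType) (f : J -> G -> R) :
  sob1 (fun x => \sum_j f j x) <= #|J|%:R * \sum_j sob1 (f j).
Proof.
rewrite /sob1 big_split /= mulrDr; apply: lerD; first exact: avg_sqr_sum.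
rewrite exchange_big mulr_sumr; apply: ler_sum => i _.
by rewrite dif_sum; exact: avg_sqr_sum.
Qed.

Lemma sob2_sum (J : finType) (f : J -> G -> R) :
  sob2 (fun x => \sum_j f j x) <= #|J|%:R * \sum_j sob2 (f j).
Proof.
rewrite {2}/sob2 big_split /= mulrDr; apply: lerD; first exact: sob1_sum.
rewrite [X in _ <= _ * X]exchange_big mulr_sumr; apply: ler_sum => i _.
rewrite [X in _ <= _ * X]exchange_big mulr_sumr; apply: ler_sum => j _.
by rewrite !dif_sum; exact: avg_sqr_sum.
Qed.

Let avg_scale a f : avg (fun x => (a * f x) ^+ 2) = a ^+ 2 * avg (fun x => f x ^+ 2).
Proof. by rewrite -avgZ; apply: avg_ext => x; rewrite exprMn. Qed.

Lemma sob1_scale a f : sob1 (fun x => a * f x) = a ^+ 2 * sob1 f.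
Proof.
rewrite /sob1 mulrDr mulr_sumr avg_scale; congr (_ + _).
by apply: eq_bigr => i _; rewrite dif_scale avg_scale.
Qed.

Lemma sob2_scale a f : sob2 (fun x => a * f x) = a ^+ 2 * sob2 f.
Proof.
rewrite /sob2 sob1_scale [RHS]mulrDr mulr_sumr; congr (_ + _).
apply: eq_bigr => i _; rewrite mulr_sumr; apply: eq_bigr => j _.
by rewrite !dif_scale avg_scale.
Qed.

Lemma sob1D f g : sob1 (fun x => f x + g x) <= 2 * (sob1 f + sob1 g).
Proof.
have := sob1_sum (fun b : bool => if b then f else g).
rewrite card_bool big_bool /= => H; apply: le_trans H.
apply: le_of_eq; congr sob1.
by apply/funext => x; rewrite big_bool.
Qed.

Lemma sob2D f g : sob2 (fun x => f x + g x) <= 2 * (sob2 f + sob2 g).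
Proof.
have := sob2_sum (fun b : bool => if b then f else g).
rewrite card_bool big_bool /= => H; apply: le_trans H.
apply: le_of_eq; congr sob2.
by apply/funext => x; rewrite big_bool.
Qed.

End NormRules.

(** * Composition on the grid with a function of class C^2 *)

Section GridComposition.
Context {R : realType}.
Variables (w : R).
Hypothesis w_gt0 : 0 < w.
Variable p : nat.
Local Notation G := (grid p).
Local Notation mesh := (@mesh R w p).
Local Notation dif := (@dif R w p).
Local Notation sob1 := (@sob1 R w p).
Local Notation sob2 := (@sob2 R w p).
Local Notation sob2p := (@sob2p R w p).
Local Notation agmon_cst := (@agmon_cst R w).

Variables (d : nat) (F : 'rV[R]_d -> R) (C rho : R).
Hypothesis dF : forall (k : 'I_d) z, derivable F z (delta_mx 0 k).
Hypothesis ddF : forall (q k : 'I_d) z, derivable (partial q F) z (delta_mx 0 k).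
Hypothesis F0 : F 0 = 0.
Hypothesis gradF0 : forall q, partial q F 0 = 0.
Hypothesis C_ge0 : 0 <= C.
Hypothesis hessF : forall q k x, l1 x <= rho -> `|partial k (partial q F) x| <= C.

Definition vec (W : 'I_d -> G -> R) (x : G) : 'rV[R]_d := \row_q W q x.

(** The two norms in which the jets of the iterates are controlled:
    pointwise, to stay where the derivatives of [F] are bounded, and in
    H^2. *)
Definition small (s : R) (W : 'I_d -> G -> R) : Prop :=
  (forall q x, `|W q x| <= s) /\ (forall q, sob2 (W q) <= s ^+ 2).

Lemma l1_vec W x : l1 (vec W x) = \sum_q `|W q x|.
Proof. by apply: eq_bigr => q _; rewrite mxE. Qed.

Lemma l1_vec_small s W x : small s W -> l1 (vec W x) <= d%:R * s.
Proof.
move=> [Ws _]; rewrite l1_vec.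
apply: (@le_trans _ _ (\sum_(q < d) s)); first by apply: ler_sum => q _.
by rewrite sumr_const card_ord mulr_natl.
Qed.

Let h0 : 0 < mesh. Proof. exact: mesh_gt0. Qed.

Let D : R := d%:R.

(** The L^4 norm of differences, by the product estimate; it is what the
    squares of first differences in [second_difference_bound] call for. *)
Lemma avg_sum4 (a : 'I_d -> G -> R) (s : R) :
  0 <= s -> (forall q, sob1 (a q) <= s ^+ 2) ->
  avg (fun x => (\sum_q `|a q x|) ^+ 2 ^+ 2) <= D ^+ 4 * (agmon_cst ^+ 2 * s ^+ 4).
Proof.
move=> s0 aq.
apply: (@le_trans _ _ (avg (fun x => D ^+ 3 * \sum_q (a q x ^+ 2 * a q x ^+ 2)))).
  apply: avg_le => x.
  have H1 : (\sum_q `|a q x|) ^+ 2 <= D * \sum_q a q x ^+ 2.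
    have := sqr_sum_le (fun q => `|a q x|); rewrite card_ord => H; apply: (le_trans H).
    by apply: ler_wpM2l => //; apply: ler_sum => q _; rewrite real_normK ?num_real.
  have H2 : (\sum_q a q x ^+ 2) ^+ 2 <= D * \sum_q (a q x ^+ 2 * a q x ^+ 2).
    have := sqr_sum_le (fun q => a q x ^+ 2); rewrite card_ord => H; apply: (le_trans H).
    by apply: ler_wpM2l => //; apply: ler_sum => q _; rewrite [leLHS]expr2.
  apply: (@le_trans _ _ ((D * \sum_q a q x ^+ 2) ^+ 2)).
    by rewrite [leLHS]expr2 [leRHS]expr2; apply: ler_pM => //; exact: sqr_ge0.
  rewrite exprMn (exprSr D 2) -mulrA; apply: ler_wpM2l; first exact: sqr_ge0.
  exact: H2.
rewrite avgZ avg_sum (exprSr D 3) -mulrA; apply: ler_wpM2l; first exact: exprn_ge0.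
apply: (@le_trans _ _ (\sum_(q < d) agmon_cst ^+ 2 * s ^+ 4)); last first.
  by rewrite sumr_const card_ord mulr_natl.
apply: ler_sum => q _; apply: (le_trans (product_estimate w_gt0 _ _)).
apply: ler_wpM2l; first exact: sqr_ge0.
have -> : s ^+ 4 = s ^+ 2 * s ^+ 2 by rewrite -exprD.
by apply: ler_pM; rewrite ?sob1_ge0.
Qed.

Lemma avg_sum2 (a : 'I_d -> G -> R) :
  avg (fun x => (\sum_q `|a q x|) ^+ 2) <= D * \sum_q avg (fun x => a q x ^+ 2).
Proof.
have := @avg_sqr_sum _ p _ (fun q x => `|a q x|); rewrite card_ord => H.
apply: (le_trans H); apply: ler_wpM2l => //; apply: ler_sum => q _.
by apply: avg_le => x; rewrite real_normK ?num_real.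
Qed.

Lemma second_difference_bound s W i x : small s W -> 0 <= s -> 3 * (D * s) <= rho ->
  `|dif i (dif i (fun x => F (vec W x))) x| <=
   C * (D * s) * (\sum_q `|dif i (dif i (W q)) x|)
   + C * (\sum_q `|dif i (W q) (translate i x)|) ^+ 2
   + C * (\sum_q `|dif i (W q) x|) ^+ 2.
Proof.
move=> Ws s0 sr.
have sm y := l1_vec_small y Ws.
pose x1 := translate i x; pose x2 := translate i x1.
have bd y y' : l1 (vec W y) + (l1 (vec W y) + l1 (vec W y')) <= rho.
  by have := sm y; have := sm y'; rewrite -/D; lra.
have := C2_second_difference dF ddF gradF0 C_ge0 hessF (bd x1 x) (bd x1 x2).
have -> : l1 (vec W x2 - 2 *: vec W x1 + vec W x) =
    mesh ^+ 2 * \sum_q `|dif i (dif i (W q)) x|.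
  rewrite /l1 mulr_sumr; apply: eq_bigr => q _; rewrite !mxE.
  rewrite -[in RHS](gtr0_norm h0) -normrX -normrM; congr `|_|.
  by rewrite /dif -/x1 -/x2; field; rewrite gt_eqF.
have E y : l1 (vec W (translate i y) - vec W y) = mesh * \sum_q `|dif i (W q) y|.
  rewrite /l1 mulr_sumr; apply: eq_bigr => q _; rewrite !mxE.
  rewrite -[in RHS](gtr0_norm h0) -normrM; congr `|_|.
  by rewrite /dif; field; rewrite gt_eqF.
rewrite (E x1) (E x).
have -> : dif i (dif i (fun x => F (vec W x))) x =
   (F (vec W x2) - 2 * F (vec W x1) + F (vec W x)) / mesh ^+ 2.
  by rewrite /dif -/x1 -/x2; field; rewrite gt_eqF.
have h2 : 0 < mesh ^+ 2 by rewrite exprn_gt0.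
rewrite normrM normfV (gtr0_norm h2) ler_pdivrMr//.
move: (`|F _ - _ + _|) => T HT; apply: (le_trans HT).
have S0 : 0 <= mesh ^+ 2 * \sum_q `|dif i (dif i (W q)) x|.
  by apply: mulr_ge0; [exact: ltW | apply: sumr_ge0].
have := ler_wpM2r S0 (ler_wpM2l C_ge0 (sm x1)).
move: (\sum_q `|dif i (dif i (W q)) x|) (\sum_q `|dif i (W q) x1|) (\sum_q `|dif i (W q) x|).
move=> a b c; rewrite -/D => H.
have -> : (C * (D * s) * a + C * b ^+ 2 + C * c ^+ 2) * mesh ^+ 2 =
  C * (D * s) * (mesh ^+ 2 * a) + C * ((mesh * b) ^+ 2 + (mesh * c) ^+ 2) by ring.
by rewrite lerD2r.
Qed.

(** The superposition operator of [F] sends a ball of radius [s] of H^2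
    into one of radius O(s^2). In the second difference of F(W), the
    gradient of [F] is of size [s], and squares of first differences are of
    size s^2 in L^2 by the product estimate. *)
Lemma sob2p_comp s W : small s W -> 0 <= s -> 3 * (D * s) <= rho ->
  sob2p (fun x => F (vec W x)) <= (C ^+ 2 * D ^+ 4 * (7 + 12 * agmon_cst ^+ 2)) * s ^+ 4.
Proof.
move=> Ws s0 sr; have [Wsup Wn2] := Ws.
have D0 : 0 <= D by [].
have Ds0 : 0 <= D * s by exact: mulr_ge0.
have P0 : avg (fun x => F (vec W x) ^+ 2) <= C ^+ 2 * D ^+ 4 * s ^+ 4.
  rewrite -[leRHS](@avg_cst _ p); apply: avg_le => x.
  have -> : C ^+ 2 * D ^+ 4 * s ^+ 4 = (C * (D * s) ^+ 2) ^+ 2 by ring.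
  apply: sqr_le_abs; have sm := l1_vec_small x Ws.
  have sm' : l1 (vec W x) <= rho by rewrite -/D in sm; lra.
  apply: (le_trans (C2_quadratic dF ddF F0 gradF0 C_ge0 hessF sm')).
  apply: ler_wpM2l => //; rewrite [leLHS]expr2 [leRHS]expr2.
  by apply: ler_pM => //; exact: l1_ge0.
have P1 i : avg (fun x => dif i (dif i (fun x => F (vec W x))) x ^+ 2) <=
    C ^+ 2 * D ^+ 4 * (3 + 6 * agmon_cst ^+ 2) * s ^+ 4.
  pose a q := dif i (W q).
  pose B x := \sum_q `|dif i (dif i (W q)) x|.
  pose A x := \sum_q `|a q x|.
  apply: (@le_trans _ _ (avg (fun x => 3 * (C * (D * s)) ^+ 2 * B x ^+ 2 +
      (3 * C ^+ 2 * A (translate i x) ^+ 2 ^+ 2 + 3 * C ^+ 2 * A x ^+ 2 ^+ 2)))).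
    apply: avg_le => x; apply: (le_trans (sqr_le_abs (second_difference_bound i x Ws s0 sr))).
    apply: (le_trans (sqr3_le _ _ _)).
    rewrite -/(B x) -/(A x) -/(A (translate i x)).
    by apply: le_of_eq; ring.
  rewrite !avgD !avgZ (avg_translate i (fun x => A x ^+ 2 ^+ 2)).
  have HB : avg (fun x => B x ^+ 2) <= D ^+ 2 * s ^+ 2.
    apply: (le_trans (avg_sum2 _)); rewrite [D ^+ 2]expr2 -mulrA.
    apply: ler_wpM2l => //.
    apply: (@le_trans _ _ (\sum_(q < d) s ^+ 2)); last first.
      by rewrite sumr_const card_ord mulr_natl.
    apply: ler_sum => q _; apply: le_trans (Wn2 q).
    by apply: le_trans (avg_dif_le_sob1 _ _ _) (sob1_dif_le_sob2 _ _ _).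
  have HA : avg (fun x => A x ^+ 2 ^+ 2) <= D ^+ 4 * (agmon_cst ^+ 2 * s ^+ 4).
    apply: avg_sum4 => // q; apply: le_trans (Wn2 q); exact: sob1_dif_le_sob2.
  have := ler_wpM2l (sqr_ge0 C) HA.
  have := ler_wpM2l (sqr_ge0 (C * (D * s))) HB.
  have -> : C ^+ 2 * D ^+ 4 * (3 + 6 * agmon_cst ^+ 2) * s ^+ 4 =
    3 * ((C * (D * s)) ^+ 2 * (D ^+ 2 * s ^+ 2))
    + 6 * (C ^+ 2 * (D ^+ 4 * (agmon_cst ^+ 2 * s ^+ 4))) by ring.
  by rewrite -!mulrA; lra.
rewrite /sob2p big_bool /=; have := P1 true; have := P1 false.
have -> : C ^+ 2 * D ^+ 4 * (7 + 12 * agmon_cst ^+ 2) * s ^+ 4 = C ^+ 2 * D ^+ 4 * s ^+ 4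
  + 2 * (C ^+ 2 * D ^+ 4 * (3 + 6 * agmon_cst ^+ 2) * s ^+ 4) by ring.
lra.
Qed.

Lemma difference_bound s W V i x : small s W -> small s V -> 0 <= s ->
  4 * (D * s) <= rho ->
  `|dif i (fun x => F (vec W x) - F (vec V x)) x| <=
   C * (2 * (D * s)) * (\sum_q `|dif i (fun y => W q y - V q y) x|)
   + C * (\sum_q `|W q x - V q x|) * (\sum_q `|dif i (V q) x|)
   + C * (\sum_q `|W q (translate i x) - V q (translate i x)|) * (\sum_q `|dif i (V q) x|).
Proof.
move=> Ws Vs s0 sr.
have smW y := l1_vec_small y Ws; have smV y := l1_vec_small y Vs.
pose x1 := translate i x.
have bd : (l1 (vec W x) + l1 (vec W x1)) + (l1 (vec V x) + l1 (vec V x1)) <= rho.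
  have := smW x; have := smW x1; have := smV x; have := smV x1; rewrite -/D; lra.
have := C2_four_points dF ddF gradF0 C_ge0 hessF bd.
have E y : l1 (vec W y - vec V y) = \sum_q `|W q y - V q y|.
  by rewrite /l1; apply: eq_bigr => q _; rewrite !mxE.
have -> : l1 (vec W x1 - vec W x - (vec V x1 - vec V x)) =
   mesh * \sum_q `|dif i (fun y => W q y - V q y) x|.
  rewrite /l1 mulr_sumr; apply: eq_bigr => q _; rewrite !mxE.
  rewrite -[in RHS](gtr0_norm h0) -normrM; congr `|_|.
  by rewrite /dif -/x1; field; rewrite gt_eqF.
have -> : l1 (vec V x1 - vec V x) = mesh * \sum_q `|dif i (V q) x|.
  rewrite /l1 mulr_sumr; apply: eq_bigr => q _; rewrite !mxE.
  rewrite -[in RHS](gtr0_norm h0) -normrM; congr `|_|.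
  by rewrite /dif -/x1; field; rewrite gt_eqF.
rewrite !E.
have -> : dif i (fun x => F (vec W x) - F (vec V x)) x =
   (F (vec W x1) - F (vec W x) - (F (vec V x1) - F (vec V x))) / mesh.
  by rewrite /dif -/x1; congr (_ / _); ring.
rewrite normrM normfV (gtr0_norm h0) ler_pdivrMr//.
move: (`|F _ - _ - _|) => T HT; apply: (le_trans HT).
have S0 : 0 <= mesh * \sum_q `|dif i (fun y => W q y - V q y) x|.
  by apply: mulr_ge0; [exact: ltW | apply: sumr_ge0].
have HH : l1 (vec W x) + l1 (vec W x1) <= 2 * (D * s).
  by have := smW x; have := smW x1; rewrite -/D; lra.
have := ler_wpM2r S0 (ler_wpM2l C_ge0 HH).
move: (\sum_q `|dif i (fun y => W q y - V q y) x|) (\sum_q `|dif i (V q) x|).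
move: (\sum_q `|W q x - V q x|) (\sum_q `|W q x1 - V q x1|).
move=> u u1 a b H.
have -> : (C * (2 * (D * s)) * a + C * u * b + C * u1 * b) * mesh =
  C * (2 * (D * s)) * (mesh * a) + C * (u + u1) * (mesh * b) by ring.
by rewrite lerD2r.
Qed.

Lemma avg_sum_mul (u b : 'I_d -> G -> R) (s : R) :
  (forall q, sob1 (b q) <= s ^+ 2) ->
  avg (fun x => (\sum_q `|u q x|) ^+ 2 * (\sum_q `|b q x|) ^+ 2) <=
    D ^+ 3 * (agmon_cst ^+ 2 * s ^+ 2) * \sum_q sob1 (u q).
Proof.
move=> bq.
apply: (@le_trans _ _ (avg (fun x => D ^+ 2 *
    \sum_q \sum_q' (u q x ^+ 2 * b q' x ^+ 2)))).
  apply: avg_le => x.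
  have H (a : 'I_d -> G -> R) : (\sum_q `|a q x|) ^+ 2 <= D * \sum_q a q x ^+ 2.
    have := sqr_sum_le (fun q => `|a q x|); rewrite card_ord => H; apply: (le_trans H).
    by apply: ler_wpM2l => //; apply: ler_sum => q _; rewrite real_normK ?num_real.
  apply: (@le_trans _ _ ((D * \sum_q u q x ^+ 2) * (D * \sum_q b q x ^+ 2))).
    by apply: ler_pM; rewrite ?sqr_ge0 ?H.
  apply: le_of_eq.
  by rewrite -big_distrlr /=; ring.
rewrite avgZ avg_sum.
have -> : D ^+ 3 * (agmon_cst ^+ 2 * s ^+ 2) * \sum_q sob1 (u q) =
  D ^+ 2 * \sum_q (D * (agmon_cst ^+ 2 * s ^+ 2 * sob1 (u q))) by rewrite -!mulr_sumr; ring.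
apply: ler_wpM2l; first exact: sqr_ge0.
apply: ler_sum => q _; rewrite avg_sum.
apply: (@le_trans _ _ (\sum_(q' < d) (agmon_cst ^+ 2 * s ^+ 2 * sob1 (u q)))); last first.
  by rewrite sumr_const card_ord mulr_natl.
apply: ler_sum => q' _; apply: (le_trans (product_estimate w_gt0 _ _)).
rewrite -mulrA; apply: ler_wpM2l; first exact: sqr_ge0.
by rewrite mulrC; apply: ler_wpM2r; [exact: sob1_ge0 | exact: bq].
Qed.

(** Superposition by [F] is a contraction in H^1 when [s] is small. In the
    term where a difference of gradients multiplies the difference quotient
    of V, the first factor is controlled in H^1 and so is the second,
    because V is bounded in H^2; the product estimate applies again. *)
Lemma sob1_comp s W V : small s W -> small s V -> 0 <= s -> 4 * (D * s) <= rho ->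
  sob1 (fun x => F (vec W x) - F (vec V x)) <=
  (C ^+ 2 * D ^+ 3 * (16 + 12 * agmon_cst ^+ 2)) * s ^+ 2 * \sum_q sob1 (fun x => W q x - V q x).
Proof.
move=> Ws Vs s0 sr.
have [Wsup Wn2] := Ws; have [Vsup Vn2] := Vs.
have D0 : 0 <= D by [].
have Ds0 : 0 <= D * s by exact: mulr_ge0.
pose U q x := W q x - V q x.
set N := \sum_q sob1 (fun x => W q x - V q x).
have N0 : 0 <= N by apply: sumr_ge0 => q _; exact: sob1_ge0.
pose K := C ^+ 2 * D ^+ 3 * s ^+ 2 * N.
have P0 : avg (fun x => (F (vec W x) - F (vec V x)) ^+ 2) <= 4 * K.
  apply: (@le_trans _ _ (avg (fun x => (C * (2 * (D * s))) ^+ 2 * (\sum_q `|U q x|) ^+ 2))).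
    apply: avg_le => x; rewrite -exprMn; apply: sqr_le_abs.
    have smW := l1_vec_small x Ws; have smV := l1_vec_small x Vs; rewrite -/D in smW smV.
    have bd : l1 (vec V x) + l1 (vec W x) <= rho by lra.
    apply: (le_trans (C2_lipschitz dF ddF gradF0 C_ge0 hessF bd)).
    have -> : l1 (vec W x - vec V x) = \sum_q `|U q x|.
      by rewrite /l1; apply: eq_bigr => q _; rewrite !mxE.
    apply: ler_wpM2r; first exact: sumr_ge0.
    by apply: ler_wpM2l => //; lra.
  rewrite avgZ.
  have : avg (fun x => (\sum_q `|U q x|) ^+ 2) <= D * N.
    apply: (le_trans (avg_sum2 _)); apply: ler_wpM2l => //.
    by apply: ler_sum => q _; exact: avg_sqr_le_sob1.
  move=> /(ler_wpM2l (sqr_ge0 (C * (2 * (D * s))))) H; apply: (le_trans H).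
  by apply: le_of_eq; rewrite /K; ring.
have P1 i : avg (fun x => dif i (fun x => F (vec W x) - F (vec V x)) x ^+ 2) <=
    (6 * agmon_cst ^+ 2) * K + 12 * C ^+ 2 * D ^+ 2 * s ^+ 2 * (D * \sum_q avg (fun x => dif i (U q) x ^+ 2)).
  pose A x := \sum_q `|dif i (U q) x|.
  pose B x := \sum_q `|dif i (V q) x|.
  pose UU x := \sum_q `|U q x|.
  apply: (@le_trans _ _ (avg (fun x => 12 * C ^+ 2 * D ^+ 2 * s ^+ 2 * A x ^+ 2 +
      (3 * C ^+ 2 * (UU x ^+ 2 * B x ^+ 2) + 3 * C ^+ 2 * (UU (translate i x) ^+ 2 * B x ^+ 2))))).
    apply: avg_le => x; apply: (le_trans (sqr_le_abs (difference_bound i x Ws Vs s0 sr))).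
    apply: (le_trans (sqr3_le _ _ _)).
    rewrite -/(A x) -/(B x) -/(UU x) -/(UU (translate i x)).
    by apply: le_of_eq; ring.
  rewrite !avgD !avgZ.
  have bn q : sob1 (dif i (V q)) <= s ^+ 2 by exact: le_trans (sob1_dif_le_sob2 _ _ _) (Vn2 q).
  have HA : avg (fun x => A x ^+ 2) <= D * \sum_q avg (fun x => dif i (U q) x ^+ 2).
    exact: avg_sum2.
  have HB : avg (fun x => UU x ^+ 2 * B x ^+ 2) <= D ^+ 3 * (agmon_cst ^+ 2 * s ^+ 2) * N.
    exact: avg_sum_mul bn.
  have HC : avg (fun x => UU (translate i x) ^+ 2 * B x ^+ 2) <= D ^+ 3 * (agmon_cst ^+ 2 * s ^+ 2) * N.
    have := avg_sum_mul (fun q x => U q (translate i x)) bn.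
    by rewrite (eq_bigr (fun q => sob1 (U q))) // => q _; rewrite (sob1_translate w i (U q)).
  have a0 : 0 <= 12 * C ^+ 2 * D ^+ 2 * s ^+ 2.
    by apply: mulr_ge0; [apply: mulr_ge0; [apply: mulr_ge0|]|]; rewrite ?sqr_ge0.
  have := ler_wpM2l a0 HA.
  have := ler_wpM2l (sqr_ge0 C) HB; have := ler_wpM2l (sqr_ge0 C) HC.
  have -> : 6 * agmon_cst ^+ 2 * K = 6 * (C ^+ 2 * (D ^+ 3 * (agmon_cst ^+ 2 * s ^+ 2) * N)).
    by rewrite /K; ring.
  by rewrite -!mulrA; lra.
have PP : \sum_i \sum_q avg (fun x => dif i (U q) x ^+ 2) <= N.
  rewrite exchange_big; apply: ler_sum => q _.
  by rewrite /sob1 lerDr; exact: avg_sqr_ge0.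
rewrite /sob1 big_bool /=; have := P1 true; have := P1 false.
move: PP; rewrite big_bool /= => PP.
have a0 : 0 <= 12 * C ^+ 2 * D ^+ 2 * s ^+ 2 * D.
  by apply: mulr_ge0 => //; apply: mulr_ge0; [apply: mulr_ge0; [apply: mulr_ge0|]|]; rewrite ?sqr_ge0.
have := ler_wpM2l a0 PP.
have -> : C ^+ 2 * D ^+ 3 * (16 + 12 * agmon_cst ^+ 2) * s ^+ 2 * N =
  4 * K + 12 * agmon_cst ^+ 2 * K + 12 * C ^+ 2 * D ^+ 2 * s ^+ 2 * D * N by rewrite /K; ring.
move: (\sum_q avg (fun x => dif true (U q) x ^+ 2)) (\sum_q avg (fun x => dif false (U q) x ^+ 2)).
move=> s1 s2; rewrite mulrDr; lra.
Qed.

End GridComposition.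

(** * Cut-off monomials *)

Section Cutoff.
Context {R : realType}.

(** Functions with Lipschitz derivative on the interval from -T to T,
    described by first and second differences: this is what difference
    quotients on the grid see of a function, and it is stable under
    products. *)
Definition C11 (T : R) (g : R -> R) : Prop := exists C : R, [/\ 0 <= C,
  forall x, `|x| <= T -> `|g x| <= C,
  forall x y, `|x| <= T -> `|y| <= T -> `|g x - g y| <= C * `|x - y| &
  forall x h, 0 <= h -> `|x| <= T -> `|x + 2 * h| <= T ->
    `|g (x + 2 * h) - 2 * g (x + h) + g x| <= C * h ^+ 2].

Lemma C11_cst T a : C11 T (fun=> a).
Proof.
exists `|a|; split => // [x y _ _|x h _ _ _].
  by rewrite subrr normr0 mulr_ge0.
have -> : a - 2 * a + a = 0 by ring.
by rewrite normr0 mulr_ge0 ?sqr_ge0.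
Qed.

Lemma C11_id T : 0 <= T -> C11 T id.
Proof.
move=> T0; exists (T + 1); split => [|x xT|x y _ _|x h _ _ _]; first lra.
- by apply: (le_trans xT); lra.
- by rewrite ler_peMl//; lra.
- have -> : x + 2 * h - 2 * (x + h) + x = 0 by ring.
  by rewrite normr0 mulr_ge0 ?sqr_ge0//; lra.
Qed.

Lemma C11_mul T f g : C11 T f -> C11 T g -> C11 T (fun x => f x * g x).
Proof.
move=> [A [A0 fA fL fD]] [B [B0 gB gL gD]].
exists (4 * A * B); split.
- by rewrite !mulr_ge0.
- move=> x xT; rewrite normrM; have := ler_pM (normr_ge0 _) (normr_ge0 _) (fA _ xT) (gB _ xT).
  by have := mulr_ge0 A0 B0; lra.
- move=> x y xT yT.
  have -> : f x * g x - f y * g y = f x * (g x - g y) + (f x - f y) * g y by ring.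
  apply: (le_trans (ler_normD _ _)); rewrite !normrM.
  have := ler_pM (normr_ge0 _) (normr_ge0 _) (fA _ xT) (gL _ _ xT yT).
  have := ler_pM (normr_ge0 _) (normr_ge0 _) (fL _ _ xT yT) (gB _ yT).
  by have := mulr_ge0 (mulr_ge0 A0 B0) (normr_ge0 (x - y)); lra.
- move=> x h h0 xT x2T.
  have x1T : `|x + h| <= T.
    by move: xT x2T; rewrite !ler_norml => /andP[? ?] /andP[? ?]; apply/andP; split; lra.
  have -> : f (x + 2 * h) * g (x + 2 * h) - 2 * (f (x + h) * g (x + h)) + f x * g x =
   f (x + h) * (g (x + 2 * h) - 2 * g (x + h) + g x) +
   (f (x + 2 * h) - 2 * f (x + h) + f x) * g (x + h) +
   (f (x + 2 * h) - f (x + h)) * (g (x + 2 * h) - g (x + h)) +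
   (f (x + h) - f x) * (g (x + h) - g x) by ring.
  have E1 : `|x + 2 * h - (x + h)| = h by rewrite -[RHS]ger0_norm//; congr `|_|; ring.
  have E2 : `|x + h - x| = h by rewrite -[RHS]ger0_norm//; congr `|_|; ring.
  have := ler_pM (normr_ge0 _) (normr_ge0 _) (fA _ x1T) (gD _ _ h0 xT x2T).
  have := ler_pM (normr_ge0 _) (normr_ge0 _) (fD _ _ h0 xT x2T) (gB _ x1T).
  have := ler_pM (normr_ge0 _) (normr_ge0 _) (fL _ _ x2T x1T) (gL _ _ x2T x1T).
  have := ler_pM (normr_ge0 _) (normr_ge0 _) (fL _ _ x1T xT) (gL _ _ x1T xT).
  rewrite E1 E2 -!normrM => H1 H2 H3 H4.
  do 3!(apply: (le_trans (ler_normD _ _)); rewrite -?lerBrDr).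
  lra.
Qed.

Lemma C11_exp T j : 0 <= T -> C11 T (fun x => x ^+ j).
Proof.
move=> T0; elim: j => [|j IH]; first exact: C11_cst.
have -> : (fun x : R => x ^+ j.+1) = (fun x => x * x ^+ j).
  by apply/funext => x; rewrite exprS.
exact: C11_mul (C11_id T0) IH.
Qed.

Lemma C11_add T f g : C11 T f -> C11 T g -> C11 T (fun x => f x + g x).
Proof.
move=> [A [A0 fA fL fD]] [B [B0 gB gL gD]].
exists (A + B); split.
- exact: addr_ge0.
- by move=> x xT; apply: (le_trans (ler_normD _ _)); rewrite lerD ?fA ?gB.
- move=> x y xT yT.
  have -> : f x + g x - (f y + g y) = (f x - f y) + (g x - g y) by ring.
  by apply: (le_trans (ler_normD _ _)); rewrite [leRHS]mulrDl lerD ?fL ?gL.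
- move=> x h h0 xT x2T; rewrite [leRHS]mulrDl.
  have -> : f (x + 2 * h) + g (x + 2 * h) - 2 * (f (x + h) + g (x + h)) + (f x + g x) =
   (f (x + 2 * h) - 2 * f (x + h) + f x) + (g (x + 2 * h) - 2 * g (x + h) + g x) by ring.
  by apply: (le_trans (ler_normD _ _)); rewrite lerD ?fD ?gD.
Qed.

Lemma C11_opp T f : C11 T f -> C11 T (fun x => f (- x)).
Proof.
move=> [A [A0 fA fL fD]]; exists A; split => //.
- by move=> x xT; apply: fA; rewrite normrN.
- move=> x y xT yT; have := fL (- x) (- y); rewrite !normrN => /(_ xT yT) H.
  by apply: (le_trans H); rewrite -opprD normrN.
- move=> x h h0 xT x2T; have := fD (- (x + 2 * h)) h h0.
  have -> : - (x + 2 * h) + 2 * h = - x by ring.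
  have -> : - (x + 2 * h) + h = - (x + h) by ring.
  rewrite !normrN => /(_ x2T xT) H; apply: le_trans H.
  by apply: le_of_eq; congr `|_|; ring.
Qed.

(** The positive part squared, the simplest function of class C^(1,1) that
    is not a polynomial. *)
Definition sqpos (x : R) : R := Num.max 0 x ^+ 2.

Lemma sqpos_ge x : 0 <= x -> sqpos x = x ^+ 2.
Proof. by move=> x0; rewrite /sqpos max_r. Qed.

Lemma sqpos_le x : x <= 0 -> sqpos x = 0.
Proof. by move=> x0; rewrite /sqpos max_l// expr0n. Qed.

Lemma C11_sqpos T a : 0 <= T -> 0 <= a -> C11 T (fun x => sqpos (x + a)).
Proof.
move=> T0 a0; set B := T + a.
have B0 : 0 <= B by rewrite /B; lra.
have H x : `|x| <= T -> x + a <= B by rewrite ler_norml => /andP[? ?]; rewrite /B; lra.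
exists (B ^+ 2 + 2 * B + 2); split.
- by rewrite !addr_ge0 ?sqr_ge0 ?mulr_ge0.
- move=> x /H xB; have [x0|x0] := leP 0 (x + a).
    by rewrite sqpos_ge// ger0_norm ?sqr_ge0//; nra.
  by rewrite (sqpos_le (ltW x0)) normr0; nra.
- move=> x y /H xB /H yB.
  have -> : x - y = (x + a) - (y + a) by ring.
  move: (x + a) (y + a) xB yB => {x y} x y xB yB.
  wlog xy : x y xB yB / x <= y.
    move=> W; have [xy|/ltW xy] := leP x y; first exact: W.
    by rewrite distrC (distrC x); exact: W.
  rewrite [X in X <= _]distrC [`|x - y|]distrC (@ger0_norm _ (y - x)) ?subr_ge0//.
  have [x0|x0] := leP 0 x; have [y0|y0] := leP 0 y.
  + by rewrite !sqpos_ge// ger0_norm; nra.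
  + lra.
  + rewrite (sqpos_le (ltW x0)) sqpos_ge// subr0 ger0_norm ?sqr_ge0//; nra.
  + rewrite (sqpos_le (ltW x0)) (sqpos_le (ltW y0)) subr0 normr0; nra.
- move=> x h h0 _ _.
  have -> : x + 2 * h + a = (x + a) + 2 * h by ring.
  have -> : x + h + a = (x + a) + h by ring.
  move: (x + a) => {}x.
  have K : 2 * h ^+ 2 <= (B ^+ 2 + 2 * B + 2) * h ^+ 2.
    by rewrite ler_wpM2r ?sqr_ge0//; nra.
  apply: le_trans K.
  have [x0|x0] := leP 0 x.
    rewrite !sqpos_ge; [|lra..].
    by rewrite ler_norml; apply/andP; split; nra.
  have [x2|x2] := leP (x + 2 * h) 0.
    by rewrite !sqpos_le ?mulr0 ?subr0 ?addr0 ?normr0; [nra|lra..].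
  rewrite (sqpos_le (ltW x0)) (sqpos_ge (ltW x2)) addr0.
  have [x1|x1] := leP (x + h) 0.
    rewrite (sqpos_le x1) mulr0 subr0 ger0_norm ?sqr_ge0//; nra.
  rewrite (sqpos_ge (ltW x1)) ler_norml; apply/andP; split; nra.
Qed.

Variable r : R.
Hypothesis r_gt0 : 0 < r.

(** A quadratic spline: 0 to the left of -3r and 1 to the right of -r. *)
Definition step (x : R) : R :=
  (2 * r ^+ 2)^-1 * (sqpos (x + 3 * r) + (-2 * sqpos (x + 2 * r) + sqpos (x + r))).

Lemma step1 x : - r <= x -> step x = 1.
Proof.
move=> xr; have r0 := r_gt0.
rewrite /step (@sqpos_ge (x + 3 * r)) ?(@sqpos_ge (x + 2 * r)) ?(@sqpos_ge (x + r)); try lra.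
by field; rewrite gt_eqF.
Qed.

Lemma step0 x : x <= - (3 * r) -> step x = 0.
Proof.
move=> xr; have r0 := r_gt0.
rewrite /step (@sqpos_le (x + 3 * r)) ?(@sqpos_le (x + 2 * r)) ?(@sqpos_le (x + r)); try lra. Qed.

(** The corrector of the solution operator is a polynomial, which is not
    periodic. On the grid its monomials are replaced by these functions,
    equal to them for |x| <= r and vanishing for |x| >= 3r, hence well away
    from the seam of the torus. *)
Definition cutmono (j : nat) (x : R) : R := x ^+ j * (step x * step (- x)).

Lemma cutmonoE j x : `|x| <= r -> cutmono j x = x ^+ j.
Proof.
have r0 := r_gt0; rewrite ler_norml => /andP[x1 x2].
by rewrite /cutmono !step1 ?mulr1//; lra.
Qed.

Lemma cutmono0 j x : 3 * r <= `|x| -> cutmono j x = 0.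
Proof.
have r0 := r_gt0; rewrite /cutmono ler_normr => /orP[x1|x1].
  by rewrite (@step0 (- x)) ?mulr0//; lra.
by rewrite (@step0 x) ?mul0r ?mulr0//; lra.
Qed.

Lemma C11_cutmono T j : 0 <= T -> C11 T (cutmono j).
Proof.
move=> T0; have r0 := r_gt0; have rs : C11 T step.
  apply: C11_mul; first exact: C11_cst.
  apply: C11_add; first by apply: C11_sqpos => //; lra.
  apply: C11_add; last by apply: C11_sqpos => //; lra.
  apply: C11_mul; first exact: C11_cst.
  by apply: C11_sqpos => //; lra.
apply: C11_mul; first exact: C11_exp.
by apply: C11_mul => //; exact: C11_opp.
Qed.

(** The torus has period 12 r, so that the support of the cut-off monomials
    is half as long as the period. *)
Definition freq : R := pi / (6 * r).

Lemma freq_gt0 : 0 < freq. Proof. by rewrite divr_gt0 ?pi_gt0// mulr_gt0. Qed.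

Lemma mesh_freq p : mesh freq p = 12 * r / (2 * p%:R + 1).
Proof.
have m0 : 2 * p%:R + 1 != 0 :> R by rewrite -ME M_neq0.
have pi0 : pi != 0 :> R by rewrite gt_eqF ?pi_gt0.
have r0 : r != 0 by rewrite gt_eqF.
rewrite /mesh /angle /freq ME; move: (@pi R) pi0 => P P0.
by field; rewrite m0 P0 r0.
Qed.

(** On the grid the successor acts as a translation by the mesh size: at
    the seam, where it does not, both values vanish. *)
Lemma cutmono_shift p j (i : 'I_(2 * p).+1) : (3 <= p)%N ->
  cutmono j (mesh freq p * centred (ordS i)) = cutmono j (mesh freq p * centred i + mesh freq p) /\
  cutmono j (mesh freq p * centred (ordS (ordS i))) =
    cutmono j (mesh freq p * centred i + 2 * mesh freq p).
Proof.
move=> p3; have r0 := r_gt0; have h0 : 0 < mesh freq p by exact: mesh_gt0 freq_gt0 _.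
have P3 : 3 <= p%:R :> R by rewrite (ler_nat _ 3).
have hp : mesh freq p * (p%:R - 1) >= 3 * r.
  rewrite mesh_freq mulrAC ler_pdivlMr; last lra.
  by nra.
set h := mesh freq p in h0 hp *.
(* The jump of the centred coordinate only occurs at the last point, where
   the arguments are at least 3 r in absolute value on both sides of the
   jump. *)
have seam (k : 'I_(2 * p).+1) : centred (ordS k) = centred k + 1 - (2 * p).+1%:R :> R ->
    centred k = p%:R :> R.
  move=> E; apply/eqP; rewrite eq_le; apply/andP; split.
    by have := @centred_norm R p k; rewrite ler_norml => /andP[].
  have := @centred_norm R p (ordS k); rewrite ler_norml E ME => /andP[? ?]; lra.
have [E|E] := @centred_ordS R p i; have [E'|E'] := @centred_ordS R p (ordS i).
- by rewrite E' E; split; congr cutmono; ring.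
- rewrite E' E; split; first by congr cutmono; ring.
  have kp := seam _ E'; rewrite E in kp.
  have -> : centred i = p%:R - 1 :> R by rewrite -kp; ring.
  rewrite !cutmono0 //; last by rewrite ler_normr ME; apply/orP; right; nra.
  by rewrite ler_normr; apply/orP; left; nra.
- have kp := seam _ E; rewrite E' E kp ME; split.
    rewrite !cutmono0 //; last by rewrite ler_normr; apply/orP; right; nra.
    by rewrite ler_normr; apply/orP; left; nra.
  rewrite !cutmono0 //; last by rewrite ler_normr; apply/orP; right; nra.
  by rewrite ler_normr; apply/orP; left; nra.
- exfalso; have kp := seam _ E; have kp' := seam _ E'.
  by move: E; rewrite kp kp' ME; lra.
Qed.

End Cutoff.

(** * The inverse of the iterated Laplacian and its corrector *)

Section PolylaplaceInverse.
Context {R : realType}.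
Variables (r : R) (m : nat).
Hypothesis r_gt0 : 0 < r.
Hypothesis m_gt0 : (0 < m)%N.
Local Notation w := (freq r).

Let w0 : 0 < w. Proof. exact: freq_gt0. Qed.

(** The spectral gap: nonzero frequencies are bounded away from 0, hence
    Delta^m is invertible on functions of mean zero. *)
Lemma centred_eq0_or_ge1 p (k : 'I_(2 * p).+1) : centred k = 0 :> R \/ 1 <= centred k ^+ 2 :> R.
Proof.
rewrite /centred; case: (ltngtP k p) => [kp|kp|->]; last by left; rewrite subrr.
  right; have : k%:R + 1 <= p%:R :> R by rewrite natr1 ler_nat.
  by move=> H; nra.
right; have : p%:R + 1 <= k%:R :> R by rewrite natr1 ler_nat.
by move=> H; nra.
Qed.

Definition mono p (a b : nat) (k : grid p) : R := (w * centred k.1) ^+ a * (w * centred k.2) ^+ b.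

Definition phase p (k : grid p) (X Y : R) : R := w * (centred k.1 * X + centred k.2 * Y).

(** The (a, b)-th partial derivative of the trigonometric polynomial with
    coefficients [c]. Each derivative multiplies by a frequency and shifts
    the phase by pi / 2. *)
Definition Trig p (c : grid p -> R * R) (a b : nat) (X Y : R) : R :=
  \sum_k mono a b k * ((c k).1 * cos (phase k X Y + (a + b)%:R * (pi / 2))
                     + (c k).2 * sin (phase k X Y + (a + b)%:R * (pi / 2))).

(** The inverse of the symbol of Delta^m. At the zero frequency it is 0,
    the value of the inverse of 0: the mean value is dropped and has to be
    restored by [coef]. *)
Definition inv_symb p (k : grid p) : R := ((- (w ^+ 2 * (centred k.1 ^+ 2 + centred k.2 ^+ 2))) ^+ m)^-1.

Definition inv_lap p (c : grid p -> R * R) (k : grid p) : R * R := (inv_symb k * (c k).1, inv_symb k * (c k).2).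

(** The phase shift by s rotates each pair of coefficients; on the grid,
    the derivatives of a trigonometric polynomial are thus obtained by
    [synth]. *)
Definition diff_coef p (a b : nat) (c : grid p -> R * R) (k : grid p) : R * R :=
  let s := (a + b)%:R * (pi / 2) in
  (mono a b k * ((c k).1 * cos s + (c k).2 * sin s),
   mono a b k * ((c k).2 * cos s - (c k).1 * sin s)).

Local Notation gx p i := (mesh w p * centred i).

Lemma Trig_grid p c a b (x : grid p) :
  Trig c a b (gx p x.1) (gx p x.2) = synth (diff_coef a b c) x.
Proof.
apply: eq_bigr => k _; rewrite /diff_coef /=.
have -> : phase k (gx p x.1) (gx p x.2) = Phi k x.
  by rewrite /phase /Phi -(w_mesh w0 p); ring.
by rewrite cosD sinD; ring.
Qed.

Lemma nrm2_diff_coef p a b (c : grid p -> R * R) k :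
  nrm2 (diff_coef a b c k) = mono a b k ^+ 2 * nrm2 (c k).
Proof.
rewrite /nrm2 /diff_coef /=; set s := _ * (pi / 2).
have := cos2Dsin2 s; move: (cos s) (sin s) => C S CS.
transitivity (mono a b k ^+ 2 * ((c k).1 ^+ 2 + (c k).2 ^+ 2) * (C ^+ 2 + S ^+ 2)); first by ring.
by rewrite CS mulr1.
Qed.

Definition mult_cst : R := (1 + w^-1) ^+ (2 * m).

Lemma mult_cst_ge1 : 1 <= mult_cst.
Proof. by rewrite exprn_ege1// lerDl invr_ge0 ltW. Qed.

Lemma mult_cst_ge0 : 0 <= mult_cst. Proof. exact: le_trans mult_cst_ge1. Qed.

(** The multiplier of D^(a,b) Delta^(-m) is of size |k|^(a+b-2m), with t
    standing for 1 / (w |k|). *)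
Lemma multiplier_decay p a b (k : grid p) : (a + b <= 2 * m)%N ->
  exists t : R, [/\ 0 <= t, t <= w^-1, t ^+ 2 * weight k <= 2 * (w^-1) ^+ 2 &
    `|mono a b k * inv_symb k| <= t ^+ (2 * m - (a + b))].
Proof.
move=> ab; set S := centred k.1 ^+ 2 + centred k.2 ^+ 2 : R.
have wi0 : 0 < w^-1 by rewrite invr_gt0.
have [S0|S1] : S = 0 \/ 1 <= S.
  rewrite /S; have := sqr_ge0 (@centred R p k.1); have := sqr_ge0 (@centred R p k.2).
  have [->|] := centred_eq0_or_ge1 k.1; have [->|] := centred_eq0_or_ge1 k.2; rewrite ?expr0n /=; move=> *;
    by [left; lra | right; lra].
  exists 0; rewrite expr0n mul0r; split; rewrite ?(ltW wi0)//.
    by rewrite mulr_ge0 ?sqr_ge0.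
  rewrite /inv_symb -/S S0 mulr0 oppr0 expr0n gtn_eqF//= invr0 mulr0 normr0.
  by rewrite exprn_ge0.
pose s := Num.sqrt S.
have s2 : s ^+ 2 = S by rewrite sqr_sqrtr//; lra.
have s1 : 1 <= s by rewrite -sqrtr1 ler_wsqrtr.
have ws0 : 0 < w * s by rewrite mulr_gt0//; lra.
exists (w * s)^-1; split.
- by rewrite invr_ge0 ltW.
- by rewrite invfM ler_piMr ?(ltW wi0)// invf_le1//; lra.
- have -> : ((w * s)^-1) ^+ 2 = w^-1 ^+ 2 * S^-1.
    by rewrite invfM exprMn -s2 [s^-1 ^+ 2]exprVn.
  rewrite mulrAC [leRHS]mulrC -mulrA ler_wpM2l ?sqr_ge0//.
  by rewrite ler_pdivrMr; [rewrite /weight -addrA -/S; lra | lra].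
have le1 i : (i = k.1 \/ i = k.2) -> `|w * centred i| <= w * s.
  move=> ik; rewrite normrM (gtr0_norm w0) ler_wpM2l ?(ltW w0)//.
  rewrite -sqrtr_sqr ler_wsqrtr// /S.
  by case: ik => ->; rewrite ?lerDl ?lerDr sqr_ge0.
have E : `|inv_symb k| = ((w * s) ^+ (2 * m))^-1.
  rewrite /inv_symb -/S -s2 -exprMn normfV normrX normrN normrX (gtr0_norm ws0).
  by rewrite exprM.
rewrite normrM E /mono normrM !normrX.
apply: (@le_trans _ _ ((w * s) ^+ (a + b) / (w * s) ^+ (2 * m))).
  rewrite ler_wpM2r ?invr_ge0 ?exprn_ge0 ?(ltW ws0)// exprD.
  by apply: ler_pM; rewrite ?exprn_ge0//; apply: lerXn2r; rewrite ?nnegrE ?(ltW ws0)//;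
    apply: le1; [left|right].
have wn0 : (w * s) ^+ (a + b) != 0 by rewrite expf_neq0// gt_eqF.
rewrite -{1}(subnK ab) [(w * s) ^+ (_ + (a + b))]exprD invfM mulrCA divff//.
by rewrite mulr1 exprVn.
Qed.

Lemma multiplier_bound p a b (k : grid p) : (a + b <= 2 * m)%N ->
  `|mono a b k * inv_symb k| <= mult_cst.
Proof.
move=> ab; have [t [t0 tw _ H]] := multiplier_decay k ab; apply: (le_trans H).
apply: (@le_trans _ _ ((1 + w^-1) ^+ (2 * m - (a + b)))).
  by apply: lerXn2r; rewrite ?nnegrE ?ler_wpDl ?addr_ge0 ?invr_ge0 ?(ltW w0).
by apply: ler_weXn2l; [rewrite lerDl invr_ge0 ltW | exact: leq_subr].
Qed.

Lemma multiplier_bound1 p a b (k : grid p) : (a + b < 2 * m)%N ->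
  (mono a b k * inv_symb k) ^+ 2 <= 2 * mult_cst ^+ 2 / weight k.
Proof.
move=> ab; have [t [t0 tw tQ H]] := multiplier_decay k (ltnW ab).
rewrite ler_pdivlMr ?weight_gt0//.
have B1 : 1 <= 1 + w^-1 by rewrite lerDl invr_ge0 ltW.
have wi0 : 0 <= w^-1 by rewrite invr_ge0 ltW.
have tB : t <= 1 + w^-1 by lra.
have {}H := sqr_le_abs H.
set j := (2 * m - (a + b)).-1.
have Ej : (2 * m - (a + b) = j.+1)%N by rewrite prednK// subn_gt0.
rewrite Ej [t ^+ j.+1]exprSr [X in _ <= X]exprMn in H.
apply: (@le_trans _ _ ((t ^+ j) ^+ 2 * (t ^+ 2 * weight k))).
  by rewrite [leRHS]mulrA; apply: ler_wpM2r => //; rewrite ltW ?weight_gt0.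
have H1 : (t ^+ j) ^+ 2 <= ((1 + w^-1) ^+ j) ^+ 2.
  by apply: sqr_le_abs; rewrite ger0_norm ?exprn_ge0//; apply: lerXn2r; rewrite ?nnegrE//; lra.
have H2 : t ^+ 2 * weight k <= 2 * (1 + w^-1) ^+ 2.
  by apply: (le_trans tQ); rewrite ler_pM2l//; apply: sqr_le_abs; rewrite ger0_norm//; lra.
apply: (le_trans (ler_pM _ _ H1 H2)); rewrite ?sqr_ge0 ?mulr_ge0 ?sqr_ge0 ?(ltW (weight_gt0 _))//.
rewrite mulrCA ler_pM2l// -exprMn -exprSr.
apply: sqr_le_abs; rewrite ger0_norm ?exprn_ge0//; last lra.
by apply: ler_weXn2l => //; rewrite -Ej leq_subr.
Qed.

(** Taking up to 2m derivatives after inverting Delta^m loses nothing in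
    any energy. This is where Sobolev spaces replace the Schauder
    estimates. *)
Lemma energy_diff_coef p s a b (c : grid p -> R * R) : (a + b <= 2 * m)%N ->
  energy s (diff_coef a b (inv_lap c)) <= mult_cst ^+ 2 * energy s c.
Proof.
move=> ab; rewrite mulr_sumr; apply: ler_sum => k _.
rewrite nrm2_diff_coef [leRHS]mulrCA; apply: ler_wpM2l; first by rewrite exprn_ge0// ltW ?weight_gt0.
have -> : mono a b k ^+ 2 * nrm2 (inv_lap c k) = (mono a b k * inv_symb k) ^+ 2 * nrm2 (c k).
  by rewrite /nrm2 /inv_lap /=; ring.
apply: ler_wpM2r; first exact: nrm2_ge0.
by apply: sqr_le_abs; exact: multiplier_bound.
Qed.

Lemma trig_amp (z : R * R) t : `|z.1 * cos t + z.2 * sin t| <= amp z.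
Proof.
apply: (le_trans (ler_normD _ _)); rewrite !normrM.
by apply: lerD; apply: ler_piMr => //; rewrite ?cos_max ?sin_max.
Qed.

Lemma Trig_le p (c : grid p -> R * R) a b X Y :
  `|Trig c a b X Y| <= \sum_k `|mono a b k| * amp (c k).
Proof.
apply: (le_trans (ler_norm_sum _ _ _)); apply: ler_sum => k _.
by rewrite normrM; apply: ler_wpM2l => //; exact: trig_amp.
Qed.

Lemma amp_inv_lap p (c : grid p -> R * R) a b k :
  `|mono a b k| * amp (inv_lap c k) = `|mono a b k * inv_symb k| * amp (c k).
Proof. by rewrite /amp /inv_lap /= !normrM; ring. Qed.

(** Derivatives of order below 2m gain one power of |k|, and are thus
    bounded at each point by the H^1 energy alone. The contraction takes
    place in H^1, and the corrector depends on the values at 0 of these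
    derivatives. *)
Lemma Trig_inv_lap_low p (c : grid p -> R * R) a b X Y (C : R) : (a + b < 2 * m)%N ->
  \sum_k @weight R p k `^ (2^-1 - 2) <= C ->
  Trig (inv_lap c) a b X Y ^+ 2 <= 4 * mult_cst ^+ 2 * C * energy 1 c.
Proof.
move=> ab CP.
apply: (@le_trans _ _ ((\sum_k `|mono a b k * inv_symb k| * amp (c k)) ^+ 2)).
  apply: sqr_le_abs; apply: (le_trans (Trig_le _ _ _ _ _)).
  by apply: le_of_eq; apply: eq_bigr => k _; exact: amp_inv_lap.
apply: (le_trans (weighted_l1_bound 1 _ _)); apply: ler_wpM2r; first exact: energy_ge0.
have -> : 4 * mult_cst ^+ 2 * C = 2 * (2 * mult_cst ^+ 2 * C) by ring.
rewrite ler_pM2l//.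
apply: (@le_trans _ _ (2 * mult_cst ^+ 2 * \sum_k @weight R p k `^ (2^-1 - 2))); last first.
  by apply: ler_wpM2l => //; rewrite mulr_ge0 ?sqr_ge0.
rewrite mulr_sumr; apply: ler_sum => k _.
rewrite expr1 real_normK ?num_real//.
have Q0 := @weight_gt0 R p k; have Q1 := @weight_ge1 R p k.
rewrite ler_pdivrMr//; apply: (le_trans (multiplier_bound1 _ ab)).
rewrite -[leRHS]mulrA; apply: ler_wpM2l; first by rewrite mulr_ge0 ?sqr_ge0.
have -> : weight k `^ (2^-1 - 2) * weight k = weight k `^ (2^-1 - 2 + 1) :> R.
  have H0 : (2^-1 - 2 + 1 == 0 :> R) ==> (weight k != 0 :> R) by rewrite (gt_eqF Q0) implybT.
  by rewrite (powRD H0) (powRr1 (ltW Q0)).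
rewrite -powR_inv1 ?(ltW Q0)//; apply: ler_powR => //; lra.
Qed.

(** The derivatives of a polynomial with coefficients [q] when [g j] is the
    j-th power. With cut-off powers this is no longer a family of
    derivatives, but agrees with one for |X|, |Y| <= r. *)
Definition Pol (g : nat -> R -> R) (q : nat -> nat -> R) (a b : nat) (X Y : R) : R :=
  \sum_(s < (2 * m).+1) \sum_(t < (2 * m).+1)
    q s t * ((s ^_ a)%:R * (t ^_ b)%:R) * (g (s - a)%N X * g (t - b)%N Y).

Definition zero_mode p : grid p := (inord p, inord p).

(** The coefficients of the polynomial that corrects [Trig (inv_lap c)]:
    they cancel its derivatives of order below 2m at 0, restore the mean
    value lost by [inv_lap], and add the polyharmonic monomial eps X^(2m-1)
    Y / (2m-1)!. No monomial of degree above 2m occurs, so that the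
    derivatives of order 2m of the polynomial are constant. *)
Definition coef p (c : grid p -> R * R) (eps : R) (s t : nat) : R :=
  if (s + t < 2 * m)%N then - Trig (inv_lap c) s t 0 0 / (s`! * t`!)%:R
  else if (s == 2 * m)%N && (t == 0)%N then (c (zero_mode p)).1 / ((2 * m)`!)%:R
  else if (s == (2 * m).-1)%N && (t == 1)%N then eps / ((2 * m).-1`!)%:R
  else 0.

(** The jet of the solution of Delta^m v = f with vanishing lower order
    derivatives at 0, as an operator on the Fourier coefficients of f. *)
Definition Sol (g : nat -> R -> R) p (c : grid p -> R * R) (eps : R) a b X Y : R :=
  Trig (inv_lap c) a b X Y + Pol g (coef c eps) a b X Y.

(** The values of [Sol] at the grid points. The cut-off monomials make them
    periodic, as difference quotients across the seam require. *)
Definition grid_jet p (c : grid p -> R * R) (eps : R) a b (x : grid p) : R :=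
  Sol (cutmono r) c eps a b (gx p x.1) (gx p x.2).

Let sqr_div_nat (x : R) n : (0 < n)%N -> (x / n%:R) ^+ 2 <= x ^+ 2.
Proof.
move=> n0; have f1 : 1 <= n%:R :> R by rewrite ler1n.
rewrite -[leRHS](real_normK (num_real x)); apply: sqr_le_abs.
rewrite normrM normfV (ger0_norm (le_trans ler01 f1)).
by rewrite ler_pdivrMr ?(lt_le_trans ltr01)// ler_peMr.
Qed.

(** The exponent alpha = 1/2 is arbitrary here: any value in (0, 1) would
    do in the sum of weights. *)
Lemma coef_bound p (c : grid p -> R * R) eps s t (C : R) : 0 <= C ->
  \sum_k @weight R p k `^ (2^-1 - 2) <= C ->
  coef c eps s t ^+ 2 <= (4 * mult_cst ^+ 2 * C + 1) * (energy 1 c + eps ^+ 2).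
Proof.
move=> C0 CP; have E0 := energy_ge0 1 c; have e0 := sqr_ge0 eps.
have K0 : 0 <= 4 * mult_cst ^+ 2 * C by apply: mulr_ge0 => //; apply: mulr_ge0 => //; exact: sqr_ge0.
have KE := mulr_ge0 K0 E0; have Ke := mulr_ge0 K0 e0.
rewrite /coef; case: ifP => st.
  apply: (le_trans (sqr_div_nat _ _)); first by rewrite muln_gt0 !fact_gt0.
  by rewrite sqrrN; apply: (le_trans (Trig_inv_lap_low c 0 0 st CP)); lra.
case: ifP => _.
  apply: (le_trans (sqr_div_nat _ _)); first exact: fact_gt0.
  suff : (c (zero_mode p)).1 ^+ 2 <= energy 1 c by move=> ?; lra.
  apply: (@le_trans _ _ (weight (zero_mode p) ^+ 1 * nrm2 (c (zero_mode p)))).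
    have := @weight_ge1 R p (zero_mode p); rewrite expr1 /nrm2.
    have := sqr_ge0 (c (zero_mode p)).1; have := sqr_ge0 (c (zero_mode p)).2.
    by move: (_ ^+ 2) (_ ^+ 2) (weight _) => x y z; nra.
  apply: (@ler_term _ _ (fun k => weight k ^+ 1 * nrm2 (c k))) => k.
  by rewrite mulr_ge0 ?nrm2_ge0// expr1 ltW ?weight_gt0.
case: ifP => _; last by rewrite expr0n /=; lra.
by apply: (le_trans (sqr_div_nat _ _)); [exact: fact_gt0 | lra].
Qed.

Section Tensor.
Variable p : nat.
Hypothesis p_ge3 : (3 <= p)%N.
Local Notation I := ('I_(2 * p).+1).
Local Notation dif := (@dif R w p).
Local Notation dif1 := (@dif1 R w p).

Definition tensor (A B : I -> R) (x : grid p) : R := A x.1 * B x.2.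

Let difF A B : dif false (tensor A B) = tensor (dif1 A) B.
Proof. by apply/funext => x; rewrite /dif /tensor /dif1 /=; ring. Qed.

Let difT A B : dif true (tensor A B) = tensor A (dif1 B).
Proof. by apply/funext => x; rewrite /dif /tensor /dif1 /=; ring. Qed.

Let avg_tensor A B (C : R) : (forall i, `|A i| <= C) -> (forall i, `|B i| <= C) ->
  avg (fun x => tensor A B x ^+ 2) <= C ^+ 4.
Proof.
move=> AC BC; rewrite -[leRHS](@avg_cst _ p); apply: avg_le => x.
have -> : C ^+ 4 = (C * C) ^+ 2 by ring.
by apply: sqr_le_abs; rewrite /tensor normrM; apply: ler_pM.
Qed.

(** The factor 7 counts the terms of the norm: the function, two first and
    four second differences. *)
Lemma sob2_tensor (A B : I -> R) (C : R) :
  (forall i, `|A i| <= C) -> (forall i, `|dif1 A i| <= C) ->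
  (forall i, `|dif1 (dif1 A) i| <= C) ->
  (forall i, `|B i| <= C) -> (forall i, `|dif1 B i| <= C) ->
  (forall i, `|dif1 (dif1 B) i| <= C) -> sob2 w (tensor A B) <= 7 * C ^+ 4.
Proof.
move=> A0 A1 A2 B0 B1 B2; rewrite /sob2 /sob1 !big_bool /= !(difT, difF).
have := avg_tensor A0 B0; have := avg_tensor A1 B0; have := avg_tensor A0 B1.
have := avg_tensor A2 B0; have := avg_tensor A1 B1; have := avg_tensor A0 B2.
lra.
Qed.

Lemma grid_range (i : I) : `|gx p i| <= 6 * r.
Proof.
have h0 := mesh_gt0 w0 p; have r0 := r_gt0.
rewrite normrM (gtr0_norm h0).
apply: (le_trans (ler_wpM2l (ltW h0) (@centred_norm R p i))).
rewrite mesh_freq// mulrAC ler_pdivrMr; last by rewrite ltr_wpDl ?mulr_ge0.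
by have := ler0n R p; nra.
Qed.

Lemma mesh_small : mesh w p <= 2 * r.
Proof.
have P3 : 3 <= p%:R :> R by rewrite (ler_nat _ 3).
have r0 := r_gt0.
rewrite mesh_freq// ler_pdivrMr; last lra.
by nra.
Qed.

(** The bound 30 r leaves room for the points of the grid, which lie within
    6 r, and for two translations by a mesh of at most 2 r. *)
Lemma cutmono_grid j (C : R) : 0 <= C ->
  (forall x, `|x| <= 30 * r -> `|cutmono r j x| <= C) ->
  (forall x y, `|x| <= 30 * r -> `|y| <= 30 * r ->
      `|cutmono r j x - cutmono r j y| <= C * `|x - y|) ->
  (forall x h, 0 <= h -> `|x| <= 30 * r -> `|x + 2 * h| <= 30 * r ->
    `|cutmono r j (x + 2 * h) - 2 * cutmono r j (x + h) + cutmono r j x| <= C * h ^+ 2) ->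
  let A := fun i : I => cutmono r j (gx p i) in
  [/\ forall i, `|A i| <= C, forall i, `|dif1 A i| <= C &
      forall i, `|dif1 (dif1 A) i| <= C].
Proof.
move=> C0 gB gL gD A; have h0 := mesh_gt0 w0 p; have r0 := r_gt0; have h2 := mesh_small.
have hn0 : mesh w p != 0 by rewrite gt_eqF.
have rg (i : I) : `|gx p i| <= 30 * r by apply: (le_trans (grid_range i)); lra.
have rg' (i : I) s : 0 <= s -> s <= 2 * mesh w p -> `|gx p i + s| <= 30 * r.
  move=> s0 s1; apply: (le_trans (ler_normD _ _)).
  by rewrite (ger0_norm s0); have := grid_range i; lra.
split => i; first exact: gB.
  rewrite /dif1 normrM normfV (gtr0_norm h0) ler_pdivrMr// /A.
  rewrite (proj1 (cutmono_shift r_gt0 j i p_ge3)).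
  apply: (le_trans (gL _ _ (rg' i _ (ltW h0) _) (rg i))); first lra.
  by rewrite addrAC subrr add0r gtr0_norm.
have -> : dif1 (dif1 A) i = (A (ordS (ordS i)) - 2 * A (ordS i) + A i) / mesh w p ^+ 2.
  by rewrite /dif1; field.
rewrite normrM normfV normrX (gtr0_norm h0) ler_pdivrMr ?exprn_gt0// /A.
have [-> ->] := cutmono_shift r_gt0 j i p_ge3.
by apply: gD; rewrite ?rg ?rg'//; lra.
Qed.

End Tensor.

Let base p (s t : nat) : grid p -> R :=
  tensor (fun i => cutmono r s (gx p i)) (fun i => cutmono r t (gx p i)).

(** The uniformity in p comes from [C11], which does not refer to a grid. *)
Lemma base_bound : exists2 C : R, 0 <= C & forall p s t, (3 <= p)%N ->
  (s <= 2 * m)%N -> (t <= 2 * m)%N ->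
  sob2 w (@base p s t) <= C /\ forall x, @base p s t x ^+ 2 <= C.
Proof.
have T0 : 0 <= 30 * r by rewrite mulr_ge0 ?ltW.
have [c cP] := choice (fun j => C11_cutmono r_gt0 j T0).
pose C := \sum_(j < (2 * m).+1) c j.
have c0 j : 0 <= c j by have [] := cP j.
have cC j : (j <= 2 * m)%N -> c j <= C.
  by move=> jm; apply: (@ler_term _ _ (fun j : 'I_(2 * m).+1 => c j) (Ordinal (jm : (j < (2 * m).+1)%N))).
have C0 : 0 <= C by apply: sumr_ge0.
exists (7 * C ^+ 4); first by rewrite mulr_ge0 ?exprn_ge0.
move=> p s t p3 sm tm.
have bd j : (j <= 2 * m)%N -> let A := fun i : 'I_(2 * p).+1 => cutmono r j (gx p i) in
  [/\ forall i, `|A i| <= C, forall i, `|dif1 w A i| <= C &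
      forall i, `|dif1 w (dif1 w A) i| <= C].
  move=> /cC jC; have [_ H1 H2 H3] := cP j.
  have [|||K1 K2 K3] := @cutmono_grid p p3 j (c j) (c0 j) => //.
  by split => i; apply: le_trans jC.
have [A0 A1 A2] := bd s sm; have [B0 B1 B2] := bd t tm.
split; first exact: sob2_tensor.
move=> x; apply: (@le_trans _ _ ((C * C) ^+ 2)).
  by apply: sqr_le_abs; rewrite /base /tensor normrM; apply: ler_pM.
have -> : (C * C) ^+ 2 = C ^+ 4 by ring.
by rewrite ler_peMl ?exprn_ge0// ler1n.
Qed.

End PolylaplaceInverse.

(** * Bounds on the jet of the discrete solution operator *)

Section OperatorBounds.
Context {R : realType}.
Variables (r : R) (m : nat).
Hypothesis r_gt0 : 0 < r.
Hypothesis m_gt0 : (0 < m)%N.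
Local Notation w := (freq r).
Local Notation gx p i := (mesh w p * centred i).
Local Notation I := ('I_(2 * m).+1).
Local Notation grid_jet := (grid_jet r m).

Let w0 : 0 < w. Proof. exact: freq_gt0. Qed.

Lemma energy_mono p (c : grid p -> R * R) : energy 1 c <= energy 2 c.
Proof.
apply: ler_sum => k _; apply: ler_wpM2r; first exact: nrm2_ge0.
by rewrite expr1 expr2 ler_peMl ?weight_ge1// ltW ?weight_gt0.
Qed.

Let grid_pol p (q : nat -> nat -> R) a b (x : grid p) : R :=
  Pol m (cutmono r) q a b (gx p x.1) (gx p x.2).

Lemma Pol_bounds (a b : nat) : exists2 K : R, 0 <= K & forall p q (B : R),
  (3 <= p)%N -> (forall s t, q s t ^+ 2 <= B) ->
  sob2 w (@grid_pol p q a b) <= K * B /\ forall x, @grid_pol p q a b x ^+ 2 <= K * B.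
Proof.
have [C C0 CP] := base_bound m r_gt0.
pose kf (j : I * I) : R := (j.1 ^_ a)%:R * (j.2 ^_ b)%:R.
exists (#|{: I * I}|%:R * \sum_j (kf j ^+ 2 * C)).
  by apply: mulr_ge0 => //; apply: sumr_ge0 => j _; rewrite mulr_ge0 ?sqr_ge0.
move=> p q B p3 qB.
pose base s t : grid p -> R :=
  tensor (fun i => cutmono r s (gx p i)) (fun i => cutmono r t (gx p i)).
have E : @grid_pol p q a b = fun x => \sum_(j : I * I) (q j.1 j.2 * kf j) * base (j.1 - a)%N (j.2 - b)%N x.
  by apply/funext => x; rewrite /grid_pol /Pol pair_bigA.
have jm (i : I) u : (i - u <= 2 * m)%N by apply: leq_trans (leq_subr _ _) _; rewrite -ltnS.
have bb (j : I * I) := CP p _ _ p3 (jm j.1 a) (jm j.2 b).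
have cf (j : I * I) : (q j.1 j.2 * kf j) ^+ 2 * C <= kf j ^+ 2 * C * B.
  have -> : (q j.1 j.2 * kf j) ^+ 2 * C = q j.1 j.2 ^+ 2 * (kf j ^+ 2 * C) by ring.
  rewrite [leRHS]mulrC; apply: ler_wpM2r; last exact: qB.
  by rewrite mulr_ge0 ?sqr_ge0.
rewrite E; split.
  apply: (le_trans (sob2_sum w _)); rewrite -mulrA; apply: ler_wpM2l => //.
  rewrite mulr_suml; apply: ler_sum => j _; rewrite sob2_scale.
  by apply: le_trans (cf j); apply: ler_wpM2l; [exact: sqr_ge0 | exact: (bb j).1].
move=> x; apply: (le_trans (sqr_sum_le _)); rewrite -mulrA; apply: ler_wpM2l => //.
rewrite mulr_suml; apply: ler_sum => j _; rewrite exprMn.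
by apply: le_trans (cf j); apply: ler_wpM2l; [exact: sqr_ge0 | exact: (bb j).2].
Qed.

(** With one more power of the weight, H^2 energies bound all derivatives
    up to order 2m pointwise; [al] is a free parameter. *)
Lemma Trig_inv_lap_sup (al : R) : 0 <= al -> al < 1 -> exists2 C : R, 0 <= C &
  forall p (c : grid p -> R * R) a b X Y, (a + b <= 2 * m)%N ->
  Trig r (inv_lap r m c) a b X Y ^+ 2 <= C * energy 2 c.
Proof.
move=> al0 al1; have [C C0 CP] := holder_weight_bound al1.
exists (mult_cst r m ^+ 2 * C); first by rewrite mulr_ge0 ?sqr_ge0.
move=> p c a b X Y ab; rewrite -mulrA.
apply: (@le_trans _ _ (mult_cst r m ^+ 2 * (\sum_k weight k `^ (al / 2) * amp (c k)) ^+ 2)); last first.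
  by apply: ler_wpM2l; [exact: sqr_ge0 | exact: CP].
rewrite -exprMn; apply: sqr_le_abs; apply: (le_trans (Trig_le _ _ _ _ _ _)).
rewrite mulr_sumr; apply: ler_sum => k _; rewrite amp_inv_lap.
apply: ler_pM; rewrite ?amp_ge0 ?multiplier_bound//.
rewrite ler_peMl ?amp_ge0//; apply: (@le_trans _ _ (weight k `^ 0)); first by rewrite powRr0.
by apply: ler_powR; [exact: weight_ge1 | exact: divr_ge0].
Qed.

(** The bounds on the linear operators behind the fixed point problem. The
    H^1 bound serves for differences of solutions, in which the term with
    eps cancels. *)
Lemma grid_jet_bounds (a b : nat) : (a + b <= 2 * m)%N -> exists2 K : R, 0 <= K &
  forall p (c : grid p -> R * R) eps, (3 <= p)%N ->
  [/\ sob1 w (grid_jet c 0 a b) <= K * energy 1 c,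
      sob2 w (grid_jet c eps a b) <= K * (energy 2 c + eps ^+ 2) &
      forall x, grid_jet c eps a b x ^+ 2 <= K * (energy 2 c + eps ^+ 2)].
Proof.
move=> ab; have [K K0 KP] := Pol_bounds a b.
have h1 : 2^-1 < 1 :> R by lra.
have [C C0 CP] := weight_bounded h1.
have [D D0 DP] := @Trig_inv_lap_sup 2^-1 ltac:(lra) h1.
pose K4 : R := 4 * mult_cst r m ^+ 2 * C + 1.
have cm0 := sqr_ge0 (mult_cst r m).
have K40 : 0 <= K4 by rewrite /K4 addr_ge0 // mulr_ge0// mulr_ge0.
have w2 := sqr_ge0 w.
pose A := (1 + w ^+ 2) ^+ 2 * mult_cst r m ^+ 2.
have A0 : 0 <= A by rewrite mulr_ge0 ?sqr_ge0.
exists (2 * (A + D + K * K4)).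
  by rewrite mulr_ge0// !addr_ge0// mulr_ge0.
move=> p c eps p3.
have E1 := energy_ge0 1 c; have E2 := energy_ge0 2 c; have E12 := energy_mono c; have e2 := sqr_ge0 eps.
have cb e s t : coef r m c e s t ^+ 2 <= K4 * (energy 1 c + e ^+ 2) by exact: coef_bound.
have EW e : grid_jet c e a b = fun x => synth (diff_coef r a b (inv_lap r m c)) x + grid_pol (coef r m c e) a b x.
  by apply/funext => x; rewrite /grid_jet /Sol /grid_pol Trig_grid.
have [P1 _] := KP p _ _ p3 (cb 0); have [P2 P3] := KP p _ _ p3 (cb eps).
have KK : 0 <= K * K4 by rewrite mulr_ge0.
split; rewrite EW.
- apply: (le_trans (sob1D w _ _)).
  have H1 := le_trans (sob1_le_sob2 w _) P1; rewrite expr0n addr0 mulrA in H1.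
  have := le_trans (sob1_synth w0 _) (ler_wpM2l (addr_ge0 ler01 w2) (energy_diff_coef r_gt0 m_gt0 1 c ab)).
  have H3 : (1 + w ^+ 2) * (mult_cst r m ^+ 2 * energy 1 c) <= A * energy 1 c.
    rewrite mulrA; apply: ler_wpM2r => //; rewrite /A; apply: ler_wpM2r => //.
    by rewrite expr2 ler_peMl ?addr_ge0// lerDl.
  move=> /le_trans /(_ H3); have := mulr_ge0 D0 E1; move: H1.
  by clear; clearbody A; move: (sob1 _ _) (sob1 _ _) (energy 1 c) (K * K4) => *; lra.
- apply: (le_trans (sob2D w _ _)).
  have := le_trans (sob2_synth w0 _) (ler_wpM2l (sqr_ge0 (1 + w ^+ 2)) (energy_diff_coef r_gt0 m_gt0 2 c ab)).
  rewrite [_ * (_ * energy 2 c)]mulrA -/A.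
  move: P2; rewrite [_ * (_ * (_ + _))]mulrA.
  have := mulr_ge0 D0 E2; have := mulr_ge0 D0 e2; have := mulr_ge0 A0 e2.
  have := ler_wpM2l KK E12.
  by clear; clearbody A; move: (sob2 _ _) (sob2 _ _) (energy 1 c) (energy 2 c) (K * K4) (eps ^+ 2) => *; lra.
- move=> x; rewrite -(Trig_grid r_gt0).
  have := DP p c a b (gx p x.1) (gx p x.2) ab; have := P3 x.
  rewrite [_ * (_ * (_ + _))]mulrA.
  have := mulr_ge0 A0 E2; have := mulr_ge0 D0 e2; have := mulr_ge0 A0 e2.
  have := ler_wpM2l KK E12.
  move: (Trig _ _ _ _ _ _) (grid_pol _ _ _ _) => u v; have := sqr_ge0 (u - v).
  rewrite sqrrB sqrrD; clear; clearbody A.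
  by move: (u ^+ 2) (v ^+ 2) (u * v) (energy 1 c) (energy 2 c) (K * K4) (eps ^+ 2) => *; lra.
Qed.

Let sub_coeffs p (c c' c'' : grid p -> R * R) := forall k,
  (c'' k).1 = (c k).1 - (c' k).1 /\ (c'' k).2 = (c k).2 - (c' k).2.

Let TrigB p (c c' c'' : grid p -> R * R) a b X Y : sub_coeffs c c' c'' ->
  Trig r (inv_lap r m c'') a b X Y = Trig r (inv_lap r m c) a b X Y - Trig r (inv_lap r m c') a b X Y.
Proof.
move=> H; rewrite /Trig -sumrB; apply: eq_bigr => k _.
by rewrite /inv_lap /= (H k).1 (H k).2; ring.
Qed.

Let coefB p (c c' c'' : grid p -> R * R) eps s t : sub_coeffs c c' c'' ->
  coef r m c'' 0 s t = coef r m c eps s t - coef r m c' eps s t.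
Proof.
move=> H; rewrite /coef (TrigB _ _ _ _ H) (H _).1.
by do 3!(case: ifP => _; first by ring); ring.
Qed.

Lemma grid_jet_sub p (f g : grid p -> R) eps a b x :
  grid_jet (dft f) eps a b x - grid_jet (dft g) eps a b x = grid_jet (dft (fun y => f y - g y)) 0 a b x.
Proof.
have H : sub_coeffs (dft f) (dft g) (dft (fun y => f y - g y)).
  move=> k; rewrite /dft /=; split.
    by rewrite -[X in _ - X]mul1r -mulNr -avgZ -avgD; apply: avg_ext => y; ring.
  by rewrite -[X in _ - X]mul1r -mulNr -avgZ -avgD; apply: avg_ext => y; ring.
rewrite /grid_jet /Sol (TrigB _ _ _ _ H) /Pol.
rewrite opprD addrACA; congr (_ + _); rewrite -sumrB; apply: eq_bigr => s _.
rewrite -sumrB; apply: eq_bigr => t _.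
by rewrite (coefB eps _ _ H); ring.
Qed.

End OperatorBounds.

(** * Approximate fixed points on the grid *)

Section ApproximateSolutions.
Context {R : realType}.
Variables (r : R) (m : nat).
Hypothesis r_gt0 : 0 < r.
Hypothesis m_gt0 : (0 < m)%N.
Local Notation w := (freq r).
Let w0 : 0 < w. Proof. exact: freq_gt0. Qed.

Variables (N d : nat) (F : 'I_N -> 'rV[R]_d -> R).
Hypothesis F_C2 : forall l, class_C setT 2 (F l).
Hypothesis F0 : forall l, F l 0 = 0.
Hypothesis gradF0 : forall l q, partial q (F l) 0 = 0.

Variables (mask : 'I_d -> bool) (ia ib : 'I_d -> nat) (il : 'I_d -> 'I_N).
Hypothesis iab : forall q, mask q -> (ia q + ib q <= 2 * m)%N.

(** The jet of the candidate solution on the grid, slot by slot. Slot [q]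
    holds the (ia q, ib q)-th derivative of component [il q], or vanishes
    when it involves a variable that the solution does not depend on. *)
Definition jet_slots p (f : 'I_N -> grid p -> R) (eps : R) (q : 'I_d) (x : grid p) : R :=
  if mask q then grid_jet r m (dft (f (il q))) eps (ia q) (ib q) x else 0.

Lemma common_bounds : exists rho C : R, [/\ 0 < rho, 0 <= C &
  forall l q k x, l1 x <= rho -> `|partial k (partial q (F l)) x| <= C].
Proof.
have [rho rhoP] := choice (fun l => class_C2_local_bounds (F_C2 l)).
have [C CP] := choice rhoP.
have r0 l : 0 < rho l by have [] := CP l.
have C0 l : 0 <= C l by have [] := CP l.
have ri l : 0 <= (rho l)^-1 by rewrite invr_ge0 ltW.
have s0 : 0 < 1 + \sum_l (rho l)^-1 by rewrite ltr_pwDl// sumr_ge0.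
exists (1 + \sum_l (rho l)^-1)^-1, (\sum_l C l); split.
- by rewrite invr_gt0.
- exact: sumr_ge0.
move=> l q k x xr; have [_ _ H] := CP l.
apply: (@le_trans _ _ (C l)); last exact: ler_term.
apply: H; apply: (le_trans xr); rewrite -[leRHS]invrK lef_pV2 ?posrE ?invr_gt0//.
by apply: (le_trans (@ler_term _ _ (fun l => (rho l)^-1) l ri)); rewrite lerDr.
Qed.

Lemma jet_slots_bounds : exists2 K : R, 0 <= K & forall p (f g : 'I_N -> grid p -> R) eps q,
  (3 <= p)%N ->
  [/\ sob1 w (fun x => jet_slots f eps q x - jet_slots g eps q x)
        <= K * energy 1 (dft (fun x => f (il q) x - g (il q) x)),
      sob2 w (jet_slots f eps q) <= K * (energy 2 (dft (f (il q))) + eps ^+ 2) &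
      forall x, jet_slots f eps q x ^+ 2 <= K * (energy 2 (dft (f (il q))) + eps ^+ 2)].
Proof.
have H q : exists K : R, 0 <= K /\ forall p (f g : 'I_N -> grid p -> R) eps,
  (3 <= p)%N ->
  [/\ sob1 w (fun x => jet_slots f eps q x - jet_slots g eps q x)
        <= K * energy 1 (dft (fun x => f (il q) x - g (il q) x)),
      sob2 w (jet_slots f eps q) <= K * (energy 2 (dft (f (il q))) + eps ^+ 2) &
      forall x, jet_slots f eps q x ^+ 2 <= K * (energy 2 (dft (f (il q))) + eps ^+ 2)].
  rewrite /jet_slots; case E : (mask q).
    have [K K0 KP] := grid_jet_bounds r_gt0 m_gt0 (iab E).
    exists K; split => // p f g eps p3.
    have [H1 _ _] := KP p (dft (fun x => f (il q) x - g (il q) x)) 0 p3.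
    have [_ H2 H3] := KP p (dft (f (il q))) eps p3.
    split => //; apply: le_trans H1; apply: le_of_eq.
    by congr sob1; apply/funext => x; exact: grid_jet_sub.
  exists 0; split => // p f g eps p3.
  have z0 : (fun _ : grid p => 0 : R) = (fun x : grid p => 0 * (fun=> 0) x).
    by apply/funext => x; rewrite mul0r.
  rewrite !mul0r; split; last by move=> x; rewrite expr0n.
    by under eq_fun do rewrite subrr; rewrite z0 sob1_scale expr0n mul0r.
  by rewrite z0 sob2_scale expr0n mul0r.
have [K KP] := choice H.
have K0 q : 0 <= K q by have [] := KP q.
exists (\sum_q K q); first exact: sumr_ge0.
move=> p f g eps q p3; have [_ /(_ p f g eps p3)[H1 H2 H3]] := KP q.
have Kq := @ler_term _ _ K q K0.
have e0 : 0 <= energy 2 (dft (f (il q))) + eps ^+ 2 by rewrite addr_ge0 ?energy_ge0 ?sqr_ge0.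
split; first by apply: (le_trans H1); rewrite ler_wpM2r ?energy_ge0.
  by apply: (le_trans H2); rewrite ler_wpM2r.
by move=> x; apply: (le_trans (H3 x)); rewrite ler_wpM2r.
Qed.

(** A crude bound that depends on the grid. It is used once, to turn
    convergence in energy into pointwise smallness on a fixed grid. *)
Lemma point_le_energy p (f : grid p -> R) x : f x ^+ 2 <= (2 * p).+1%:R ^+ 2 * energy 1 (dft f).
Proof.
have M0 : 0 < (2 * p).+1%:R ^+ 2 :> R by rewrite exprn_gt0// M_gt0.
apply: (@le_trans _ _ ((2 * p).+1%:R ^+ 2 * avg (fun x => f x ^+ 2))).
  rewrite /avg mulrA divff ?gt_eqF// mul1r.
  by apply: (@ler_term _ _ (fun x => f x ^+ 2)) => y; exact: sqr_ge0.
apply: ler_wpM2l; first exact: ltW.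
rewrite -parseval; apply: ler_sum => k _.
by rewrite expr1 ler_peMl ?nrm2_ge0 ?weight_ge1.
Qed.

(** Picard iteration from 0. The iterates stay in the ball of radius kappa
    eps of H^2, and their successive distances in H^1 are halved at each
    step; on a fixed grid this makes the residual as small as wished. The
    threshold [eps0] and the radius do not depend on the grid. *)
Theorem approximate_solutions (kappa : R) : 0 < kappa ->
  exists2 eps0 : R, 0 < eps0 & forall eps p (del : R),
  0 < eps <= eps0 -> (3 <= p)%N -> 0 < del ->
  exists f : 'I_N -> grid p -> R,
    (forall l, energy 2 (dft (f l)) <= (kappa * eps) ^+ 2) /\
    forall l x, `|f l x - F l (vec (jet_slots f eps) x)| <= del.
Proof.
move=> kap0.
have [rho [C [rho0 C0 hess]]] := common_bounds.
have [K K0 KP] := jet_slots_bounds.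
have derF l k z : derivable (F l) z (delta_mx 0 k) by have [H _] := F_C2 l [::]; exact: H.
have derdF l q k z : derivable (partial q (F l)) z (delta_mx 0 k).
  by have [H _] := F_C2 l [:: q]; exact: H.
pose D : R := d%:R.
pose KAw := agmon_cst (R := R) w.
(* The jet of an iterate has size S eps; B1 and B2 are the constants of
   the two composition estimates, in terms of energies. *)
pose S : R := 1 + K * (kappa ^+ 2 + 1).
pose B1 : R := 3 * (1 + ((chord_cst ^+ 2 * w ^+ 2)^-1) ^+ 2) * (C ^+ 2 * D ^+ 4 * (7 + 12 * KAw ^+ 2)).
pose B2 : R := N%:R * ((1 + (chord_cst ^+ 2 * w ^+ 2)^-1) * (C ^+ 2 * D ^+ 3 * (16 + 12 * KAw ^+ 2)) * (D * K)).
have D0 : 0 <= D by [].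
have c2 := sqr_ge0 C; have ka2 := sqr_ge0 KAw.
have cw : 0 <= (chord_cst ^+ 2 * w ^+ 2)^-1 by rewrite invr_ge0 mulr_ge0 ?sqr_ge0.
have B10 : 0 <= B1.
  apply: mulr_ge0; first by rewrite mulr_ge0// addr_ge0 ?sqr_ge0.
  by rewrite mulr_ge0 ?mulr_ge0 ?exprn_ge0// addr_ge0// mulr_ge0.
have B20 : 0 <= B2.
  apply: mulr_ge0 => //; apply: mulr_ge0; last exact: mulr_ge0.
  apply: mulr_ge0; first by rewrite addr_ge0.
  by rewrite mulr_ge0 ?mulr_ge0 ?exprn_ge0// addr_ge0// mulr_ge0.
have k20 := sqr_ge0 kappa.
have S1 : 1 <= S by rewrite lerDl mulr_ge0// addr_ge0.
have S0 : 0 <= S by lra.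
have x1 : 0 <= 4 * D * S / rho by rewrite divr_ge0 ?(ltW rho0)// mulr_ge0// mulr_ge0.
have x2 : 0 <= B1 * S ^+ 4 / kappa ^+ 2 by rewrite divr_ge0 ?sqr_ge0// mulr_ge0// exprn_ge0.
have x3 : 0 <= 2 * B2 * S ^+ 2 by rewrite mulr_ge0 ?sqr_ge0// mulr_ge0.
(* The inverse of the threshold: it dominates the constants of all the
   smallness conditions on eps. *)
pose den : R := 1 + 4 * D * S / rho + B1 * S ^+ 4 / kappa ^+ 2 + 2 * B2 * S ^+ 2.
have den0 : 0 < den by rewrite /den; lra.
exists den^-1; first by rewrite invr_gt0.
move=> eps p del /andP[e0 e1] p3 del0.
have ed : eps * den <= 1 by rewrite -ler_pdivlMr// div1r.
have eps1 : eps <= 1.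
  by apply: (le_trans e1); rewrite invf_le1// /den; lra.
have ex1 : eps * (4 * D * S / rho) <= 1.
  by apply: le_trans ed; rewrite ler_pM2l// /den; lra.
have ex2 : eps * (B1 * S ^+ 4 / kappa ^+ 2) <= 1.
  by apply: le_trans ed; rewrite ler_pM2l// /den; lra.
have ex3 : eps * (2 * B2 * S ^+ 2) <= 1.
  by apply: le_trans ed; rewrite ler_pM2l// /den; lra.
pose s := S * eps.
have s0 : 0 <= s by rewrite mulr_ge0// ltW.
have Ds : 4 * (D * s) <= rho.
  have -> : 4 * (D * s) = eps * (4 * D * S / rho) * rho.
    by rewrite /s; field; rewrite gt_eqF.
  by rewrite -[leRHS]mul1r ler_pM2r.
pose good (f : 'I_N -> grid p -> R) := forall l, energy 2 (dft (f l)) <= (kappa * eps) ^+ 2.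
pose Psi (f : 'I_N -> grid p -> R) : 'I_N -> grid p -> R := fun l x => F l (vec (jet_slots f eps) x).
have sm f : good f -> small w s (jet_slots f eps).
  move=> gf.
  have Ks q : K * (energy 2 (dft (f (il q))) + eps ^+ 2) <= s ^+ 2.
    apply: (@le_trans _ _ (K * ((kappa * eps) ^+ 2 + eps ^+ 2))).
      by apply: ler_wpM2l => //; rewrite lerD2r.
    rewrite /s exprMn exprMn -[X in _ + X]mul1r -mulrDl mulrA.
    apply: ler_wpM2r; first exact: sqr_ge0.
    by have := mulr_ge0 K0 (addr_ge0 k20 ler01); rewrite /S; nra.
  split => q; have [_ H2 H3] := KP p f f eps q p3.
    move=> x; rewrite -(ler_pXn2r (n := 2)) ?nnegrE// real_normK ?num_real//.
    exact: le_trans (H3 x) (Ks q).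
  exact: le_trans H2 (Ks q).
have good_Psi f : good f -> good (Psi f).
  move=> gf l; have Ds3 : 3 * (D * s) <= rho by have := mulr_ge0 D0 s0; lra.
  have H := sob2p_comp w0 (derF l) (derdF l) (F0 l) (gradF0 l) C0 (hess l) (sm f gf) s0 Ds3.
  apply: (le_trans (energy2_le_sob2p w0 _)).
  have B0 : 0 <= 3 * (1 + ((chord_cst ^+ 2 * w ^+ 2)^-1) ^+ 2) by rewrite mulr_ge0// addr_ge0 ?sqr_ge0.
  apply: (le_trans (ler_wpM2l B0 H)); rewrite mulrA -/D -/KAw -/B1.
  have -> : B1 * s ^+ 4 = (eps * (B1 * S ^+ 4 / kappa ^+ 2)) * eps * (kappa * eps) ^+ 2.
    by rewrite /s; field; rewrite gt_eqF.
  rewrite -[leRHS]mul1r; apply: ler_wpM2r; first exact: sqr_ge0.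
  by apply: mulr_ile1 => //; [rewrite mulr_ge0// ltW | exact: ltW].
pose dist (f g : 'I_N -> grid p -> R) := \sum_l energy 1 (dft (fun x => f l x - g l x)).
have contr f g : good f -> good g -> dist (Psi f) (Psi g) <= 2^-1 * dist f g.
  move=> gf gg.
  have dfg0 : 0 <= dist f g by apply: sumr_ge0 => l _; exact: energy_ge0.
  have Hq : \sum_q sob1 w (fun x => jet_slots f eps q x - jet_slots g eps q x) <= D * K * dist f g.
    apply: (@le_trans _ _ (\sum_(q < d) (K * dist f g))); last first.
      by rewrite sumr_const card_ord -mulrA mulr_natl.
    apply: ler_sum => q _; have [H1 _ _] := KP p f g eps q p3; apply: (le_trans H1).
    apply: ler_wpM2l => //.
    apply: (@ler_term _ _ (fun l => energy 1 (dft (fun x => f l x - g l x)))) => l.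
    exact: energy_ge0.
  apply: (@le_trans _ _ (\sum_(l < N) ((1 + (chord_cst ^+ 2 * w ^+ 2)^-1) *
     ((C ^+ 2 * D ^+ 3 * (16 + 12 * KAw ^+ 2)) * s ^+ 2 * (D * K * dist f g))))).
    apply: ler_sum => l _; apply: (le_trans (energy1_le_sob1 w0 _)).
    apply: ler_wpM2l; first by rewrite addr_ge0.
    have H := sob1_comp w0 (derF l) (derdF l) (gradF0 l) C0 (hess l) (sm f gf) (sm g gg) s0 Ds.
    apply: (le_trans H); rewrite -/D -/KAw; apply: ler_wpM2l => //.
    rewrite mulr_ge0 ?sqr_ge0// mulr_ge0 ?mulr_ge0 ?exprn_ge0// addr_ge0// mulr_ge0//.
  rewrite sumr_const card_ord -[X in X <= _]mulr_natl.
  have -> : N%:R * ((1 + (chord_cst ^+ 2 * w ^+ 2)^-1) * (C ^+ 2 * D ^+ 3 * (16 + 12 * KAw ^+ 2) * s ^+ 2 * (D * K * dist f g)))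
     = (eps * (2 * B2 * S ^+ 2)) * eps / 2 * dist f g.
    by rewrite /B2 /s; move: ((chord_cst ^+ 2 * w ^+ 2)^-1) => b; field.
  apply: ler_wpM2r => //; rewrite -[leRHS]mul1r; apply: ler_wpM2r; first by rewrite invr_ge0.
  by apply: mulr_ile1 => //; [rewrite mulr_ge0// ltW | exact: ltW].
pose it n := iter n Psi (fun _ _ => 0).
have git n : good (it n).
  elim: n => [l|n IH]; last exact: good_Psi.
  apply: (@le_trans _ _ 0); last exact: sqr_ge0.
  apply: le_of_eq; rewrite /energy big1// => k _.
  have -> : nrm2 (dft (it 0%N l) k) = 0; last by rewrite mulr0.
  by rewrite /nrm2 /dft /= /avg !big1 ?mulr0 ?expr0n ?addr0// => x _; rewrite mul0r.
have dit n : dist (it n.+1) (it n) <= 2^-1 ^+ n * dist (it 1%N) (it 0%N).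
  elim: n => [|n IH]; first by rewrite expr0 mul1r.
  apply: (le_trans (contr _ _ (git n.+1) (git n))).
  by rewrite exprS -mulrA ler_pM2l// invr_gt0.
pose M2 : R := (2 * p).+1%:R ^+ 2.
have M20 : 0 < M2 by rewrite exprn_gt0// M_gt0.
(* The number of iterations needed on the given grid. *)
pose Z := M2 * dist (it 1%N) (it 0%N) / del ^+ 2.
have Z0 : 0 <= Z.
  by rewrite divr_ge0 ?sqr_ge0// mulr_ge0 ?(ltW M20)// sumr_ge0// => l _; exact: energy_ge0.
have [n Zn] : exists n : nat, Z <= 2 ^+ n.
  exists (Num.bound Z); have := archi_boundP Z0 => /ltW H; apply: (le_trans H).
  by rewrite -natrX ler_nat ltnW// ltn_expl.
exists (it n); split; first exact: git.
move=> l x; rewrite distrC.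
rewrite -(ler_pXn2r (n := 2)) ?nnegrE ?(ltW del0)// real_normK ?num_real//.
apply: (le_trans (point_le_energy (fun x => it n.+1 l x - it n l x) x)).
apply: (@le_trans _ _ (M2 * dist (it n.+1) (it n))).
  apply: ler_wpM2l; first exact: ltW.
  apply: (@ler_term _ _ (fun l => energy 1 (dft (fun x => it n.+1 l x - it n l x)))) => l'.
  exact: energy_ge0.
apply: (le_trans (ler_wpM2l (ltW M20) (dit n))).
have d2 : 0 < del ^+ 2 by rewrite exprn_gt0.
have -> : M2 * (2^-1 ^+ n * dist (it 1%N) (it 0%N)) = 2^-1 ^+ n * Z * del ^+ 2.
  by rewrite /Z; field; rewrite gt_eqF.
rewrite -[leRHS]mul1r; apply: ler_wpM2r; first exact: ltW.
by rewrite exprVn mulrC ler_pdivrMr ?exprn_gt0// mul1r.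
Qed.

End ApproximateSolutions.

(** * Partial derivatives in the plane and their limits *)

Section PlaneTowers.
Context {R : realType}.

(** A function together with its partial derivatives: phi a b is the (a,
    b)-th derivative of phi 0 0. Having the derivatives as data allows each
    of them to be constructed as a limit, and makes the order of
    differentiation immaterial. *)
Definition tower (k : nat) (phi : nat -> nat -> R -> R -> R) : Prop :=
  forall a b, (a + b < k)%N -> forall X Y : R,
    is_derive X 1 (phi a b ^~ Y) (phi a.+1 b X Y) /\
    is_derive Y 1 (phi a b X) (phi a b.+1 X Y).

Lemma is_derive_bigsum (J : Type) (s : seq J) (f : J -> R -> R) (df : J -> R) (x : R) :
  (forall j, is_derive x 1 (f j) (df j)) ->
  is_derive x 1 (fun y => \sum_(j <- s) f j y) (\sum_(j <- s) df j).
Proof.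
move=> H; elim: s => [|j s IH].
  rewrite big_nil; under eq_fun do rewrite big_nil; exact: is_derive_cst.
rewrite big_cons; under eq_fun do rewrite big_cons; exact: is_deriveD.
Qed.

Lemma is_derive_scale (c x d : R) (f : R -> R) :
  is_derive x 1 f d -> is_derive x 1 (fun y => c * f y) (c * d).
Proof. exact: is_deriveZ. Qed.

Lemma is_derive_exp (n : nat) (x : R) :
  is_derive x 1 (fun y : R => y ^+ n) (n%:R * x ^+ n.-1).
Proof.
have -> : (fun y : R => y ^+ n) = (id : R -> R) ^+ n.
  by apply/funext => y; rewrite exprfctE.
by apply: is_derive_eq; rewrite [_ *: 1]mulr1.
Qed.

(** A derivative shifts the phase by a quarter turn, which explains the
    form of [Trig]. *)
Lemma is_derive_trig (u v c1 c2 x : R) :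
  is_derive x 1 (fun y => c1 * cos (u * y + v) + c2 * sin (u * y + v))
    (u * (c1 * cos (u * x + v + pi / 2) + c2 * sin (u * x + v + pi / 2))).
Proof.
have D : is_derive x 1 (fun y : R => u * y + v) u.
  by apply: is_derive_eq; rewrite [_ *: 1]mulr1 ?addr0.
have C := @is_derive1_comp R cos _ x _ _ (is_derive_cos _) D.
have S := @is_derive1_comp R sin _ x _ _ (is_derive_sin _) D.
have := is_deriveD (is_derive_scale c1 C) (is_derive_scale c2 S).
move=> /is_derive_eq; apply.
by rewrite cosDpihalf sinDpihalf; ring.
Qed.

Lemma tower_Pol m q : forall k, tower k (Pol m (fun j (x : R) => x ^+ j) q).
Proof.
move=> k a b _ X Y; split.
  apply: is_derive_bigsum => s; apply: is_derive_bigsum => t.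
  have := is_derive_scale (q s t * ((s ^_ a)%:R * (t ^_ b)%:R) * Y ^+ (t - b)) (is_derive_exp (s - a) X).
  have -> : (fun y : R => q s t * ((s ^_ a)%:R * (t ^_ b)%:R) * Y ^+ (t - b) * y ^+ (s - a)) =
    (fun y => q s t * ((s ^_ a)%:R * (t ^_ b)%:R) * (y ^+ (s - a) * Y ^+ (t - b))).
    by apply/funext => y; ring.
  move=> /is_derive_eq; apply.
  by rewrite ffactnSr natrM subnS; ring.
apply: is_derive_bigsum => s; apply: is_derive_bigsum => t.
have := is_derive_scale (q s t * ((s ^_ a)%:R * (t ^_ b)%:R) * X ^+ (s - a)) (is_derive_exp (t - b) Y).
have -> : (fun y : R => q s t * ((s ^_ a)%:R * (t ^_ b)%:R) * X ^+ (s - a) * y ^+ (t - b)) =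
  (fun y => q s t * ((s ^_ a)%:R * (t ^_ b)%:R) * (X ^+ (s - a) * y ^+ (t - b))).
  by apply/funext => y; ring.
move=> /is_derive_eq; apply.
by rewrite ffactnSr natrM subnS; ring.
Qed.

Lemma tower_Trig (r : R) p c : forall k, tower k (@Trig R r p c).
Proof.
move=> k a b _ X Y; split.
  apply: is_derive_bigsum => j.
  have := is_derive_scale (mono r a b j) (is_derive_trig (freq r * centred j.1)
     (freq r * (centred j.2 * Y) + (a + b)%:R * (pi / 2)) (c j).1 (c j).2 X).
  have E y : freq r * centred j.1 * y + (freq r * (centred j.2 * Y) + (a + b)%:R * (pi / 2))
    = phase r j y Y + (a + b)%:R * (pi / 2) by rewrite /phase; ring.
  under eq_fun do rewrite E; move=> /is_derive_eq; apply; rewrite E /mono exprS.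
  have -> : phase r j X Y + (a + b)%:R * (pi / 2) + pi / 2 =
    phase r j X Y + (a.+1 + b)%:R * (pi / 2) by rewrite addSn -natr1; ring.
  by ring.
apply: is_derive_bigsum => j.
have := is_derive_scale (mono r a b j) (is_derive_trig (freq r * centred j.2)
   (freq r * (centred j.1 * X) + (a + b)%:R * (pi / 2)) (c j).1 (c j).2 Y).
have E y : freq r * centred j.2 * y + (freq r * (centred j.1 * X) + (a + b)%:R * (pi / 2))
  = phase r j X y + (a + b)%:R * (pi / 2) by rewrite /phase; ring.
under eq_fun do rewrite E; move=> /is_derive_eq; apply; rewrite E /mono exprS.
have -> : phase r j X Y + (a + b)%:R * (pi / 2) + pi / 2 =
  phase r j X Y + (a + b.+1)%:R * (pi / 2) by rewrite addnS -natr1; ring.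
by ring.
Qed.

Lemma tower_add k phi chi : tower k phi -> tower k chi ->
  tower k (fun a b X Y => phi a b X Y + chi a b X Y).
Proof.
move=> H K a b ab X Y; have [H1 H2] := H a b ab X Y; have [K1 K2] := K a b ab X Y.
by split; exact: is_deriveD.
Qed.

Lemma powR_small (al e : R) : 0 < al -> 0 < e -> exists2 d : R, 0 < d &
  forall x : R, `|x| < d -> `|x| `^ al < e.
Proof.
move=> al0 e0; exists (e `^ al^-1); first exact: powR_gt0.
move=> x xd; have -> : e = (e `^ al^-1) `^ al.
  by rewrite -powRrM mulVf ?gt_eqF// powRr1// ltW.
by rewrite gt0_ltr_powR ?nnegrE ?powR_ge0.
Qed.

(** Equi-Hoelder derivatives make pointwise limits differentiable: the
    first order Taylor remainders are bounded by C |h|^(1+al) uniformly,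
    and this bound survives in the limit. *)
Lemma holder_limit_derive (U : set_system nat) (FU : ProperFilter U)
    (g dg : nat -> R -> R) (gl dgl : R -> R) (C al x : R) :
  0 < al -> 0 <= C ->
  (forall n (t : R), is_derive t 1 (g n) (dg n t)) ->
  (forall n s t, `|dg n s - dg n t| <= C * `|s - t| `^ al) ->
  (forall t, g n t @[n --> U] --> gl t) ->
  (forall t, dg n t @[n --> U] --> dgl t) ->
  is_derive x 1 gl (dgl x).
Proof.
move=> al0 C0 gd dgH gc dgc.
(* The Taylor remainder, bounded before passing to the limit. *)
have rem h : `|gl (h + x) - gl x - h * dgl x| <= C * `|h| `^ al * `|h|.
  have cv : `|g n (h + x) - g n x - h * dg n x| @[n --> U] -->
      `|gl (h + x) - gl x - h * dgl x|.
    apply: cvg_norm; apply: cvgB; first by apply: cvgB; exact: gc.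
    by apply: cvgM; [exact: cvg_cst | exact: dgc].
  apply: (cvgr_to_le cv); apply: nearW => n.
  have [c [cx E]] : exists c, `|c - x| <= `|h| /\ g n (h + x) - g n x = h * dg n c.
    have W : {within `[0, 1], continuous (fun s : R => g n (x + s * h))} /\
       forall s : R, is_derive s 1 (fun s : R => g n (x + s * h)) (h * dg n (x + s * h)).
      have D (s : R) : is_derive s 1 (fun s : R => g n (x + s * h)) (h * dg n (x + s * h)).
        have D1 : is_derive s 1 (fun s : R => x + s * h) h.
          by apply: is_derive_eq; rewrite /GRing.scale /=; ring.
        by rewrite mulrC; exact: (@is_derive1_comp R (g n) _ s _ _ (gd n _) D1).
      split => //; apply: derivable_within_continuous => s _.
      by have := D s => -[].
    have [c /andP[c0 c1]] := mean_value01 W.2.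
    rewrite mul1r mul0r addr0 [x + h]addrC => E; exists (x + c * h); split => //.
    by rewrite addrAC subrr add0r normrM ger0_norm// ler_piMl.
  rewrite E -mulrBr normrM mulrC; apply: ler_wpM2r => //.
  apply: (le_trans (dgH _ _ _)); apply: ler_wpM2l => //.
  by apply: ge0_ler_powR; rewrite ?nnegrE ?(ltW al0).
have cvD : (fun h => h^-1 *: ((gl \o shift x) (h *: (1 : R)) - gl x)) @ 0^' --> dgl x.
  apply/cvgrPdist_le => /= e e0.
  have C1 : 0 < C + 1 by lra.
  have [d d0 dP] := powR_small al0 (divr_gt0 e0 C1).
  exists d => //= h /=; rewrite sub0r normrN => hd h0.
  rewrite [h *: 1]mulr1 distrC.
  have -> : h^-1 *: (gl (h + x) - gl x) - dgl x = (gl (h + x) - gl x - h * dgl x) / h.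
    by rewrite /GRing.scale /=; field.
  rewrite normrM normfV ler_pdivrMr ?normr_gt0//; apply: (le_trans (rem h)).
  apply: ler_wpM2r => //; have := dP _ hd; rewrite ltr_pdivlMr// mulrC => /ltW H.
  apply: le_trans H; apply: ler_wpM2r; [exact: powR_ge0 | lra].
split; first by apply/cvg_ex; exists (dgl x).
exact: cvg_lim cvD.
Qed.

(** Along such an ultrafilter all bounded sequences converge at once, which
    spares diagonal extractions. *)
Lemma ultrafilter_nat : exists U : set_system nat, UltraFilter U /\ \oo `<=` U.
Proof. by have [U [U1 U2]] := ultraFilterLemma (eventually_filter); exists U. Qed.

Lemma bounded_ultra_cvg (U : set_system nat) (UU : UltraFilter U) (z : nat -> R) (B : R) :
  (forall n, `|z n| <= B) -> z n @[n --> U] --> lim (z n @[n --> U]).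
Proof.
move=> zB; have := @segment_compact R (- B) B; rewrite compact_ultra => H.
have UF : UltraFilter (z n @[n --> U]).
  split; first exact: fmap_proper_filter.
  move=> F FF UleF; rewrite predeqE => A; split; last exact: UleF.
  move=> FA; have [//|FnA] := in_ultra_setVsetC (z @^-1` A) UU.
  have /filter_ex[? []//] : F (A `&` ~` A).
  by apply: filterI => //; apply: UleF.
have FA : (z n @[n --> U]) `[- B, B]%classic.
  by apply: (@filterE _ U) => n; rewrite /= in_itv /= -ler_norml; exact: zB.
have [l [_ zl]] := H _ UF FA.
by apply/cvg_ex; exists l; exact: zl.
Qed.

End PlaneTowers.

(** * The polynomial part *)

Section Convergence.
Context {R : realType}.

Lemma cvg_bigsum (T : Type) (F : set_system T) (FF : Filter F) (J : Type) (s : seq J)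
    (f : J -> T -> R) (l : J -> R) :
  (forall j, f j n @[n --> F] --> l j) ->
  (\sum_(j <- s) f j n) @[n --> F] --> \sum_(j <- s) l j.
Proof.
move=> H; elim: s => [|j s IH].
  by rewrite big_nil; under eq_fun do rewrite big_nil; exact: cvg_cst.
by rewrite big_cons; under eq_fun do rewrite big_cons; exact: cvgD.
Qed.

Lemma cvg_Pol m (T : Type) (F : set_system T) (FF : Filter F)
    (qn : T -> nat -> nat -> R) (q : nat -> nat -> R) (Xn Yn : T -> R) X Y a b :
  (forall s t, qn n s t @[n --> F] --> q s t) ->
  Xn n @[n --> F] --> X -> Yn n @[n --> F] --> Y ->
  Pol m (fun j x => x ^+ j) (qn n) a b (Xn n) (Yn n) @[n --> F] -->
  Pol m (fun j x => x ^+ j) q a b X Y.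
Proof.
move=> Hq HX HY; apply: cvg_bigsum => s; apply: cvg_bigsum => t.
apply: cvgM; first by apply: cvgM; [exact: Hq | exact: cvg_cst].
have P j (Zn : T -> R) (Z : R) : Zn n @[n --> F] --> Z -> Zn n ^+ j @[n --> F] --> Z ^+ j.
  exact: (@continuous_cvg _ _ _ F FF Zn (fun x : R => x ^+ j) Z (@exprn_continuous R j Z)).
by apply: cvgM; exact: P.
Qed.

Lemma Pol0 m (q : nat -> nat -> R) a b : (a <= 2 * m)%N -> (b <= 2 * m)%N ->
  Pol m (fun j x => x ^+ j) q a b 0 0 = q a b * (a`! * b`!)%:R.
Proof.
move=> am bm.
have zero (u v : nat) : u != v -> (v ^_ u)%:R * 0 ^+ (v - u) = 0 :> R.
  move=> uv; case: (ltnP v u) => vu; first by rewrite ffact_small// mul0r.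
  by rewrite expr0n subn_eq0 leqNgt ltn_neqAle uv vu /= mulr0.
rewrite /Pol (bigD1 (Ordinal (am : (a < (2 * m).+1)%N))) //=.
rewrite [X in _ + X]big1 ?addr0; last first.
  move=> s; rewrite -(inj_eq val_inj) /= eq_sym => sa; apply: big1 => t _.
  have := zero _ _ sa.
  move: ((s ^_ a)%:R) (0 ^+ (s - a)) ((t ^_ b)%:R) (0 ^+ (t - b)) => x y u v xy.
  have -> : q s t * (x * u) * (y * v) = (x * y) * (q s t * u * v) by ring.
  by rewrite xy mul0r.
rewrite (bigD1 (Ordinal (bm : (b < (2 * m).+1)%N))) //=.
rewrite [X in _ + X]big1 ?addr0; last first.
  move=> t; rewrite -(inj_eq val_inj) /= eq_sym => tb.
  have := zero _ _ tb.
  move: ((t ^_ b)%:R) (0 ^+ (t - b)) ((a ^_ a)%:R) (0 ^+ (a - a)) => x y u v xy.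
  have -> : q a t * (u * x) * (v * y) = (x * y) * (q a t * u * v) by ring.
  by rewrite xy mul0r.
by rewrite !subnn !expr0 !ffactnn !mulr1 natrM.
Qed.

(** Since the coefficients of degree above 2m vanish, the derivatives of
    order 2m are constant. *)
Lemma Pol_top m (q : nat -> nat -> R) a b X Y : (a + b = 2 * m)%N ->
  (forall s t, (2 * m < s + t)%N -> q s t = 0) ->
  Pol m (fun j x => x ^+ j) q a b X Y = q a b * (a`! * b`!)%:R.
Proof.
move=> ab q0.
have am : (a < (2 * m).+1)%N by rewrite ltnS -ab leq_addr.
have bm : (b < (2 * m).+1)%N by rewrite ltnS -ab leq_addl.
have zero (s t : nat) : (s, t) != (a, b) ->
    q s t * ((s ^_ a)%:R * (t ^_ b)%:R) = 0.
  move=> st; have [/q0->|stm] := ltnP (2 * m) (s + t); first by rewrite mul0r.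
  have [sa|sa] := ltnP s a; first by rewrite (ffact_small sa) mul0r mulr0.
  have [tb|tb] := ltnP t b; first by rewrite (ffact_small tb) !mulr0.
  by exfalso; move/eqP: st; apply; congr pair; lia.
rewrite /Pol (bigD1 (Ordinal am)) //= [X in _ + X]big1 ?addr0; last first.
  move=> s; rewrite -(inj_eq val_inj) /= => sa; apply: big1 => t _.
  by rewrite zero ?mul0r// xpair_eqE negb_and sa.
rewrite (bigD1 (Ordinal bm)) //= [X in _ + X]big1 ?addr0; last first.
  move=> t; rewrite -(inj_eq val_inj) /= => tb.
  by rewrite zero ?mul0r// xpair_eqE negb_and tb orbT.
by rewrite !subnn !expr0 !ffactnn !mulr1 natrM.
Qed.

End Convergence.

(** * The Laplacian in the plane *)

Section Laplacian2D.
Context {R : realType}.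
Implicit Types phi chi : nat -> nat -> R -> R -> R.

(** On towers the Laplacian merely shifts indices. *)
Definition lap2 phi : nat -> nat -> R -> R -> R :=
  fun a b X Y => phi a.+2 b X Y + phi a b.+2 X Y.

Lemma tower_lap2 k phi : tower k.+2 phi -> tower k (lap2 phi).
Proof.
move=> H a b ab X Y.
have [H1 H2] := H a.+2 b ltac:(lia) X Y; have [H3 H4] := H a b.+2 ltac:(lia) X Y.
by split; exact: is_deriveD.
Qed.

Lemma iter_lap2_add j phi chi a b X Y :
  iter j lap2 (fun a b X Y => phi a b X Y + chi a b X Y) a b X Y =
  iter j lap2 phi a b X Y + iter j lap2 chi a b X Y.
Proof.
elim: j a b => [//|j IH] a b; rewrite !iterS /lap2 -/lap2 !IH.
by rewrite addrACA.
Qed.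

(** Of all derivatives D^(a,b) of order 2m with b even, the only ones in
    Delta^m, only D_X^(2m) contributes for the polynomial of [coef]. *)
Lemma iter_lap2_top m phi (V : R) X Y :
  (forall a b, (a + b = 2 * m)%N -> ~~ odd b ->
     phi a b X Y = if b == 0%N then V else 0) ->
  forall j a b, (a + b + 2 * j = 2 * m)%N -> ~~ odd b ->
  iter j lap2 phi a b X Y = if b == 0%N then V else 0.
Proof.
move=> H; elim=> [|j IH] a b abj ob; first by apply: H => //; lia.
rewrite iterS /lap2 -/lap2 !IH //; [|lia|by rewrite !oddS negbK|lia].
by rewrite addr0.
Qed.

Variables (r : R) (m : nat).
Hypothesis r_gt0 : 0 < r.
Hypothesis m_gt0 : (0 < m)%N.
Local Notation w := (freq r).
Let w0 : 0 < w. Proof. exact: freq_gt0. Qed.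

Let symb p (k : grid p) : R := - (w ^+ 2 * (centred k.1 ^+ 2 + centred k.2 ^+ 2)).

Lemma iter_lap2_Trig p (c : grid p -> R * R) j a b X Y :
  iter j lap2 (Trig r c) a b X Y =
  Trig r (fun k => (symb k ^+ j * (c k).1, symb k ^+ j * (c k).2)) a b X Y.
Proof.
elim: j a b => [|j IH] a b.
  by rewrite /= /Trig; apply: eq_bigr => k _ /=; rewrite expr0 !mul1r.
rewrite iterS /lap2 -/lap2 !IH /Trig -big_split; apply: eq_bigr => k _ /=.
have E (x y : nat) : (x = y + 2)%N -> phase r k X Y + x%:R * (pi / 2) =
    (phase r k X Y + y%:R * (pi / 2)) + pi.
  by move=> ->; rewrite natrD; field.
rewrite (E (a.+2 + b)%N (a + b)%N) ?(E (a + b.+2)%N (a + b)%N); [|lia..].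
rewrite cosDpi sinDpi /mono !exprS /symb.
by ring.
Qed.

Lemma centred_inord p : centred (inord p : 'I_(2 * p).+1) = 0 :> R.
Proof. by rewrite /centred inordK ?subrr// ltnS mul2n -addnn leq_addr. Qed.

Lemma centred_eq0 p (k : 'I_(2 * p).+1) : (centred k == 0 :> R) = (k == inord p).
Proof.
rewrite /centred subr_eq0 eqr_nat -(inj_eq val_inj) /= inordK// ltnS mul2n -addnn.
exact: leq_addr.
Qed.

(** The zero mode is the only one that [inv_symb] does not invert. *)
Lemma iter_lap2_inv_lap p (c : grid p -> R * R) X Y :
  iter m lap2 (Trig r (inv_lap r m c)) 0%N 0%N X Y = Trig r c 0 0 X Y - (c (zero_mode p)).1.
Proof.
rewrite iter_lap2_Trig /Trig (bigD1 (zero_mode p)) //= [in RHS](bigD1 (zero_mode p)) //=.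
have z : phase r (zero_mode p) X Y = 0.
  by rewrite /phase /zero_mode /= !centred_inord; ring.
have z' : symb (zero_mode p) = 0.
  by rewrite /symb /zero_mode /= !centred_inord; ring.
rewrite z z' !mul0r !addr0 cos0 sin0 /mono !expr0 !mulr1 !mul1r.
rewrite expr0n gtn_eqF//= !mul0r mulr0 !addr0 add0r.
rewrite addrAC subrr add0r; apply: eq_bigr => k k0.
have S0 : symb k != 0.
  have wn0 : w != 0 by rewrite gt_eqF.
  rewrite /symb oppr_eq0 mulf_eq0 negb_or expf_neq0//=.
  rewrite paddr_eq0 ?sqr_ge0// !sqrf_eq0 !centred_eq0.
  by move: k0; rewrite /zero_mode; case: k => k1 k2; rewrite xpair_eqE.
have Sm : symb k ^+ m * inv_symb r m k = 1 by rewrite /inv_symb -/(symb k) divff// expf_neq0.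
rewrite /inv_lap /= ![symb k ^+ m * (_ * _)]mulrA Sm.
by rewrite !mul1r.
Qed.

End Laplacian2D.

(** * Hoelder bounds for trigonometric polynomials *)

Section HolderTrig.
Context {R : realType}.
Variables (r : R) (m : nat).
Hypothesis r_gt0 : 0 < r.
Hypothesis m_gt0 : (0 < m)%N.
Local Notation w := (freq r).
Let w0 : 0 < w. Proof. exact: freq_gt0. Qed.

(** Interpolation between the bound 2 on the difference and the Lipschitz
    bound. *)
Lemma holder_of_lipschitz (f : R -> R) (al : R) : 0 < al -> al < 1 ->
  (forall s, `|f s| <= 1) -> (forall s t, `|f s - f t| <= `|s - t|) ->
  forall s t, `|f s - f t| <= 2 * `|s - t| `^ al.
Proof.
move=> al0 al1 f1 fl s t; have [d1|d1] := leP `|s - t| 1.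
  have [d0|d0] := eqVneq `|s - t| 0.
    by apply: (le_trans (fl s t)); rewrite d0 mulr_ge0 ?powR_ge0.
  have dpos : 0 < `|s - t| <= 1 by rewrite d1 lt_neqAle eq_sym d0 normr_ge0.
  apply: (le_trans (fl s t)); apply: (le_trans (ger1_powR dpos (ltW al1))).
  by have := powR_ge0 `|s - t| al; lra.
apply: (@le_trans _ _ 2).
  by apply: (le_trans (ler_normB _ _)); have := f1 s; have := f1 t; lra.
have : `|s - t| `^ 0 <= `|s - t| `^ al by apply: ler_powR; exact: ltW.
by rewrite powRr0; lra.
Qed.

(** Stated for two families of coefficients because it is used twice: for
    the derivatives of [inv_lap c], and for [c] itself. *)
Lemma Trig_holder (al : R) : 0 < al -> al < 1 -> exists2 H : R, 0 <= H &
  forall p (e c : grid p -> R * R) (K : R) a b X Y X' Y', 0 <= K ->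
  (forall k, `|mono r a b k| * amp (e k) <= K * amp (c k)) ->
  (Trig r e a b X Y - Trig r e a b X' Y') ^+ 2 <=
    H * (K ^+ 2 * energy 2 c) * ((`|X - X'| + `|Y - Y'|) `^ al) ^+ 2.
Proof.
move=> al0 al1; have [C C0 CP] := holder_weight_bound al1.
exists (4 * (w `^ al) ^+ 2 * C); first by rewrite mulr_ge0// mulr_ge0 ?sqr_ge0.
move=> p e c K a b X Y X' Y' K0 eK.
set del := `|X - X'| + `|Y - Y'|.
have del0 : 0 <= del by rewrite addr_ge0.
pose S := \sum_k weight k `^ (al / 2) * amp (c k).
apply: (@le_trans _ _ ((2 * w `^ al * del `^ al * K * S) ^+ 2)); last first.
  have := CP p c; rewrite -/S => H.
  have T0 : 0 <= (2 * w `^ al * del `^ al * K) ^+ 2 by exact: sqr_ge0.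
  have := ler_wpM2l T0 H; rewrite -exprMn => {}H; apply: (le_trans H).
  by apply: le_of_eq; ring.
apply: sqr_le_abs; rewrite /Trig -sumrB; apply: (le_trans (ler_norm_sum _ _ _)).
rewrite mulr_sumr; apply: ler_sum => k _.
set s := _ * (pi / 2).
have ph : `|(phase r k X Y + s) - (phase r k X' Y' + s)| `^ al <=
    w `^ al * del `^ al * weight k `^ (al / 2).
  have -> : w `^ al * del `^ al * weight k `^ (al / 2) = (w * del * Num.sqrt (weight k)) `^ al :> R.
    rewrite (powRM _ (mulr_ge0 (ltW w0) del0) (sqrtr_ge0 _)) (powRM _ (ltW w0) del0).
    by rewrite -powR12_sqrt ?(ltW (weight_gt0 _))// -powRrM [2^-1 * al]mulrC.
  apply: (ge0_ler_powR (ltW al0)); rewrite ?nnegrE //.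
    by apply: mulr_ge0; [apply: mulr_ge0 => //; exact: ltW | exact: sqrtr_ge0].
  have -> : phase r k X Y + s - (phase r k X' Y' + s) =
     w * (centred k.1 * (X - X') + centred k.2 * (Y - Y')) by rewrite /phase; ring.
  rewrite normrM (gtr0_norm w0) -mulrA; apply: ler_wpM2l; first exact: ltW.
  apply: (le_trans (ler_normD _ _)); rewrite !normrM mulrDl.
  have q1 : `|centred k.1| <= Num.sqrt (weight k) :> R.
    rewrite -sqrtr_sqr ler_wsqrtr// /weight; have := sqr_ge0 (@centred R p k.2); lra.
  have q2 : `|centred k.2| <= Num.sqrt (weight k) :> R.
    rewrite -sqrtr_sqr ler_wsqrtr// /weight; have := sqr_ge0 (@centred R p k.1); lra.
  by apply: lerD; rewrite [leRHS]mulrC; apply: ler_wpM2r.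
have Hc := holder_of_lipschitz al0 al1 (@cos_max R) (@cos_lipschitz R)
   (phase r k X Y + s) (phase r k X' Y' + s).
have Hs := holder_of_lipschitz al0 al1 (@sin_max R) (@sin_lipschitz R)
   (phase r k X Y + s) (phase r k X' Y' + s).
set P := w `^ al * del `^ al * weight k `^ (al / 2) in ph.
have {}Hc := le_trans Hc (ler_wpM2l (ler0n R 2) ph).
have {}Hs := le_trans Hs (ler_wpM2l (ler0n R 2) ph).
move: (cos _) (cos _) (sin _) (sin _) Hc Hs => C2 C1 S2 S1 Hc Hs.
have -> : mono r a b k * ((e k).1 * C1 + (e k).2 * S1)
  - mono r a b k * ((e k).1 * C2 + (e k).2 * S2) =
  mono r a b k * ((e k).1 * (C1 - C2) + (e k).2 * (S1 - S2)) by ring.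
rewrite normrM.
apply: (@le_trans _ _ (`|mono r a b k| * (amp (e k) * (2 * P)))).
  apply: ler_wpM2l => //; apply: (le_trans (ler_normD _ _)); rewrite !normrM /amp mulrDl.
  by apply: lerD; apply: ler_wpM2l.
have P0 : 0 <= 2 * P by apply: le_trans Hc.
rewrite [leLHS]mulrA; apply: (le_trans (ler_wpM2r P0 (eK k))).
by apply: le_of_eq; rewrite /P; ring.
Qed.

End HolderTrig.

(** * Limits of sequences of bounded energy *)

Section EnergyLimit.
Context {R : realType}.
Variables (r al : R) (m : nat).
Hypothesis r_gt0 : 0 < r.
Hypothesis m_gt0 : (0 < m)%N.
Hypothesis al_gt0 : 0 < al.
Hypothesis al_lt1 : al < 1.
Local Notation w := (freq r).
Local Notation inv_lap := (inv_lap r m).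
Local Notation Trig := (Trig r).

Variables (U : set_system nat) (UU : UltraFilter U).
Variables (pn : nat -> nat) (c : forall n, grid (pn n) -> R * R) (B : R).
Hypothesis cB : forall n, energy 2 (@c n) <= B.

Let FU : ProperFilter U := ultra_proper.

(** The limit of the parts of the solutions that come from inverting
    Delta^m. Their existence is proved in [psi_cvg]. *)
Definition psi (a b : nat) (X Y : R) : R := lim (Trig (inv_lap (@c n)) a b X Y @[n --> U]).

Definition mean_limit : R := lim ((@c n (zero_mode (pn n))).1 @[n --> U]).

Let B0 : 0 <= B. Proof. exact: le_trans (energy_ge0 2 _) (cB 0). Qed.

Let abs_le_sqrt (x D : R) : x ^+ 2 <= D -> `|x| <= Num.sqrt D.
Proof. by move=> H; rewrite -sqrtr_sqr ler_wsqrtr. Qed.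

Lemma psi_bound_cvg : exists2 D : R, 0 <= D & forall a b X Y, (a + b <= 2 * m)%N ->
  (forall n, Trig (inv_lap (@c n)) a b X Y ^+ 2 <= D * B).
Proof.
have [D D0 DP] := Trig_inv_lap_sup r_gt0 m_gt0 (ltW al_gt0) al_lt1.
exists D => // a b X Y ab n; apply: (le_trans (DP _ _ _ _ _ _ ab)).
by apply: ler_wpM2l.
Qed.

Lemma psi_cvg a b X Y : (a + b <= 2 * m)%N ->
  Trig (inv_lap (@c n)) a b X Y @[n --> U] --> psi a b X Y.
Proof.
move=> ab; have [D _ H] := psi_bound_cvg.
apply: (bounded_ultra_cvg UU (B := Num.sqrt (D * B))) => n.
by apply: abs_le_sqrt; exact: H.
Qed.

Lemma mean_cvg : (@c n (zero_mode (pn n))).1 @[n --> U] --> mean_limit.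
Proof.
apply: (bounded_ultra_cvg UU (B := Num.sqrt B)) => n; apply: abs_le_sqrt.
apply: le_trans (cB n).
apply: (@le_trans _ _ (weight (zero_mode (pn n)) ^+ 2 * nrm2 (@c n (zero_mode (pn n))))).
  rewrite /nrm2; have := @weight_ge1 R _ (zero_mode (pn n)).
  have := sqr_ge0 (@c n (zero_mode (pn n))).1; have := sqr_ge0 (@c n (zero_mode (pn n))).2.
  move: (weight _) (_ ^+ 2) (_.1 ^+ 2) => q y x y0 x0 q1.
  have : 1 <= q ^+ 2 by rewrite expr_ge1//; lra.
  by move: (q ^+ 2) => z z1; nra.
apply: (@ler_term _ _ (fun k => weight k ^+ 2 * nrm2 (@c n k))) => k.
by rewrite mulr_ge0 ?nrm2_ge0// exprn_ge0// ltW// weight_gt0.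
Qed.

(** A common Hoelder constant for the derivatives of order at most 2m of
    the inverses and for the trigonometric interpolants of the right-hand
    sides. *)
Lemma energy_holder : exists2 H : R, 0 <= H & forall n X Y X' Y',
  (forall a b, (a + b <= 2 * m)%N ->
    `|Trig (inv_lap (@c n)) a b X Y - Trig (inv_lap (@c n)) a b X' Y'| <=
      H * (`|X - X'| + `|Y - Y'|) `^ al) /\
  `|Trig (@c n) 0 0 X Y - Trig (@c n) 0 0 X' Y'| <= H * (`|X - X'| + `|Y - Y'|) `^ al.
Proof.
have [H H0 HP] := Trig_holder r_gt0 al_gt0 al_lt1.
exists (Num.sqrt (H * (mult_cst r m ^+ 2 * B))); first exact: sqrtr_ge0.
move=> n X Y X' Y'; have Cm1 := mult_cst_ge1 m r_gt0.
set d := _ `^ al; have d0 : 0 <= d by exact: powR_ge0.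
have fin (x K : R) : 0 <= K -> K <= mult_cst r m -> x ^+ 2 <= H * (K ^+ 2 * energy 2 (@c n)) * d ^+ 2 ->
    `|x| <= Num.sqrt (H * (mult_cst r m ^+ 2 * B)) * d.
  move=> K0 KC xK; rewrite -[X in _ * X](ger0_norm d0) -[X in _ * X]sqrtr_sqr.
  rewrite -sqrtrM; last by rewrite mulr_ge0// mulr_ge0 ?sqr_ge0.
  apply: abs_le_sqrt; apply: (le_trans xK); apply: ler_wpM2r; first exact: sqr_ge0.
  apply: ler_wpM2l => //; apply: ler_pM; rewrite ?sqr_ge0 ?energy_ge0 ?cB//.
  by apply: sqr_le_abs; rewrite ger0_norm.
split => [a b ab|].
  apply: (@fin _ (mult_cst r m)); rewrite ?mult_cst_ge0//.
  apply: HP => [|k]; first exact: mult_cst_ge0.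
  by rewrite amp_inv_lap; apply: ler_wpM2r; [exact: amp_ge0 | exact: multiplier_bound].
apply: (@fin _ 1) => //; apply: HP => // k.
by rewrite /mono !expr0 mulr1 normr1.
Qed.

Lemma psi_holder : exists2 H : R, 0 <= H & forall a b X Y X' Y', (a + b <= 2 * m)%N ->
  `|psi a b X Y - psi a b X' Y'| <= H * (`|X - X'| + `|Y - Y'|) `^ al.
Proof.
have [H H0 HP] := energy_holder; exists H => // a b X Y X' Y' ab.
apply: (@cvgr_to_le _ U _ R (fun n => `|Trig (inv_lap (@c n)) a b X Y - Trig (inv_lap (@c n)) a b X' Y'|)).
  by apply: cvg_norm; apply: cvgB; exact: psi_cvg.
by apply: nearW => n; exact: (HP n X Y X' Y').1.
Qed.

(** The Hoelder bounds of [energy_holder] for the next derivative are the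
    hypothesis of [holder_limit_derive]. *)
Lemma tower_psi : tower (2 * m) psi.
Proof.
have [H H0 HP] := energy_holder.
move=> a b ab X Y; split.
  apply: (@holder_limit_derive R U _ (fun n x => Trig (inv_lap (@c n)) a b x Y)
    (fun n x => Trig (inv_lap (@c n)) a.+1 b x Y) _ (fun x => psi a.+1 b x Y) H al) => //.
  - by move=> n t; exact: (@tower_Trig R r _ _ (2 * m)%N a b ab t Y).1.
  - move=> n s t; have := (HP n s Y t Y).1 a.+1 b ab.
    by rewrite subrr normr0 addr0.
  - by move=> t; apply: psi_cvg; exact: ltnW.
  - by move=> t; apply: psi_cvg.
apply: (@holder_limit_derive R U _ (fun n y => Trig (inv_lap (@c n)) a b X y)
  (fun n y => Trig (inv_lap (@c n)) a b.+1 X y) _ (fun y => psi a b.+1 X y) H al) => //.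
- by move=> n t; exact: (@tower_Trig R r _ _ (2 * m)%N a b ab X t).2.
- move=> n s t; have := (HP n X s X t).1 a b.+1; rewrite addnS => /(_ ab).
  by rewrite subrr normr0 add0r.
- by move=> t; apply: psi_cvg; exact: ltnW.
- by move=> t; apply: psi_cvg; rewrite addnS.
Qed.

Definition coef_lim (eps : R) (s t : nat) : R :=
  if (s + t < 2 * m)%N then - psi s t 0 0 / (s`! * t`!)%:R
  else if (s == 2 * m)%N && (t == 0)%N then mean_limit / ((2 * m)`!)%:R
  else if (s == (2 * m).-1)%N && (t == 1)%N then eps / ((2 * m).-1`!)%:R
  else 0.

Lemma coef_cvg eps s t : coef r m (@c n) eps s t @[n --> U] --> coef_lim eps s t.
Proof.
rewrite /coef /coef_lim; case st: (s + t < 2 * m)%N.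
  exact: (cvgM (cvgN (@psi_cvg s t 0 0 (ltnW st))) (cvg_cst ((s`! * t`!)%:R^-1 : R))).
case: (_ && _); first exact: (cvgM mean_cvg (cvg_cst (((2 * m)`!)%:R^-1 : R))).
by case: (_ && _); exact: cvg_cst.
Qed.

Definition sol (eps : R) (a b : nat) (X Y : R) : R :=
  psi a b X Y + Pol m (fun j x => x ^+ j) (coef_lim eps) a b X Y.

Lemma tower_sol eps : tower (2 * m) (sol eps).
Proof. exact: tower_add tower_psi (@tower_Pol R m _ _). Qed.

Lemma dist_cvg0 (T : Type) (F : set_system T) (FF : Filter F) (Xn Yn : T -> R) (X Y : R) :
  Xn n @[n --> F] --> X -> Yn n @[n --> F] --> Y ->
  (`|Xn n - X| + `|Yn n - Y|) `^ al @[n --> F] --> (0 : R).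
Proof.
move=> HX HY; apply/cvgrPdist_lt => e e0.
have [d d0 dP] := powR_small al_gt0 e0.
have d2 : 0 < d / 2 by rewrite divr_gt0.
move/cvgrPdist_lt : HX => /(_ _ d2) hx; move/cvgrPdist_lt : HY => /(_ _ d2) hy.
apply: filterS2 hx hy => n h1 h2; rewrite sub0r normrN ger0_norm ?powR_ge0//.
have H : `|(`|Xn n - X| + `|Yn n - Y|)| < d.
  by rewrite ger0_norm ?addr_ge0// (distrC (Xn n)) (distrC (Yn n)); lra.
by have := dP _ H; rewrite ger0_norm ?addr_ge0.
Qed.

(** Equicontinuity allows the points to move: only grid points see the
    approximate equation, and they have to approach a given point of the
    plane. *)
Lemma moving_cvg (z : nat -> R -> R -> R) (l H : R) (Xn Yn : nat -> R) (X Y : R) :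
  (forall n x y x' y', `|z n x y - z n x' y'| <= H * (`|x - x'| + `|y - y'|) `^ al) ->
  Xn n @[n --> U] --> X -> Yn n @[n --> U] --> Y ->
  z n X Y @[n --> U] --> l -> z n (Xn n) (Yn n) @[n --> U] --> l.
Proof.
move=> zH HX HY zl.
have D0 : z n (Xn n) (Yn n) - z n X Y @[n --> U] --> (0 : R).
  apply/cvgr0Pnorm_le => e e0.
  have H1 : H * (`|Xn n - X| + `|Yn n - Y|) `^ al @[n --> U] --> (0 : R).
    by rewrite -(mulr0 H); apply: cvgM; [exact: cvg_cst | exact: dist_cvg0].
  move/cvgr0Pnorm_le : H1 => /(_ _ e0); apply: filterS => n h.
  by apply: (le_trans (zH _ _ _ _ _)); exact: le_trans (ler_norm _) h.
rewrite -[l]add0r.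
have -> : (fun n => z n (Xn n) (Yn n)) =
    (fun n => (z n (Xn n) (Yn n) - z n X Y) + z n X Y).
  by apply/funext => n; rewrite subrK.
exact: cvgD.
Qed.

Lemma Sol_moving_cvg eps a b (Xn Yn : nat -> R) (X Y : R) : (a + b <= 2 * m)%N ->
  Xn n @[n --> U] --> X -> Yn n @[n --> U] --> Y ->
  Sol r m (fun j x => x ^+ j) (@c n) eps a b (Xn n) (Yn n) @[n --> U] --> sol eps a b X Y.
Proof.
move=> ab HX HY; have [H H0 HP] := energy_holder; apply: cvgD.
  apply: (@moving_cvg (fun n => Trig (inv_lap (@c n)) a b) _ H _ _ X Y) => //.
    by move=> n x y x' y'; exact: (HP n x y x' y').1.
  exact: psi_cvg.
by apply: cvg_Pol => //; exact: coef_cvg.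
Qed.

Lemma sol_continuous eps a b X Y : (a + b <= 2 * m)%N ->
  (fun z : R * R => sol eps a b z.1 z.2) z @[z --> (X, Y)] --> sol eps a b X Y.
Proof.
move=> ab; have [H H0 HP] := psi_holder.
have c1 : (fun z : R * R => z.1) z @[z --> (X, Y)] --> X by exact: cvg_fst.
have c2 : (fun z : R * R => z.2) z @[z --> (X, Y)] --> Y by exact: cvg_snd.
apply: cvgD; last by apply: cvg_Pol => // s t; exact: cvg_cst.
rewrite -[psi a b X Y]add0r.
have -> : (fun z : R * R => psi a b z.1 z.2) =
    (fun z => (psi a b z.1 z.2 - psi a b X Y) + psi a b X Y).
  by apply/funext => z; rewrite subrK.
apply: cvgD; last exact: cvg_cst.
apply/cvgr0Pnorm_le => e e0.
have H1 : H * (`|z.1 - X| + `|z.2 - Y|) `^ al @[z --> (X, Y)] --> (0 : R).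
  by rewrite -(mulr0 H); apply: cvgM; [exact: cvg_cst | exact: dist_cvg0].
move/cvgr0Pnorm_le : H1 => /(_ _ e0); apply: filterS => z h.
by apply: (le_trans (HP _ _ _ _ _ _ ab)); exact: le_trans (ler_norm _) h.
Qed.

Lemma coef_lim_high eps s t : (2 * m < s + t)%N -> coef_lim eps s t = 0.
Proof.
move=> st; rewrite /coef_lim ltnNge (ltnW st) /=.
case: ifP => [/andP[/eqP E1 /eqP E2]|_]; first by move: st; rewrite E1 E2 addn0 ltnn.
case: ifP => [/andP[/eqP E1 /eqP E2]|//].
by move: st; rewrite E1 E2 addn1 prednK ?ltnn// muln_gt0.
Qed.

Lemma sol_holder eps a b : (a + b = 2 * m)%N -> exists C : R, forall X Y X' Y',
  `|sol eps a b X Y - sol eps a b X' Y'| <= C * (`|X - X'| + `|Y - Y'|) `^ al.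
Proof.
move=> ab; have [H H0 HP] := psi_holder; exists H => X Y X' Y'.
have qh := coef_lim_high eps.
rewrite /sol (Pol_top X Y ab qh) (Pol_top X' Y' ab qh).
by rewrite opprD addrACA subrr addr0; apply: HP; rewrite ab.
Qed.

Lemma sol_vanish eps a b : (a + b < 2 * m)%N -> sol eps a b 0 0 = 0.
Proof.
move=> ab; rewrite /sol Pol0; [|lia..].
rewrite /coef_lim ab divfK ?subrr// pnatr_eq0 -lt0n muln_gt0 !fact_gt0 //.
Qed.

Lemma sol_top eps : sol eps (2 * m).-1 1%N 0 0 = psi (2 * m).-1 1 0 0 + eps.
Proof.
have m2 : (0 < 2 * m)%N by rewrite muln_gt0.
rewrite /sol Pol0; [|lia..]; congr (_ + _).
rewrite /coef_lim addn1 prednK// ltnn /= !eqxx andbF muln1 divfK// pnatr_eq0 -lt0n fact_gt0.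
Qed.

Let iter_lap2_psi j a b X Y : (a + b + 2 * j <= 2 * m)%N ->
  iter j lap2 (Trig (inv_lap (@c n))) a b X Y @[n --> U] --> iter j lap2 psi a b X Y.
Proof.
elim: j a b => [|j IH] a b ab; first by apply: psi_cvg; lia.
rewrite iterS /lap2 -/lap2; under eq_fun do rewrite iterS /lap2 -/lap2.
by apply: cvgD; apply: IH; lia.
Qed.

(** The corrector contributes its constant polyharmonic part, which is the
    limit of the mean values that [inv_lap] had dropped. *)
Lemma sol_polylaplacian eps X Y :
  Trig (@c n) 0 0 X Y @[n --> U] --> iter m lap2 (sol eps) 0%N 0%N X Y.
Proof.
have m2 : (0 < 2 * m)%N by rewrite muln_gt0.
rewrite /sol iter_lap2_add.
have top a b : (a + b = 2 * m)%N -> ~~ odd b ->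
    Pol m (fun j x => x ^+ j) (coef_lim eps) a b X Y = if b == 0%N then mean_limit else 0.
  move=> ab ob; rewrite (Pol_top X Y ab (coef_lim_high eps)).
  rewrite /coef_lim ab ltnn; case: (eqVneq b 0%N) => [b0|b0].
    move: ab; rewrite b0 addn0 => ->; rewrite eqxx /= fact0 muln1 divfK// pnatr_eq0 -lt0n fact_gt0.
  rewrite andbF; case: ifP => [/andP[_ /eqP b1]|_]; last by rewrite mul0r.
  by rewrite b1 in ob.
have tot : (0 + 0 + 2 * m = 2 * m)%N by rewrite !add0n.
rewrite (iter_lap2_top top tot isT) eqxx.
have -> : (fun n => Trig (@c n) 0 0 X Y) = (fun n =>
   iter m lap2 (Trig (inv_lap (@c n))) 0%N 0%N X Y + (@c n (zero_mode (pn n))).1).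
  by apply/funext => n; rewrite iter_lap2_inv_lap// subrK.
by apply: cvgD; [apply: iter_lap2_psi; rewrite !add0n | exact: mean_cvg].
Qed.

End EnergyLimit.

(** * Solutions in the plane *)

Section PlaneSolutions.
Context {R : realType}.
Variables (r al : R) (m : nat).
Hypothesis r_gt0 : 0 < r.
Hypothesis m_gt0 : (0 < m)%N.
Hypothesis al_gt0 : 0 < al.
Hypothesis al_lt1 : al < 1.
Local Notation w := (freq r).
Local Notation gx p i := (mesh w p * centred i).

(** The index is the integer part of X / h + p. *)
Lemma grid_approx p X : (3 <= p)%N -> `|X| < r ->
  exists i : 'I_(2 * p).+1, `|gx p i - X| <= mesh w p.
Proof.
move=> p3; rewrite ltr_norml => /andP[X1 X2]; have r0 := r_gt0.
have h0 := mesh_gt0 (freq_gt0 r_gt0) p.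
have P3 : 3 <= p%:R :> R by rewrite (ler_nat _ 3).
have hp : r <= mesh w p * p%:R.
  rewrite mesh_freq// mulrAC ler_pdivlMr; last lra.
  by nra.
set h := mesh w p in h0 hp *.
set y := X / h + p%:R.
have hy : h * y = X + h * p%:R by rewrite /y mulrDr mulrC divfK// gt_eqF.
have y0 : 0 <= y by rewrite -(pmulr_rge0 _ h0) hy; lra.
have y1 : y < (2 * p).+1%:R.
  rewrite -(ltr_pM2l h0) hy ME; have : h * (2 * p%:R + 1) = h * p%:R + (h * p%:R + h) by ring.
  by move=> ->; lra.
have /andP[t1 t2] := truncn_itv y0.
have tM : (Num.trunc y < (2 * p).+1)%N by rewrite -(ltr_nat R); exact: le_lt_trans y1.
exists (Ordinal tM); rewrite /centred /=.
have -> : h * ((Num.trunc y)%:R - p%:R) - X = h * ((Num.trunc y)%:R - y).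
  by rewrite mulrBr mulrBr hy; ring.
rewrite normrM (gtr0_norm h0) ler_piMr ?(ltW h0)// distrC ger0_norm ?subr_ge0//.
by move: t2; rewrite -natr1; lra.
Qed.

Lemma mesh_cvg0 (U : set_system nat) (FU : Filter U) : \oo `<=` U ->
  mesh w (n + 3)%N @[n --> U] --> (0 : R).
Proof.
move=> oU; have r0 := r_gt0.
have H : (12 * r) * (n.+1%:R^-1 : R) @[n --> \oo] --> (0 : R).
  by rewrite -(mulr0 (12 * r)); apply: cvgM; [exact: cvg_cst | exact: cvg_harmonic].
have {}H : (12 * r) * (n.+1%:R^-1 : R) @[n --> U] --> (0 : R).
  by move=> A /H; exact: oU.
apply: (squeeze_cvgr _ (cvg_cst 0) H); apply: nearW => n.
rewrite ltW ?mesh_gt0 ?freq_gt0//= mesh_freq//; apply: ler_wpM2l; first lra.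
have d1 : 0 < 2 * (n + 3)%:R + 1 :> R by have := ler0n R (n + 3); lra.
have d2 : 0 < n.+1%:R :> R by rewrite ltr0n.
rewrite lef_pV2 ?posrE//.
by rewrite natrD -natr1; have := ler0n R n; lra.
Qed.

Lemma cvg_row (d : nat) (U : set_system nat) (FU : Filter U)
    (v : nat -> 'rV[R]_d) (l : 'rV[R]_d) :
  (forall q, v n 0 q @[n --> U] --> l 0 q) -> v n @[n --> U] --> l.
Proof.
move=> H; apply/cvg_ballP => e e0.
have H1 q : U [set n | ball (l 0 q) e (v n 0 q)].
  by have /cvg_ballP/(_ e e0) := H q.
have := filter_forall FU H1; apply: filterS => n /= Hn.
by split => // i j; rewrite (ord1 i); exact: Hn.
Qed.

Variables (N d : nat) (F : 'I_N -> 'rV[R]_d -> R).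
Hypothesis F_C2 : forall l, class_C setT 2 (F l).
Hypothesis F0 : forall l, F l 0 = 0.
Hypothesis gradF0 : forall l q, partial q (F l) 0 = 0.
Variables (mask : 'I_d -> bool) (ia ib : 'I_d -> nat) (il : 'I_d -> 'I_N).
Hypothesis iab : forall q, mask q -> (ia q + ib q <= 2 * m)%N.

(** The limit, along an ultrafilter, of approximate solutions on grids of
    size tending to infinity with residuals tending to 0. At a point of the
    square, approached by grid points, the left-hand side converges by
    [sol_polylaplacian] and the right-hand side by continuity of [F]; the
    cut-off is invisible there. The radius kappa is chosen so that the
    contribution of [psi] to D_X^(2m-1) D_Y at 0 is at most eps / 2. *)
Theorem plane_solutions : exists2 eps0 : R, 0 < eps0 &
  forall eps, 0 < eps <= eps0 -> exists Psi : 'I_N -> nat -> nat -> R -> R -> R,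
  [/\ forall l, tower (2 * m) (Psi l),
      forall l a b X Y, (a + b <= 2 * m)%N ->
        (fun z : R * R => Psi l a b z.1 z.2) z @[z --> (X, Y)] --> Psi l a b X Y,
      forall l a b, (a + b = 2 * m)%N -> exists C : R, forall X Y X' Y',
        `|Psi l a b X Y - Psi l a b X' Y'| <= C * (`|X - X'| + `|Y - Y'|) `^ al &
      [/\ forall l a b, (a + b < 2 * m)%N -> Psi l a b 0 0 = 0,
          forall l, eps / 2 <= Psi l (2 * m).-1 1%N 0 0 <= 3 * eps / 2 &
          forall X Y, `|X| < r -> `|Y| < r -> forall l,
            iter m lap2 (Psi l) 0%N 0%N X Y =
            F l (\row_q if mask q then Psi (il q) (ia q) (ib q) X Y else 0)]].
Proof.
have m2 : (0 < 2 * m)%N by rewrite muln_gt0.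
have [D D0 DP] := Trig_inv_lap_sup r_gt0 m_gt0 (ltW al_gt0) al_lt1.
pose kappa : R := (2 * (D + 1))^-1.
have k0 : 0 < kappa by rewrite invr_gt0; lra.
have [eps0 e0 AP] := approximate_solutions r_gt0 m_gt0 F_C2 F0 gradF0 il iab k0.
exists eps0 => // eps eps_itv; have /andP[eps_gt0 _] := eps_itv.
have dpos n : 0 < (n.+1%:R^-1 : R) by rewrite invr_gt0 ltr0n.
have p3 n : (3 <= n + 3)%N by rewrite leq_addl.
pose fex n := cid (AP eps (n + 3)%N (n.+1%:R^-1) eps_itv (p3 n) (dpos n)).
pose f n := projT1 (fex n); have fP n : (forall l, energy 2 (dft (f n l)) <= (kappa * eps) ^+ 2) /\
    forall l x, `|f n l x - F l (vec (jet_slots r m mask ia ib il (f n) eps) x)| <= n.+1%:R^-1.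
  exact: projT2 (fex n).
pose c l n := dft (f n l).
have cB l n : energy 2 (c l n) <= (kappa * eps) ^+ 2 by exact: (fP n).1.
have [U [UU oU]] := ultrafilter_nat.
have FU : ProperFilter U := @ultra_proper _ _ UU.
pose Psi l := sol r m U (c l) eps.
exists Psi; split; last split.
- by move=> l; exact: (tower_sol r_gt0 m_gt0 al_gt0 al_lt1 UU (cB l)).
- by move=> l a b X Y ab; exact: (sol_continuous r_gt0 m_gt0 al_gt0 al_lt1 UU (cB l)).
- by move=> l a b ab; exact: (sol_holder r_gt0 m_gt0 al_gt0 al_lt1 UU (cB l)).
- by move=> l a b ab; exact: (sol_vanish r_gt0 m_gt0 al_gt0 al_lt1 U (cB l)).
- move=> l; rewrite /Psi (sol_top r_gt0 m_gt0 al_gt0 al_lt1 U (cB l)).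
  have ab : ((2 * m).-1 + 1 <= 2 * m)%N by lia.
  have small_psi : `|psi r m U (c l) (2 * m).-1 1%N 0 0| <= eps / 2.
    have cv := @psi_cvg _ _ _ _ r_gt0 m_gt0 al_gt0 al_lt1 _ UU _ _ _ (cB l) _ _ 0 0 ab.
    apply: (cvgr_to_le (cvg_norm cv)); apply: nearW => n.
    rewrite -(ler_pXn2r (n := 2)) ?nnegrE ?real_normK ?num_real//; last by lra.
    apply: (le_trans (DP _ (c l n) _ _ 0 0 ab)).
    apply: (le_trans (ler_wpM2l D0 (cB l n))).
    have D1 : D + 1 != 0 by rewrite gt_eqF; lra.
    have -> : D * (kappa * eps) ^+ 2 = (D / (D + 1) ^+ 2) * (eps / 2) ^+ 2.
      by rewrite /kappa; field.
    rewrite -[leRHS]mul1r; apply: ler_wpM2r; first exact: sqr_ge0.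
    rewrite ler_pdivrMr ?mul1r; first nra.
    by rewrite exprn_gt0//; lra.
  by move: small_psi; rewrite ler_norml => /andP[? ?]; apply/andP; split; lra.
move=> X Y Xr Yr l.
pose ix n := projT1 (cid (grid_approx (p3 n) Xr)).
have ixP n : `|gx (n + 3)%N (ix n) - X| <= _ := projT2 (cid (grid_approx (p3 n) Xr)).
pose iy n := projT1 (cid (grid_approx (p3 n) Yr)).
have iyP n : `|gx (n + 3)%N (iy n) - Y| <= _ := projT2 (cid (grid_approx (p3 n) Yr)).
pose Xn n := gx (n + 3)%N (ix n); pose Yn n := gx (n + 3)%N (iy n).
have h0 : mesh w (n + 3)%N @[n --> U] --> (0 : R) by exact: mesh_cvg0.
have cvX : Xn n @[n --> U] --> X.
  apply/cvgrPdist_le => e epos; move/cvgr0Pnorm_le : h0 => /(_ _ epos).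
  apply: filterS => n hn; rewrite distrC; apply: (le_trans (ixP n)).
  exact: le_trans (ler_norm _) hn.
have cvY : Yn n @[n --> U] --> Y.
  apply/cvgrPdist_le => e epos; move/cvgr0Pnorm_le : h0 => /(_ _ epos).
  apply: filterS => n hn; rewrite distrC; apply: (le_trans (iyP n)).
  exact: le_trans (ler_norm _) hn.
pose xn n : grid (n + 3)%N := (ix n, iy n).
have lhs : f n l (xn n) @[n --> U] --> iter m lap2 (Psi l) 0%N 0%N X Y.
  (* At grid points the interpolant takes the values of f. *)
  have E n : f n l (xn n) = Trig r (c l n) 0 0 (Xn n) (Yn n).
    rewrite -(synth_dft (f n l)) (@Trig_grid _ r r_gt0 _ (c l n) 0 0 (xn n)).
    congr synth; apply/funext => k; rewrite /diff_coef /mono -/(c l n).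
    case: (c l n k) => c1 c2 /=; rewrite mul0r cos0 sin0 !expr0.
    by congr pair; ring.
  under eq_fun do rewrite E.
  have [H H0 HP] := energy_holder r_gt0 m_gt0 al_gt0 al_lt1 (cB l).
  have HT n x y x' y' : `|Trig r (c l n) 0%N 0%N x y - Trig r (c l n) 0%N 0%N x' y'| <=
      H * (`|x - x'| + `|y - y'|) `^ al by exact: (HP n x y x' y').2.
  apply: (moving_cvg al_gt0 UU HT cvX cvY).
  exact: (sol_polylaplacian r_gt0 m_gt0 al_gt0 al_lt1 UU (cB l)).
have near_r (Zn : nat -> R) Z : `|Z| < r -> Zn n @[n --> U] --> Z ->
    \forall n \near U, `|Zn n| <= r.
  move=> Zr ZP; have rZ : 0 < r - `|Z| by rewrite subr_gt0.
  move/cvgrPdist_lt : ZP => /(_ _ rZ); apply: filterS => n hn.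
  have := ler_distD 0 (Zn n) Z; have := ler_normB Z (Z - Zn n).
  by rewrite opprB addrCA subrr addr0; lra.
have rhs : F l (vec (jet_slots r m mask ia ib il (f n) eps) (xn n)) @[n --> U] -->
    F l (\row_q if mask q then Psi (il q) (ia q) (ib q) X Y else 0).
  have Fc : {for (\row_q if mask q then Psi (il q) (ia q) (ib q) X Y else 0), continuous (F l)}.
    by have [_ H] := F_C2 l [::]; exact: H.
  pose vn n := vec (jet_slots r m mask ia ib il (f n) eps) (xn n).
  suff cvv : vn n @[n --> U] --> (\row_q if mask q then Psi (il q) (ia q) (ib q) X Y else 0).
    exact: (@continuous_cvg _ _ _ U _ vn (F l) _ Fc cvv).
  apply: cvg_row => q.
  under eq_fun do rewrite mxE; rewrite mxE /jet_slots.
  case E : (mask q); last exact: cvg_cst.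
  have := @Sol_moving_cvg _ _ _ _ r_gt0 m_gt0 al_gt0 al_lt1 _ UU _ _ _ (cB (il q)) eps _ _ _ _ _ _ (iab E) cvX cvY.
  apply: cvg_trans; apply: near_eq_cvg.
  apply: filterS2 (near_r _ _ Xr cvX) (near_r _ _ Yr cvY) => n hx hy.
  rewrite /grid_jet /Sol /Pol; congr (_ + _); apply: eq_bigr => s _; apply: eq_bigr => t _.
  by rewrite !cutmonoE.
have diff0 : f n l (xn n) - F l (vec (jet_slots r m mask ia ib il (f n) eps) (xn n)) @[n --> U] --> (0 : R).
  apply/cvgr0Pnorm_le => e epos.
  have : (n.+1%:R^-1 : R) @[n --> \oo] --> (0 : R) by exact: cvg_harmonic.
  move/cvgr0Pnorm_le => /(_ _ epos) /oU; apply: filterS => n hn.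
  apply: (le_trans ((fP n).2 l (xn n))); exact: le_trans (ler_norm _) hn.
have dd := @cvgB _ _ _ _ _ _ _ _ _ lhs rhs.
apply/eqP; rewrite -subr_eq0; apply/eqP.
exact: (@cvg_unique _ (@Rhausdorff R) _ _ _ _ (dd _) diff0).
Qed.

End PlaneSolutions.

(** * Derivatives are determined locally *)

Section LocalUniqueness.
Context {R : realType}.

Lemma tower_zero k : tower k (fun _ _ (_ _ : R) => 0 : R).
Proof. by move=> a b _ X Y; split; exact: is_derive_cst. Qed.

Lemma is_derive_local (f g : R -> R) (df dg rho X : R) : `|X| < rho ->
  (forall Z, `|Z| < rho -> f Z = g Z) ->
  is_derive X 1 f df -> is_derive X 1 g dg -> df = dg.
Proof.
move=> Xr fg [_ <-] [_ <-]; apply: near_eq_derive.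
exists (rho - `|X|); first by rewrite /= subr_gt0.
move=> Z /=; rewrite distrC => ZX; apply: fg.
have := ler_normD (Z - X) X; rewrite subrK; lra.
Qed.

(** Equality on a neighbourhood is inherited by derivatives. It separates
    the solutions, and shows that they do not vanish identically. *)
Lemma tower_local_eq k (phi chi : nat -> nat -> R -> R -> R) (rho : R) :
  tower k phi -> tower k chi ->
  (forall X Y, `|X| < rho -> `|Y| < rho -> phi 0%N 0%N X Y = chi 0%N 0%N X Y) ->
  forall a b, (a + b <= k)%N -> forall X Y, `|X| < rho -> `|Y| < rho ->
  phi a b X Y = chi a b X Y.
Proof.
move=> Hp Hc H0; elim=> [|a IHa] b; last first.
  move=> ab X Y Xr Yr.
  have [D1 _] := Hp a b ab X Y; have [D2 _] := Hc a b ab X Y.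
  apply: (is_derive_local Xr _ D1 D2) => Z Zr; apply: IHa => //; exact: ltnW.
elim: b => [|b IHb] ab X Y Xr Yr; first exact: H0.
have [_ D1] := Hp 0%N b ab X Y; have [_ D2] := Hc 0%N b ab X Y.
by apply: (is_derive_local Yr _ D1 D2) => Z Zr; apply: IHb => //; exact: ltnW.
Qed.

End LocalUniqueness.

(** * Functions of two of the coordinates *)

Section Lift.
Context {R : realType}.
Variables (n : nat) (i0 i1 : 'I_n).
Hypothesis i01 : i0 != i1.
Implicit Types phi : nat -> nat -> R -> R -> R.

Definition pull (f : R -> R -> R) (x : 'rV[R]_n) : R := f (x 0 i0) (x 0 i1).

Lemma is_derive_of_line (f : 'rV[R]_n -> R) (x v : 'rV[R]_n) (l : R) :
  is_derive (0 : R) 1 (fun t : R => f (x + t *: v)) l ->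
  derivable f x v /\ 'D_v f x = l.
Proof.
move=> [d e].
have E : (fun h : R => h^-1 *: (((fun t => f (x + t *: v)) \o shift 0) (h *: (1 : R))
              - f (x + 0 *: v)))
       = (fun h : R => h^-1 *: ((f \o shift x) (h *: v) - f x)).
  apply/funext => h /=; rewrite scale0r addr0; congr (_ *: (f _ - _)).
  by rewrite addrC; congr (_ *: v + _); exact: mulr1.
  by rewrite addr0.
split; first by rewrite /derivable -E.
by rewrite -e /derive E.
Qed.

Let is_derive_translate (g : R -> R) (x l : R) :
  is_derive x 1 g l -> is_derive (0 : R) 1 (fun t => g (x + t)) l.
Proof.
move=> H; have D : is_derive (0 : R) 1 (fun t : R => x + t) 1.
  have := @is_deriveD _ _ _ _ _ _ _ _ _ (is_derive_cst x (0:R) (1:R)) (is_derive_id (0:R) (1:R)); rewrite add0r; apply.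
rewrite -[l]mulr1; apply: (@is_derive1_comp R g _ 0 _ _ _ D).
by rewrite addr0.
Qed.

Let coordE (x : 'rV[R]_n) (t : R) (j i : 'I_n) :
  (x + t *: delta_mx 0 j) 0 i = x 0 i + t * (i == j)%:R.
Proof. by rewrite !mxE eqxx. Qed.

Lemma partial_pull (f fx fy : R -> R -> R) j x :
  (forall X Y : R, is_derive X 1 (f ^~ Y) (fx X Y) /\ is_derive Y 1 (f X) (fy X Y)) ->
  derivable (pull f) x (delta_mx 0 j) /\
  partial j (pull f) x =
    if j == i0 then pull fx x else if j == i1 then pull fy x else 0.
Proof.
move=> H; apply: is_derive_of_line.
have -> : (fun t : R => pull f (x + t *: delta_mx 0 j)) =
   (fun t => f (x 0 i0 + t * (i0 == j)%:R) (x 0 i1 + t * (i1 == j)%:R)).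
  by apply/funext => t; rewrite /pull !coordE.
case: (eqVneq j i0) => [->|j0].
  rewrite eq_sym (negbTE i01).
  under eq_fun do rewrite mulr1 mulr0 addr0.
  exact: is_derive_translate (H _ _).1.
case: (eqVneq j i1) => [_|_].
  under eq_fun do rewrite mulr0 addr0 mulr1.
  exact: is_derive_translate (H _ _).2.
under eq_fun do rewrite !mulr0 !addr0.
exact: is_derive_cst.
Qed.

(** A function of two coordinates is constant in the other directions: a
    derivative that involves another direction vanishes. *)
Definition active (s : seq 'I_n) : bool := all (fun i => (i == i0) || (i == i1)) s.

(** The value of an iterated partial derivative only depends on how often
    each of the two directions occurs in [s]. *)
Definition tval phi (s : seq 'I_n) : 'rV[R]_n -> R :=
  if active s then pull (phi (count_mem i0 s) (count_mem i1 s)) else fun=> 0.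

Lemma count_active s : active s -> (count_mem i0 s + count_mem i1 s = size s)%N.
Proof.
elim: s => [//|j s IH] /= /andP[j01 /IH <-].
have : ((j == i0) + (j == i1) = 1)%N.
  by case/orP: j01 => /eqP ->; rewrite eqxx ?(negbTE i01) // eq_sym (negbTE i01).
by move=> E; rewrite addnACA E add1n.
Qed.

Lemma partial_tval k phi s j x : tower k phi -> (size s < k)%N ->
  derivable (tval phi s) x (delta_mx 0 j) /\
  partial j (tval phi s) x = tval phi (j :: s) x.
Proof.
move=> T sk; rewrite /tval /=; case E : (active s); last first.
  rewrite andbF; split; first exact: derivable_cst.
  by rewrite /partial derive_cst.
have ab : (count_mem i0 s + count_mem i1 s < k)%N by rewrite count_active.
have [D1 D2] := partial_pull j x (T _ _ ab); split => //; rewrite D2 andbT.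
case: (eqVneq j i0) => [->|j0] /=; first by rewrite (negbTE i01) add1n add0n.
case: (eqVneq j i1) => [_|//] /=.
by rewrite add1n add0n.
Qed.

Lemma partials_pull k phi s : tower k phi -> (size s <= k)%N ->
  partials s (pull (phi 0%N 0%N)) = tval phi s.
Proof.
move=> T; elim: s => [//|j s IH] /= sk.
rewrite IH ?(ltnW sk)//; apply/funext => x.
exact: (partial_tval j x T sk).2.
Qed.

Lemma class_C_pull k phi W : tower k phi ->
  (forall a b X Y, (a + b <= k)%N ->
     (fun z : R * R => phi a b z.1 z.2) z @[z --> (X, Y)] --> phi a b X Y) ->
  class_C W k (pull (phi 0%N 0%N)).
Proof.
move=> T C s; split => [sk i x _|sk x _].
  by rewrite (partials_pull T (ltnW sk)); exact: (partial_tval i x T sk).1.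
rewrite (partials_pull T sk) /tval; case E : (active s); last exact: cst_continuous.
rewrite -(count_active E) in sk.
have P : (fun y : 'rV[R]_n => (y 0 i0, y 0 i1)) y @[y --> x] --> (x 0 i0, x 0 i1).
  exact: (cvg_pair (@coord_continuous _ _ _ 0 i0 x) (@coord_continuous _ _ _ 0 i1 x)).
exact: (cvg_comp _ _ P (C _ _ _ _ sk)).
Qed.

Lemma laplacian_pull phi : tower 2 phi ->
  laplacian (pull (phi 0%N 0%N)) = pull (lap2 phi 0%N 0%N).
Proof.
move=> T; apply/funext => x; rewrite /laplacian.
transitivity (\sum_(i < n) tval phi [:: i; i] x).
  by apply: eq_bigr => i _; rewrite -(partials_pull T).
rewrite (bigD1 i0) //= (bigD1 i1) 1?eq_sym //= big1 ?addr0.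
  by rewrite /tval /= !eqxx !orbT (eq_sym i1 i0) (negbTE i01).
move=> i /andP[/negbTE a /negbTE b]; by rewrite /tval /= a b.
Qed.

Lemma tower_le j k phi : (j <= k)%N -> tower k phi -> tower j phi.
Proof. by move=> jk T a b ab; apply: T; exact: leq_trans jk. Qed.

Lemma iter_laplacian_pull j phi : tower (2 * j) phi ->
  iter j (@laplacian R n) (pull (phi 0%N 0%N)) = pull (iter j lap2 phi 0%N 0%N).
Proof.
elim: j phi => [//|j IH] phi T; rewrite !iterSr laplacian_pull; last first.
  by apply: tower_le T; lia.
apply: IH; apply: tower_lap2; apply: tower_le T; lia.
Qed.

(** The sequence of directions behind [Dmulti]. *)
Definition dseq (b : 'I_n -> nat) : seq 'I_n := flatten [seq nseq (b i) i | i <- enum 'I_n].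

Lemma size_dseq b : size (dseq b) = mlen b.
Proof.
rewrite size_flatten /shape -map_comp sumnE big_map big_enum /=.
by apply: eq_bigr => i _; rewrite size_nseq.
Qed.

Lemma count_dseq b i : count_mem i (dseq b) = b i.
Proof.
rewrite count_flatten -map_comp sumnE big_map big_enum /=.
rewrite (bigD1 i) //= count_nseq /= eqxx mul1n big1 ?addn0// => j ji.
by rewrite count_nseq /= (negbTE ji) mul0n.
Qed.

Lemma Dmulti_pull k phi b x : tower k phi -> (mlen b <= k)%N ->
  Dmulti b (pull (phi 0%N 0%N)) x =
  if active (dseq b) then phi (b i0) (b i1) (x 0 i0) (x 0 i1) else 0.
Proof.
move=> T bk; rewrite /Dmulti -/(dseq b) (partials_pull T) ?size_dseq// /tval.
by case: (active _); rewrite ?count_dseq.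
Qed.

Lemma two_le_mlen (b : 'I_n -> nat) : (b i0 + b i1 <= mlen b)%N.
Proof.
by rewrite /mlen (bigD1 i0) //= (bigD1 i1) 1?eq_sym //= addnA leq_addr.
Qed.

Lemma active_mlen b : active (dseq b) -> (b i0 + b i1 = mlen b)%N.
Proof. by move=> /count_active; rewrite !count_dseq size_dseq. Qed.

Lemma coord_le_enorm (x : 'rV[R]_n) i : `|x 0 i| <= enorm x.
Proof.
rewrite -sqrtr_sqr /enorm ler_wsqrtr//.
by apply: (@ler_term _ _ (fun i => x 0 i ^+ 2)) => j; exact: sqr_ge0.
Qed.

Definition planar (X Y : R) : 'rV[R]_n := X *: delta_mx 0 i0 + Y *: delta_mx 0 i1.

Lemma planar0 X Y : planar X Y 0 i0 = X.
Proof. by rewrite !mxE !eqxx (negbTE i01) mulr1 mulr0 addr0. Qed.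

Lemma planar1 X Y : planar X Y 0 i1 = Y.
Proof. by rewrite !mxE !eqxx eq_sym (negbTE i01) mulr1 mulr0 add0r. Qed.

Lemma enorm_planar X Y : enorm (planar X Y) = Num.sqrt (X ^+ 2 + Y ^+ 2).
Proof.
rewrite /enorm (bigD1 i0) //= (bigD1 i1) 1?eq_sym //= planar0 planar1.
rewrite big1 ?addr0// => i /andP[/negbTE a /negbTE b].
by rewrite !mxE eqxx a b !mulr0 addr0 expr0n.
Qed.

End Lift.

(** * Solutions in the ball *)

Section MainProof.
Context {R : realType}.
Variables (n N : nat) (i0 i1 : 'I_n).
Hypothesis i01 : i0 != i1.

Definition lifted (Psi : 'I_N -> nat -> nat -> R -> R -> R) (x : 'rV[R]_n) : 'rV[R]_N :=
  \row_l pull i0 i1 (Psi l 0%N 0%N) x.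

Lemma coordf_lifted Psi l : coordf (lifted Psi) l = pull i0 i1 (Psi l 0%N 0%N).
Proof. by apply/funext => x; rewrite /coordf mxE. Qed.

Lemma holder_pull k phi al W b : 0 <= al -> tower k phi -> mlen b = k ->
  (active i0 i1 (dseq b) -> exists C : R, forall X Y X' Y',
     `|phi (b i0) (b i1) X Y - phi (b i0) (b i1) X' Y'|
       <= C * (`|X - X'| + `|Y - Y'|) `^ al) ->
  holder_on W al (Dmulti b (pull i0 i1 (phi 0%N 0%N))).
Proof.
move=> al0 T bk H.
have D x := Dmulti_pull i01 x T (eq_leq bk).
case E : (active i0 i1 (dseq b)) H; last first.
  by move=> _; exists 0 => x y _ _; rewrite !D E subrr normr0 mul0r.
move=> /(_ isT)[C HC]; exists (`|C| * 2 `^ al) => x y _ _; rewrite !D E.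
apply: (le_trans (HC _ _ _ _)); rewrite -mulrA.
have e0 : 0 <= enorm (x - y) by exact: sqrtr_ge0.
have P0 : 0 <= `|x 0 i0 - y 0 i0| + `|x 0 i1 - y 0 i1| by rewrite addr_ge0.
apply: (@le_trans _ _ (`|C| * (`|x 0 i0 - y 0 i0| + `|x 0 i1 - y 0 i1|) `^ al)).
  by rewrite ler_wpM2r ?powR_ge0// ler_norm.
rewrite ler_wpM2l// -powRM//; apply: ge0_ler_powR => //.
  by rewrite nnegrE mulr_ge0.
have := lerD (coord_le_enorm (x - y) i0) (coord_le_enorm (x - y) i1).
rewrite !mxE; lra.
Qed.

Lemma lifted_regular m (al : R) Psi W : 0 < al ->
  (forall l, tower (2 * m) (Psi l)) ->
  (forall l a b X Y, (a + b <= 2 * m)%N ->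
     (fun z : R * R => Psi l a b z.1 z.2) z @[z --> (X, Y)] --> Psi l a b X Y) ->
  (forall l a b, (a + b = 2 * m)%N -> exists C : R, forall X Y X' Y',
     `|Psi l a b X Y - Psi l a b X' Y'| <= C * (`|X - X'| + `|Y - Y'|) `^ al) ->
  forall l, class_C_holder W (2 * m) al (coordf (lifted Psi) l).
Proof.
move=> al0 T C H l; rewrite coordf_lifted; split.
  by apply: class_C_pull => // a b X Y; exact: C.
move=> b bk; apply: (holder_pull W (ltW al0) (T l) bk) => E.
by apply: H; rewrite (active_mlen i01 E).
Qed.

Lemma lifted_vanishing m Psi : (1 <= m)%N -> (0 < N)%N ->
  (forall l, tower (2 * m) (Psi l)) ->
  (forall l a b, (a + b < 2 * m)%N -> Psi l a b 0 0 = 0) ->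
  (forall l, Psi l (2 * m).-1 1%N 0 0 != 0) ->
  vanishing_order0 (lifted Psi) (2 * m).
Proof.
move=> m1 N1 T V nz; split => [b c bm|].
  rewrite coordf_lifted (Dmulti_pull i01 _ (T c) (ltnW bm)) !mxE.
  case: ifP => // _; apply: V; apply: leq_ltn_trans bm; exact: two_le_mlen.
pose b i := (if i == i0 then (2 * m).-1 else if i == i1 then 1 else 0)%N.
have b0 : b i0 = (2 * m).-1 by rewrite /b eqxx.
have b1 : b i1 = 1%N by rewrite /b eq_sym (negbTE i01) eqxx.
have bm : mlen b = (2 * m)%N.
  rewrite /mlen (bigD1 i0) //= (bigD1 i1) 1?eq_sym //= b0 b1 big1 ?addn0; first lia.
  by move=> i /andP[/negbTE ii0 /negbTE ii1]; rewrite /b ii0 ii1.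
exists b, (Ordinal N1); split=> //.
rewrite coordf_lifted (Dmulti_pull i01 _ (T _)) ?bm// !mxE b0 b1.
suff -> : active i0 i1 (dseq b) by apply/eqP.
apply/allP => i; rewrite -has_pred1 has_count count_dseq /b.
by case: (i == i0) => //; case: (i == i1).
Qed.

Lemma planar_in_ball (r X Y : R) : 0 < r -> `|X| < r / 2 -> `|Y| < r / 2 ->
  eball n r (planar i0 i1 X Y).
Proof.
move=> r0 Xr Yr; rewrite /eball /= enorm_planar//.
rewrite -(ger0_norm (ltW r0)) -sqrtr_sqr ltr_sqrt ?exprn_gt0//.
rewrite -[X ^+ 2]real_normK ?num_real// -[Y ^+ 2]real_normK ?num_real//.
have := normr_ge0 X; have := normr_ge0 Y; nra.
Qed.

(** If the solution were radial, its value at a point of the ball would be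
    its value at the point of the third axis with the same norm, which is
    its value at 0, namely 0. Hence it would vanish on the ball, and so
    would its derivatives at 0. *)
Lemma lifted_not_radial i2 k Psi r a b l : i0 != i2 -> i1 != i2 -> 0 < r -> (a + b <= k)%N ->
  (forall l, tower k (Psi l)) -> Psi l 0%N 0%N 0 0 = 0 ->
  Psi l a b 0 0 != 0 -> ~ radial_on (eball n r) (lifted Psi).
Proof.
move=> i02 i12 r0 ab T V nz [g Hg].
have Z x : eball n r x -> Psi l 0%N 0%N (x 0 i0) (x 0 i1) = 0.
  move=> xr; pose y : 'rV[R]_n := planar i2 i0 (enorm x) 0.
  have e0 : 0 <= enorm x by exact: sqrtr_ge0.
  have i20 : i2 != i0 by rewrite eq_sym.
  have ey : enorm y = enorm x.
    by rewrite enorm_planar// expr0n addr0 sqrtr_sqr ger0_norm.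
  have yr : eball n r y by rewrite /eball /= ey.
  have := congr1 (fun v : 'rV_N => v 0 l) (etrans (Hg x xr) (esym _ : _ = lifted Psi y)).
  rewrite !mxE /pull; move=> -> //; last by rewrite (Hg y yr) ey.
  have -> : y 0 i0 = 0 by rewrite planar1.
  suff -> : y 0 i1 = 0 by [].
  by rewrite !mxE (negbTE i12) [i1 == i0]eq_sym (negbTE i01) !andbF !mulr0 addr0.
move/eqP: nz; apply.
have r2 : `|0 : R| < r / 2 by rewrite normr0 divr_gt0.
refine (tower_local_eq (T l) (@tower_zero R k) _ ab r2 r2) => X Y Xr Yr.
by have := Z _ (planar_in_ball r0 Xr Yr); rewrite planar0 // planar1.
Qed.

Lemma lifted_eq_on_ball k Psi Psi' r l a b : 0 < r -> (a + b <= k)%N ->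
  (forall l, tower k (Psi l)) -> (forall l, tower k (Psi' l)) ->
  (forall x, eball n r x -> lifted Psi x = lifted Psi' x) ->
  Psi l a b 0 0 = Psi' l a b 0 0.
Proof.
move=> r0 ab T T' E.
have r2 : `|0 : R| < r / 2 by rewrite normr0 divr_gt0.
apply: (tower_local_eq (T l) (T' l) _ ab r2 r2) => X Y Xr Yr.
have := E _ (planar_in_ball r0 Xr Yr).
by move/(congr1 (fun v : 'rV_N => v 0 l)); rewrite !mxE /pull planar0 ?planar1.
Qed.

Section System.
Variables (m : nat) (a : 'rV[R]_(jet_dim n N (2 * m)) -> 'rV[R]_N).

Let idx (q : 'I_(jet_dim n N (2 * m))) := val (enum_val q : jet_index n N (2 * m)).
Definition planar_slot q : bool := active i0 i1 (dseq (fun i => (idx q).1 i : nat)).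
Definition order0 q : nat := (idx q).1 i0.
Definition order1 q : nat := (idx q).1 i1.
Definition component q : 'I_N := (idx q).2.

Lemma orders_le q : (order0 q + order1 q <= 2 * m)%N.
Proof.
apply: leq_trans (valP (enum_val q : jet_index n N (2 * m))).
exact: (two_le_mlen i01 (fun i => (idx q).1 i : nat)).
Qed.

Lemma lifted_jet Psi x : (forall l, tower (2 * m) (Psi l)) ->
  jet (2 * m) (lifted Psi) x =
  \row_q if planar_slot q then
           Psi (component q) (order0 q) (order1 q) (x 0 i0) (x 0 i1) else 0.
Proof.
move=> T; apply/rowP => q; rewrite !mxE; lazy zeta; rewrite coordf_lifted.
apply: (Dmulti_pull i01 x (T _)); exact: valP (enum_val q : jet_index n N (2 * m)).
Qed.

Lemma lifted_equation Psi r : (forall l, tower (2 * m) (Psi l)) ->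
  (forall X Y, `|X| < r -> `|Y| < r -> forall l,
     iter m lap2 (Psi l) 0%N 0%N X Y =
     coordf a l (\row_q if planar_slot q then
                         Psi (component q) (order0 q) (order1 q) X Y else 0)) ->
  forall x, eball n r x ->
    laplacian_iter m (lifted Psi) x = a (jet (2 * m) (lifted Psi) x).
Proof.
move=> T H x xr; apply/rowP => l; rewrite mxE coordf_lifted.
rewrite iter_laplacian_pull// /pull H ?lifted_jet//.
  exact: le_lt_trans (coord_le_enorm x i0) xr.
exact: le_lt_trans (coord_le_enorm x i1) xr.
Qed.

End System.

End MainProof.

Theorem theorem1p3 (R : realType) (n N m : nat) (al : R)
    (n_ge3 : (3 <= n)%N) (N_ge1 : (1 <= N)%N) (m_ge1 : (1 <= m)%N)
    (al_gt0 : 0 < al) (al_lt1 : al < 1)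
    (a : 'rV[R]_(jet_dim n N (2 * m)) -> 'rV[R]_N)
    (a_C2 : forall l : 'I_N, class_C setT 2 (coordf a l))
    (a_0 : a 0 = 0)
    (grad_a_0 : forall (l : 'I_N) (q : 'I_(jet_dim n N (2 * m))),
        partial q (coordf a l) 0 = 0)
    (r : R) (r_gt0 : 0 < r) :
  exists S : set ('rV[R]_n -> 'rV[R]_N),
    (* infinitely many, as functions on the ball *)
    infinite_set [set u \_ (eball n r) | u in S] /\
    forall u, S u ->
      [/\ forall l : 'I_N, class_C_holder (eball n r) (2 * m) al (coordf u l),
          forall x, eball n r x ->
            laplacian_iter m u x = a (jet (2 * m) u x),
          vanishing_order0 u (2 * m)
        & ~ radial_on (eball n r) u].
Proof.
pose i0 : 'I_n := Ordinal (leq_trans (isT : (0 < 3)%N) n_ge3).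
pose i1 : 'I_n := Ordinal (leq_trans (isT : (1 < 3)%N) n_ge3).
pose i2 : 'I_n := Ordinal n_ge3.
have i01 : i0 != i1 by []. have i02 : i0 != i2 by []. have i12 : i1 != i2 by [].
have a0 l : coordf a l 0 = 0 by rewrite /coordf a_0 mxE.
have m2 : (((2 * m).-1 + 1) = 2 * m)%N by lia.
have [e0 e0_gt0 Hsol] := plane_solutions r_gt0 m_ge1 al_gt0 al_lt1 a_C2 a0 grad_a_0
  (@component n N m) (fun q (_ : planar_slot i0 i1 q) => orders_le i01 q).
pose eps (j : nat) := e0 * 4^-1 ^+ j.
have q4 : 0 < (4^-1 : R) by rewrite invr_gt0.
have q1 : (4^-1 : R) < 1 by rewrite invf_lt1 ?ltr1n.
have eps_gt0 j : 0 < eps j by rewrite mulr_gt0// exprn_gt0.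
have eps_le j : eps j <= e0.
  by rewrite ger_pMr// exprn_ile1// ltW.
(* A ratio of 4 between successive parameters separates the intervals [eps
   / 2, 3 eps / 2]. *)
have eps_lt j k : (j < k)%N -> 4 * eps k <= eps j.
  move=> jk; rewrite /eps mulrCA ler_pM2l// -(subnKC jk) addSn exprS mulVKf ?pnatr_eq0//.
  by rewrite exprD ger_pMr ?exprn_gt0// exprn_ile1// ltW.
pose sol j := Hsol (eps j) (introT andP (conj (eps_gt0 j) (eps_le j))).
have [Psi HPsi] := choice sol.
pose U j := lifted i0 i1 (Psi j).
exists (range U); split; last first.
  move=> _ [j _ <-]; have [T C H [V bnd Eq]] := HPsi j.
  have nz l : Psi j l (2 * m).-1 1%N 0 0 != 0.
    by have /andP[lo _] := bnd l; rewrite gt_eqF// (lt_le_trans _ lo)// divr_gt0.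
  split.
  - exact: lifted_regular.
  - exact: lifted_equation.
  - exact: lifted_vanishing.
  - apply: (@lifted_not_radial _ _ _ _ _ i01 i2 (2 * m) _ _ (2 * m).-1 1%N (Ordinal N_ge1)) => //.
      by rewrite m2.
    by apply: V; lia.
suff inj : {in [set: nat] &, injective (fun j => U j \_ (eball n r))}.
  by rewrite image_comp; rewrite (eq_finite_set (inj_card_eq inj)); exact: infinite_nat.
suff ne j k : (j < k)%N -> U j \_ (eball n r) <> U k \_ (eball n r).
  move=> j k _ _ E; case: (ltngtP j k) => [/ne|/ne|] //.
  by move/(_ (esym E)).
move=> jk E.
have EB x : eball n r x -> U j x = U k x.
  by move=> xr; have := congr1 (fun u => u x) E; rewrite !patchE mem_set.
have [Tj _ _ [_ /(_ (Ordinal N_ge1))/andP[lo _] _]] := HPsi j.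
have [Tk _ _ [_ /(_ (Ordinal N_ge1))/andP[_ up] _]] := HPsi k.
have := lifted_eq_on_ball i01 (Ordinal N_ge1) r_gt0 (eq_leq m2) Tj Tk EB.
have := eps_lt j k jk; have := eps_gt0 k; move: lo up; rewrite -/(Psi _) -/(Psi _); lra.
Qed.
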